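(* If $\tilde L$ is a selfadjoint extension of the minimal operator $L_0$ in $L^2$, then $\tilde L$ is generated by the differential expression $\tilde l(u)=(iu_1'+\tilde Au_1,\ iu_2'+\tilde Au_2)$ and the boundary condition $$u_2(b)=W\,u_1(a),$$ where $W:H\to H$ is a unitary operator; that is, $\tilde L=L_W$. Moreover, the unitary operator $W$ in $H$ is determined uniquely by the extension $\tilde L$; and vice versa, for every unitary operator $W:H\to H$ the operator $L_W$ is a selfadjoint extension of $L_0$ in $L^2$.
   Context: Setting. $H\neq\{0\}$ is a separable complex Hilbert space (inner products are linear in the first argument), $a<b$ are real numbers, and $A:D(A)\subset H\to H$ is a linear selfadjoint (possibly unbounded) operator. Put $L^2:=L^2(H,(-\infty,a))\oplus L^2(H,(b,+\infty))$ (direct sum of spaces of square-integrable $H$-valued functions). Let $H_+=D(A)$ with inner product $(f,g)_+=(Af,Ag)_H+(f,g)_H$, let $H_-$ be the corresponding negative-norm space (the dual of $H_+$ with respect to $H$), and let $\tilde A:H\to H_-$ be the continuous extension of $A$ (the adjoint of the continuous operator $A:H_+\to H$). Consider the differential expression $$\tilde l(u)=(\tilde l_1(u_1),\tilde l_2(u_2))=(iu_1'+\tilde A u_1,\ iu_2'+\tilde A u_2),\quad u=(u_1,u_2).$$ Minimal and maximal operators. On $I_1=(-\infty,a)$ and $I_2=(b,+\infty)$ let $\mathcal T_k$ be the set of finite sums of functions $\varphi(t)f$ with $\varphi\in C_0^\infty(I_k)$, $f\in D(A)$. The minimal operator $L_{k0}$ is the closure in $L^2(H,I_k)$ of the operator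 $\phi\mapsto i\phi'+A\phi$ on $\mathcal T_k$. The maximal operator is $L_k=L_{k0}^*$: $u\in D(L_k)$ with $L_ku=g$ iff $u,g\in L^2(H,I_k)$ and $\int_{I_k}(u,i\phi'+A\phi)_H\,dt=\int_{I_k}(g,\phi)_H\,dt$ for all $\phi\in\mathcal T_k$ (i.e. $i u'+\tilde A u=g$ in the weak sense). Set $L_0=L_{10}\oplus L_{20}$ and $L=L_1\oplus L_2$ in $L^2$; $L_0$ is closed symmetric and $L_0^*=L$. Each $u=(u_1,u_2)\in D(L)$ has a representative with $u_1$ continuous from $(-\infty,a]$ to $H$ and $u_2$ continuous from $[b,+\infty)$ to $H$; $u_1(a)$ and $u_2(b)$ denote the values of this representative. For a unitary operator $W:H\to H$, the operator generated by $\tilde l$ and the boundary condition $u_2(b)=Wu_1(a)$ is $L_W$ (also written $L(W)$), the restriction of $L$ to $D(L_W)=\{u=(u_1,u_2)\in D(L):\ u_2(b)=Wu_1(a)\}$. *)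

(* Defs.v *)
From HB Require Import structures.
From mathcomp Require Import all_boot all_order all_algebra.
From mathcomp Require Export sesquilinear ring_quotient.
From mathcomp Require Import all_classical all_reals all_analysis
  measurable_realfun.
From mathcomp Require Export complex.
From mathcomp Require Import ring.

Set Implicit Arguments.
Unset Strict Implicit.
Unset Printing Implicit Defensive.

Import Order.TTheory GRing.Theory Num.Theory.
Import numFieldNormedType.Exports.
Local Open Scope classical_set_scope.
Local Open Scope ring_scope.
Local Open Scope complex_scope.

(* Unbounded operators, identified with their graphs *)
Section Operators.
Context {R : realType}.

Definition ip_norm (X : lmodType R[i]) (ip : X -> X -> R[i]) (x : X) : R :=
  Num.sqrt (complex.Re (ip x x)).

Definition densely_defined (X : lmodType R[i]) (ip : X -> X -> R[i])
    (G : set (X * X)) : Prop :=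
  forall (x : X) (e : R), 0 < e ->
    exists p, G p /\ ip_norm ip (x - p.1) < e.

Definition linear_operator (X : lmodType R[i]) (G : set (X * X)) : Prop :=
  [/\ G 0,
      forall (c : R[i]) p q, G p -> G q -> G (c *: p + q)
    & forall x y z, G (x, y) -> G (x, z) -> y = z].

Definition adjoint (X : lmodType R[i]) (ip : X -> X -> R[i])
    (G : set (X * X)) : set (X * X) :=
  [set p | forall q, G q -> ip p.1 q.2 = ip p.2 q.1].

Definition selfadjoint (X : lmodType R[i]) (ip : X -> X -> R[i])
    (G : set (X * X)) : Prop :=
  [/\ linear_operator G, densely_defined ip G & adjoint ip G = G].

Definition operator_closure (X : lmodType R[i]) (ip : X -> X -> R[i])
    (G : set (X * X)) : set (X * X) :=
  [set p | forall e : R, 0 < e -> exists q, [/\ G q,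
     ip_norm ip (p.1 - q.1) < e & ip_norm ip (p.2 - q.2) < e]].

Definition unitary (X : lmodType R[i]) (ip : X -> X -> R[i]) (W : X -> X) :=
  [/\ linear W,
      forall x y, ip (W x) (W y) = ip x y
    & forall y, exists x, W x = y].

Definition sum_ip (X1 X2 : lmodType R[i]) (ip1 : X1 -> X1 -> R[i])
    (ip2 : X2 -> X2 -> R[i]) (u v : X1 * X2) : R[i] :=
  ip1 u.1 v.1 + ip2 u.2 v.2.

Definition operator_sum (X1 X2 : lmodType R[i]) (G1 : set (X1 * X1))
    (G2 : set (X2 * X2)) : set ((X1 * X2) * (X1 * X2)) :=
  [set p | G1 (p.1.1, p.2.1) /\ G2 (p.1.2, p.2.2)].

End Operators.

Section SquareIntegrable.
Context {R : realType} (H : normedModType R[i]) (I : interval R).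
Local Notation mu := (@lebesgue_measure R).

(* The norm of H takes its values in R[i]. *)
Definition rnorm (x : H) : R := complex.Re `|x|.

Definition simple_on (s : R -> H) : Prop :=
  finite_set (s @` [set` I]) /\
  forall h, measurable ([set` I] `&` s @^-1` [set h]).

(* Pointwise limits on I of simple functions with Borel level sets. Asking for
   convergence at every point of I, rather than almost every one, leaves the
   classes modulo equality almost everywhere unchanged. *)
Definition strongly_measurable (f : R -> H) : Prop :=
  exists s : nat -> R -> H, (forall n, simple_on (s n)) /\
    forall t, t \in I -> s n t @[n --> \oo] --> f t.

Definition square_integrable (f : R -> H) : Prop :=
  strongly_measurable f /\
  (\int[mu]_(t in [set` I]) ((rnorm (f t)) ^+ 2)%:E < +oo)%E.

Lemma rnormE x : (rnorm x)%:C = `|x|.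
Proof. by rewrite /rnorm RRe_real// normr_real. Qed.

Lemma rnorm_ge0 x : 0 <= rnorm x.
Proof. by rewrite -lecR rnormE normr_ge0. Qed.

Lemma rnormD x y : rnorm (x + y) <= rnorm x + rnorm y.
Proof. by rewrite -lecR rmorphD /= !rnormE ler_normD. Qed.

Lemma rnormZ c x : rnorm (c *: x) = complex.Re `|c| * rnorm x.
Proof.
have cE : (complex.Re `|c|)%:C = `|c| by rewrite RRe_real// normr_real.
by apply: (@complexI R); rewrite rmorphM /= !rnormE normrZ cE.
Qed.

Lemma rnorm_dist x y : `|rnorm x - rnorm y| <= rnorm (x - y).
Proof.
have h z w : rnorm z <= rnorm (z - w) + rnorm w.
  by rewrite -[X in X <= _](congr1 rnorm (subrK w z)) rnormD.
have hN z : rnorm (- z) = rnorm z by rewrite /rnorm normrN.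
have := h x y; have := h y x.
rewrite -[rnorm (y - x)]hN opprB ler_norml => h1 h2.
by rewrite lerBlDr h2 andbT lerNl opprB lerBlDr.
Qed.

Lemma cvg_rnorm (u : nat -> H) (l : H) :
  u n @[n --> \oo] --> l -> rnorm (u n) @[n --> \oo] --> rnorm l.
Proof.
move=> ul; apply/cvgrPdist_lt => e e0.
have eC : 0 < e%:C by rewrite ltcR.
have /cvgrPdist_lt/(_ _ eC) := ul.
apply: filterS => n; rewrite -rnormE ltcR.
exact/le_lt_trans/rnorm_dist.
Qed.

Lemma simple_on_preimage s (P : set H) : simple_on s ->
  measurable ([set` I] `&` s @^-1` P).
Proof.
move=> [fs ms].
have -> : [set` I] `&` s @^-1` P =
    \bigcup_(v in s @` [set` I] `&` P) ([set` I] `&` s @^-1` [set v]).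
  apply/seteqP; split=> [t [tI Pt]|t [v [_ Pv] [tI /= stv]]].
    by exists (s t) => //; split=> //; exists t.
  by split=> //=; rewrite stv.
by apply: fin_bigcup_measurable => //; exact: finite_setIl.
Qed.

Lemma simple_onZD c s s' : simple_on s -> simple_on s' ->
  simple_on (c *: s + s').
Proof.
move=> hs hs'; split.
  apply: (@sub_finite_set _ _ [set c *: x + y | x in s @` [set` I]
                                               & y in s' @` [set` I]]).
    by move=> _ [t tI <-]; exists (s t); [exists t|exists (s' t); [exists t|]].
  by apply: finite_image2; [exact: hs.1|exact: hs'.1].
move=> h.
have -> : [set` I] `&` (c *: s + s') @^-1` [set h] =
    \bigcup_(v in s @` [set` I]) (([set` I] `&` s @^-1` [set v]) `&`
      ([set` I] `&` s' @^-1` [set h - c *: v])).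
  apply/seteqP; split=> [t [tI /= <-]|t [v _ [[tI /= sv] [_ /= s'v]]]].
    by exists (s t); [exists t|split; split=> //=; rewrite addrAC subrr add0r].
  by split=> //=; rewrite !fctE sv s'v addrC subrK.
apply: fin_bigcup_measurable; first exact: hs.1.
by move=> v _; apply: measurableI; [exact: hs.2|exact: hs'.2].
Qed.

Lemma strongly_measurable_rnorm f : strongly_measurable f ->
  measurable_fun [set` I] (rnorm \o f).
Proof.
move=> [s [ss sf]].
apply: (@measurable_fun_cvg _ _ _ _ (fun n => rnorm \o s n)).
- by move=> n _ Y _; exact: (@simple_on_preimage _ (rnorm @^-1` Y)).
- by move=> t /= tI; apply: cvg_rnorm; exact: sf.
Qed.

Definition sq_integrable_pred : {pred (R -> H)} := mem [set f | square_integrable f].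

Lemma sq_integrable_submod_closed : submod_closed sq_integrable_pred.
Proof.
split=> [|c f g].
  rewrite inE; split.
    exists (fun _ => 0); split=> [_|t _]; last exact: cvg_cst.
    split.
      apply: (@sub_finite_set _ _ [set 0]); last exact: finite_set1.
      by move=> _ [t _ <-].
    move=> h; have [->|h0] := eqVneq h 0.
      by rewrite (_ : _ @^-1` _ = setT) ?setIT; [exact: measurable_itv|exact/seteqP].
    rewrite (_ : _ @^-1` _ = set0) ?setI0//; apply/seteqP; split=> // t /= h0'.
    by move: h0; rewrite -h0' eqxx.
  under eq_integral do rewrite /rnorm normr0 /= expr0n /=.
  by rewrite integral0.
rewrite !inE => -[mf If] [mg Ig].
have mZ : strongly_measurable (c *: f + g).
  move: mf mg => [s [ss sf]] [s' [ss' sg]].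
  exists (fun n => c *: s n + s' n); split=> [n|t tI].
    exact: simple_onZD.
  by apply: cvgD; [apply: cvgZr; exact: sf|exact: sg].
split=> //.
pose k := complex.Re `|c|.
have mq h : strongly_measurable h ->
    measurable_fun [set` I] (fun t => ((rnorm (h t)) ^+ 2)%:E).
  move=> mh; apply/measurable_EFinP.
  exact: measurable_funX (strongly_measurable_rnorm mh).
have k0 : 0 <= 2 * k ^+ 2 by rewrite mulr_ge0 ?sqr_ge0.
pose F t := ((2 * k ^+ 2)%:E * ((rnorm (f t)) ^+ 2)%:E
             + 2%:E * ((rnorm (g t)) ^+ 2)%:E)%E.
apply: (@le_lt_trans _ _ (\int[mu]_(t in [set` I]) F t)%E).
  apply: ge0_le_integral => //=.
  - by move=> t _; rewrite lee_fin sqr_ge0.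
  - exact: mq.
  - by apply: emeasurable_funD; apply: measurable_funeM; exact: mq.
  - move=> t _; rewrite /F -!EFinM -EFinD lee_fin fctE.
    have h1 := rnormD (c *: f t) (g t).
    have h0 := rnorm_ge0 (c *: f t + g t).
    apply: (@le_trans _ _ ((rnorm (c *: f t) + rnorm (g t)) ^+ 2)).
      by rewrite lerXn2r ?nnegrE ?addr_ge0 ?rnorm_ge0.
    rewrite rnormZ -/k; set x := rnorm (f t); set y := rnorm (g t).
    rewrite -subr_ge0.
    by rewrite (_ : _ - _ = (k * x - y) ^+ 2) ?sqr_ge0//; ring.
have I0 h t : [set` I] t -> (0 <= ((rnorm (h t)) ^+ 2)%:E)%E.
  by move=> _; rewrite lee_fin sqr_ge0.
rewrite ge0_integralD//=.
- rewrite !ge0_integralZl//; [|exact: mq|exact: I0|exact: mq|exact: I0].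
  by rewrite lte_add_pinfty// lte_mul_pinfty// lee_fin.
- by move=> t tI; rewrite mule_ge0// ?I0// lee_fin.
- by apply: measurable_funeM; exact: mq.
- by move=> t tI; rewrite mule_ge0// I0.
- by apply: measurable_funeM; exact: mq.
Qed.

HB.instance Definition _ :=
  GRing.isSubmodClosed.Build R[i] (R -> H) sq_integrable_pred
    sq_integrable_submod_closed.

Record sq_integrable_fun := SqIntegrableFun {
  sq_fun :> R -> H ; _ : sq_fun \in sq_integrable_pred }.

HB.instance Definition _ := [isSub for sq_fun].
HB.instance Definition _ := [Choice of sq_integrable_fun by <:].
HB.instance Definition _ :=
  [SubChoice_isSubLmodule of sq_integrable_fun by <:].

Definition null_pred : {pred sq_integrable_fun} :=
  mem [set f : sq_integrable_fun |
         {ae mu, forall t, [set` I] t -> f t = 0}].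

Lemma null_submod_closed : submod_closed null_pred.
Proof.
split=> [|c f g]; rewrite !inE /=.
  exact: aeW.
apply: filterS2; first exact: (ae_filter_ringOfSetsType mu).
by move=> t f0 g0 tI; rewrite !fctE f0// g0// scaler0 addr0.
Qed.

HB.instance Definition _ :=
  GRing.isSubmodClosed.Build R[i] sq_integrable_fun null_pred
    null_submod_closed.

(* L^2(H, I): square-integrable functions modulo equality almost everywhere *)
Definition L2 : Type := Quotient.quot null_pred.

HB.instance Definition _ := GRing.Zmodule.on L2.

Local Open Scope quotient_scope.

Definition L2_class (f : sq_integrable_fun) : L2 := \pi_(Quotient.quot null_pred) f.
Definition L2_repr (u : L2) : sq_integrable_fun := repr (u : Quotient.quot null_pred).

Lemma L2_reprK : cancel L2_repr L2_class. Proof. exact: reprK. Qed.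

Lemma L2_classD f g : L2_class (f + g) = L2_class f + L2_class g.
Proof. exact: Quotient.pi_add. Qed.

Lemma L2_classE f g : (L2_class f == L2_class g) = (f - g \in null_pred).
Proof. by rewrite Quotient.idealrBE. Qed.

Definition L2_scale (c : R[i]) (u : L2) : L2 := L2_class (c *: L2_repr u).

Lemma L2_scale_class c f : L2_scale c (L2_class f) = L2_class (c *: f).
Proof.
apply/eqP; rewrite /L2_scale L2_classE -scalerBr rpredZ//.
by rewrite -L2_classE L2_reprK.
Qed.

Lemma L2_scalerA c d u : L2_scale c (L2_scale d u) = L2_scale (c * d) u.
Proof. by rewrite -[u]L2_reprK !L2_scale_class scalerA. Qed.

Lemma L2_scale1r : left_id 1 L2_scale.
Proof. by move=> u; rewrite -[u]L2_reprK L2_scale_class scale1r. Qed.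

Lemma L2_scalerDr : right_distributive L2_scale +%R.
Proof.
move=> c u v; rewrite -[u]L2_reprK -[v]L2_reprK -L2_classD !L2_scale_class.
by rewrite scalerDr L2_classD.
Qed.

Lemma L2_scalerDl u : {morph L2_scale^~ u : c d / c + d}.
Proof.
by move=> c d; rewrite -[u]L2_reprK !L2_scale_class scalerDl L2_classD.
Qed.

HB.instance Definition _ := GRing.Zmodule_isLmodule.Build R[i] L2
  L2_scalerA L2_scale1r L2_scalerDr L2_scalerDl.

Definition represents (u : L2) (f : R -> H) : Prop :=
  {ae mu, forall t, [set` I] t -> L2_repr u t = f t}.

Definition L2_ip (ip : H -> H -> R[i]) (u v : L2) : R[i] :=
  let h t := ip (L2_repr u t) (L2_repr v t) in
  (\int[mu]_(t in [set` I]) complex.Re (h t))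
  +i* (\int[mu]_(t in [set` I]) complex.Im (h t)).

End SquareIntegrable.

Section DifferentialOperators.
Context {R : realType}.

Definition smooth (f : R -> R) : Prop :=
  forall n t, derivable (derive1n n f) t 1.

(* C_0^oo(I), with complex values: R[i] carries no normed-module structure over
   R, so derivatives are taken componentwise. *)
Definition test_function (I : interval R) (phi : R -> R[i]) : Prop :=
  [/\ smooth (@complex.Re R \o phi), smooth (@complex.Im R \o phi),
      compact (closure [set t | phi t != 0])
    & closure [set t | phi t != 0] `<=` [set` I]].

Definition cderive (phi : R -> R[i]) (t : R) : R[i] :=
  derive1 (@complex.Re R \o phi) t +i* derive1 (@complex.Im R \o phi) t.

Context {H : normedModType R[i]}.

(* The operator phi |-> i phi' + A phi on finite sums of products phi(t) f,
   f in D(A) *)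
Definition preminimal (I : interval R) (A : set (H * H)) :
    set (L2 H I * L2 H I) :=
  [set p | exists (n : nat) (phi : 'I_n -> R -> R[i]) (f g : 'I_n -> H),
     [/\ forall j, test_function I (phi j) /\ A (f j, g j),
         represents p.1 (fun t => \sum_(j < n) phi j t *: f j)
       & represents p.2 (fun t => \sum_(j < n)
           (('i%C * cderive (phi j) t) *: f j + phi j t *: g j))]].

Arguments preminimal : clear implicits.

Variable ip : H -> H -> R[i].

Definition minimal_on (I : interval R) (A : set (H * H)) :
    set (L2 H I * L2 H I) :=
  operator_closure (L2_ip ip) (preminimal I A).

Arguments minimal_on : clear implicits.

Definition maximal_on (I : interval R) (A : set (H * H)) :
    set (L2 H I * L2 H I) :=
  adjoint (L2_ip ip) (minimal_on I A).

Arguments maximal_on : clear implicits.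

Variables (a b : R) (A : set (H * H)).

Definition L2pair : lmodType R[i] :=
  (L2 H `]-oo, a[ * L2 H `]b, +oo[)%type.

Definition L2pair_ip : L2pair -> L2pair -> R[i] :=
  sum_ip (L2_ip ip) (L2_ip ip).

Definition minimal_operator : set (L2pair * L2pair) :=
  operator_sum (minimal_on `]-oo, a[ A) (minimal_on `]b, +oo[ A).

Definition maximal_operator : set (L2pair * L2pair) :=
  operator_sum (maximal_on `]-oo, a[ A) (maximal_on `]b, +oo[ A).

(* u has a representative which is continuous on the interval J (I with its
   finite endpoint c added) and takes the value x at c *)
Definition boundary_value (I J : interval R) (c : R) (u : L2 H I) (x : H) :=
  exists f : R -> H,
    [/\ {within [set` J], continuous f}, represents u f & f c = x].

Arguments boundary_value {I} J c u x.

Definition boundary_operator (W : H -> H) : set (L2pair * L2pair) :=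
  [set p | maximal_operator p /\
     exists x y, [/\ boundary_value `]-oo, a] a p.1.1 x,
                     boundary_value `[b, +oo[ b p.1.2 y
                   & y = W x]].

End DifferentialOperators.

Arguments preminimal {R H} I A.
Arguments minimal_on {R H} ip I A.
Arguments maximal_on {R H} ip I A.
Arguments L2pair {R} H a b.
Arguments L2pair_ip {R H} ip a b u v.
Arguments minimal_operator {R H} ip a b A.
Arguments maximal_operator {R H} ip a b A.
Arguments boundary_value {R H I} J c u x.
Arguments boundary_operator {R H} ip a b A W.

(* Main.v *)
(* A solution u of i u' + A u = g on a half-line has a trace at the end point. Applying the
   resolvent J_n = (1 - i A / n)^-1 turns the equation into one with a bounded operator, whose
   energy identity makes J_n u uniformly Cauchy; its limit is a continuous representative of u, and
   |u|^2 at the end point is, up to sign, twice the integral of Re <i u, g>. Polarization gives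
   Green's formula <L u, v> - <u, L v> = i (<u1(a), v1(a)> - <u2(b), v2(b)>).
   Every pair of vectors is a pair of traces. Instead of the unitary group of A, which would produce
   a lift at once, Poisson weights q_k are used: sum_k q_k(t / d) J_d^k x is an approximate solution
   starting at x, since q_k' = q_(k-1) - q_k, and the errors are summed along a geometric series.
   Consequently a selfadjoint extension of L_0 is determined by its set B of pairs of traces, and
   selfadjointness says that B is its own annihilator for the form <x, x'> - <y, y'>. Such a B is
   the graph of an isometry which is defined everywhere and onto. *)
Require Import Defs.
From HB Require Import structures.
From mathcomp Require Import all_boot all_order all_algebra.
From mathcomp Require Import all_classical all_reals all_analysis.
From mathcomp Require Import measurable_realfun ring lra zify.
Set Implicit Arguments.
Unset Strict Implicit.
Unset Printing Implicit Defensive.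
Import Order.TTheory GRing.Theory Num.Theory.
Import numFieldNormedType.Exports.
Local Open Scope classical_set_scope.
Local Open Scope ring_scope.
Local Open Scope complex_scope.

(** * Real inner product and Riesz representation *)

(** Three obstacles shape the argument. The order and the integral are real while [ip] is complex,
    so everything is proved for [re_ip], a real inner product for which multiplication by ['i] is
    skew; [ipE] recovers the complex statements by testing against ['i%C *: y] as well. No
    vector-valued integral is used: a primitive is a function whose increments have the right scalar
    products with all vectors, and Riesz representation produces it from a locally square integrable
    derivative. Finally, a weak solution is known only almost everywhere, and the exceptional set
    depends on the test vector. With the test vectors [J_(-d) e_j], where [e_j] is a dense sequence,
    countably many Lebesgue point conditions suffice, every such vector lies in the domain of [A],
    and since the adjoint of [J_d] is [J_(-d)], testing [u] against them is testing [J_d u] against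
    [e_j]. The trace is then an energy balance with nothing left at infinity; its sign, opposite on
    the two half-lines, is what turns selfadjointness into unitarity. *)

Section RealInnerProduct.
Context {R : realType} {H : completeNormedModType R[i]}.
Variable ip : {dot H for Num.conj}.
Hypothesis norm_ip : forall x : H, `|x| ^+ 2 = ip x x.

Definition re_ip (x y : H) : R := complex.Re (ip x y).
Local Notation rip := re_ip.

Lemma ReD (z w : R[i]) : complex.Re (z + w) = complex.Re z + complex.Re w.
Proof. by case: z; case: w. Qed.

Lemma ReN (z : R[i]) : complex.Re (- z) = - complex.Re z.
Proof. by case: z. Qed.

Lemma ripDl x y z : rip (x + y) z = rip x z + rip y z.
Proof. by rewrite /re_ip linearDl ReD. Qed.

Lemma ripNl x z : rip (- x) z = - rip x z.
Proof. by rewrite /re_ip linearNl ReN. Qed.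

Lemma ipC x y : ip x y = (ip y x)^*%R.
Proof. by rewrite (hermC ip) expr0 mul1r. Qed.

Lemma ripC x y : rip x y = rip y x.
Proof. by rewrite /re_ip ipC; case: (ip y x). Qed.

Lemma ripDr x y z : rip x (y + z) = rip x y + rip x z.
Proof. by rewrite ripC ripDl ripC [rip z x]ripC. Qed.

Lemma ripNr x z : rip x (- z) = - rip x z.
Proof. by rewrite ripC ripNl ripC. Qed.

Lemma ripBl x y z : rip (x - y) z = rip x z - rip y z.
Proof. by rewrite ripDl ripNl. Qed.

Lemma ripBr x y z : rip x (y - z) = rip x y - rip x z.
Proof. by rewrite ripDr ripNr. Qed.

Lemma ripZl (c : R) x y : rip (c%:C *: x) y = c * rip x y.
Proof. by rewrite /re_ip linearZl_LR /=; case: (ip x y) => ? ? /=; rewrite mul0r subr0. Qed.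

Lemma ripZr (c : R) x y : rip x (c%:C *: y) = c * rip x y.
Proof. by rewrite ripC ripZl ripC. Qed.

Lemma rip0l x : rip 0 x = 0. Proof. by rewrite /re_ip linear0l. Qed.
Lemma rip0r x : rip x 0 = 0. Proof. by rewrite ripC rip0l. Qed.

Lemma ip_i_l x y : ip ('i%C *: x) y = 'i%C * ip x y.
Proof. by rewrite linearZl_LR. Qed.

(** The second slot of [ip] is conjugate-linear, so moving ['i] across changes the sign. *)
Lemma ripiC x y : rip ('i%C *: x) y = - rip x ('i%C *: y).
Proof.
rewrite /re_ip (ipC x) !ip_i_l (ipC x); case: (ip y x) => a b /=; ring.
Qed.

Lemma ripii x y : rip ('i%C *: x) ('i%C *: y) = rip x y.
Proof.
by rewrite ripiC scalerA -expr2 sqr_i scaleN1r ripNr opprK.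
Qed.

Lemma Im_ip x y : complex.Im (ip x y) = rip x ('i%C *: y).
Proof.
rewrite /re_ip (ipC x ('i *: y)) ip_i_l (ipC x y).
by case: (ip y x) => a b /=; ring.
Qed.

Lemma ipE x y : ip x y = rip x y +i* rip x ('i%C *: y).
Proof. by rewrite -Im_ip /re_ip; case: (ip x y). Qed.

Lemma rip_norm x : rip x x = rnorm x ^+ 2.
Proof.
rewrite /re_ip -norm_ip; have := rnormE x => <-.
by rewrite -rmorphXn.
Qed.

Lemma rip_ge0 x : 0 <= rip x x. Proof. by rewrite rip_norm sqr_ge0. Qed.

Lemma rip_eq0 x : rip x x = 0 -> x = 0.
Proof.
rewrite rip_norm => /eqP; rewrite sqrf_eq0 => /eqP x0.
by apply/eqP; rewrite -normr_eq0 -rnormE x0.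
Qed.

Lemma rip_ext x y : (forall z, rip x z = rip y z) -> x = y.
Proof.
move=> h; apply/eqP; rewrite -subr_eq0; apply/eqP/rip_eq0.
by rewrite ripBl h subrr.
Qed.

Lemma rnorm_eq0 (x : H) : rnorm x = 0 -> x = 0.
Proof. by move=> x0; apply/eqP; rewrite -normr_eq0 -rnormE x0. Qed.

Lemma rnorm0 : rnorm (0 : H) = 0. Proof. by rewrite /rnorm normr0. Qed.

Lemma rnormN (x : H) : rnorm (- x) = rnorm x. Proof. by rewrite /rnorm normrN. Qed.

Lemma rnormBC (x y : H) : rnorm (x - y) = rnorm (y - x).
Proof. by rewrite -rnormN opprB. Qed.

Lemma rnormZR (c : R) (x : H) : rnorm (c%:C *: x) = `|c| * rnorm x.
Proof. by rewrite rnormZ normc_def /= expr0n /= addr0 sqrtr_sqr. Qed.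

Lemma rnormi (x : H) : rnorm ('i%C *: x) = rnorm x.
Proof. by rewrite rnormZ normc_def /= expr0n expr1n /= add0r sqrtr1 mul1r. Qed.

Lemma rnorm_sqrB x y : rnorm (x - y) ^+ 2 = rnorm x ^+ 2 - 2 * rip x y + rnorm y ^+ 2.
Proof. by rewrite -!rip_norm ripBl !ripBr (ripC y x); ring. Qed.

Lemma rnorm_sqrD x y : rnorm (x + y) ^+ 2 = rnorm x ^+ 2 + 2 * rip x y + rnorm y ^+ 2.
Proof. by rewrite -!rip_norm ripDl !ripDr (ripC y x); ring. Qed.

(** The discriminant argument, isolated because each Cauchy-Schwarz inequality below, as well as the
    first-order condition in [riesz_on], is an instance of it. *)
Lemma quad_disc (p q r : R) : 0 <= p -> 0 <= r ->
  (forall t, 0 <= p + 2 * t * q + t ^+ 2 * r) -> q ^+ 2 <= p * r.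
Proof.
move=> p0 r0 h; have [r00|r00] := eqVneq r 0.
  have [-> |q0] := eqVneq q 0; first by rewrite expr0n mulr_ge0.
  (* For [r = 0] the polynomial is affine in [t], and this [t] gives it the value [-1]. *)
  have := h (- (p + 1) / (2 * q)).
  rewrite r00 mulr0 addr0.
  have -> : 2 * (- (p + 1) / (2 * q)) * q = - (p + 1) by field.
  by rewrite opprD addrA subrr sub0r oppr_ge0 ler10.
have rp : 0 < r by rewrite lt_neqAle eq_sym r00.
have := h (- q / r).
have -> : p + 2 * (- q / r) * q + (- q / r) ^+ 2 * r = (p * r - q ^+ 2) / r.
  by field.
by rewrite pmulr_lge0 ?invr_gt0// subr_ge0.
Qed.

Lemma rip_CS x y : `|rip x y| <= rnorm x * rnorm y.
Proof.
rewrite -(@ler_pXn2r _ 2)// ?nnegrE ?mulr_ge0 ?rnorm_ge0//.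
rewrite real_normK ?num_real// exprMn; apply: quad_disc; rewrite ?sqr_ge0// => t.
have := sqr_ge0 (rnorm (x + t%:C *: y)).
rewrite rnorm_sqrD ripZr rnormZR exprMn real_normK ?num_real//; lra.
Qed.

Lemma rip_le x y : rip x y <= rnorm x * rnorm y.
Proof. exact: le_trans (ler_norm _) (rip_CS _ _). Qed.

(** The norm of [H] has values in [R[i]]; a positive element there is real, so the radii may be
    taken in [R]. *)
Lemma rnorm_cvgP (u : nat -> H) l :
  u n @[n --> \oo] --> l <->
  (forall e, 0 < e -> exists N, forall n, (N <= n)%N -> rnorm (l - u n) < e).
Proof.
split=> [/cvgrPdist_lt h e e0|h].
  have /h [N _ hN] : 0 < e%:C by rewrite ltcR.
  by exists N => n Nn; rewrite -ltcR rnormE; exact: hN.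
apply/cvgrPdist_lt => e e0.
have eE : e = (complex.Re e)%:C by rewrite RRe_real// gtr0_real.
have /h[N hN] : 0 < complex.Re e by rewrite -ltcR -eE.
by exists N => // n Nn; rewrite -rnormE eE ltcR; exact: hN.
Qed.

Lemma rnorm_cauchy (u : nat -> H) :
  (forall e, 0 < e -> exists N, forall m n, (N <= m)%N -> (N <= n)%N ->
     rnorm (u m - u n) < e) ->
  exists l : H, u n @[n --> \oo] --> l.
Proof.
move=> h; have : cvg (u @ \oo).
  apply/cauchy_cvgP/cauchy_ballP => e e0.
  have eE : e = (complex.Re e)%:C by rewrite RRe_real// gtr0_real.
  have /h[N hN] : 0 < complex.Re e by rewrite -ltcR -eE.
  exists ([set u n | n in [set n | (N <= n)%N]], [set u n | n in [set n | (N <= n)%N]]).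
    by split=> /=; exists N => // n Nn; exists n.
  move=> [x y] /= [[m Nm <-] [n Nn <-]].
  by rewrite -ball_normE/= -rnormE eE ltcR; exact: hN.
by move=> /cvg_ex.
Qed.

End RealInnerProduct.

(* Linear identities between vectors are checked against every inner product. *)
Ltac vec norm_ip :=
  apply: (rip_ext norm_ip) => ?;
  rewrite !(ripDl, ripNl, ripZl, rip0l); ring.

Section Riesz.
Context {R : realType} {H : completeNormedModType R[i]}.
Variable ip : {dot H for Num.conj}.
Hypothesis norm_ip : forall x : H, `|x| ^+ 2 = ip x x.
Local Notation rip := (re_ip ip).

(** Variational proof: a minimizer over [M] of [Phi y = |y|^2 - 2 F y] represents [F]. Boundedness
    of [F] keeps [Phi] bounded below, the parallelogram identity makes a minimizing sequence Cauchy,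
    and the vanishing of the first variation is the representation. Linearity is only over the reals
    and only on [M], so that one lemma serves both functionals and orthogonal projections. *)
Lemma riesz_on (M : set H) (F : H -> R) (C : R) :
  M 0 -> (forall (c : R) x y, M x -> M y -> M (c%:C *: x + y)) ->
  (forall x, (forall e, 0 < e -> exists y, M y /\ rnorm (x - y) < e) -> M x) ->
  (forall (c : R) x y, M x -> M y -> F (c%:C *: x + y) = c * F x + F y) ->
  (forall x, M x -> `|F x| <= C * rnorm x) ->
  exists z, M z /\ forall y, M y -> rip z y = F y.
Proof.
move=> M0 Ml Mc Fl Fb.
pose Phi y := rnorm y ^+ 2 - 2 * F y.
have Phi_lb y : M y -> - C ^+ 2 <= Phi y.
  move=> /Fb h; rewrite /Phi.
  have h2 : F y <= C * rnorm y by apply: le_trans h; rewrite ler_norm.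
  have := sqr_ge0 (rnorm y - C); rewrite sqrrB; lra.
pose S := [set Phi y | y in M].
have Sinf : has_inf S.
  by split; [exists (Phi 0), 0|exists (- C ^+ 2) => _ [y My <-]; exact: Phi_lb].
pose m := inf S.
have mlb y : M y -> m <= Phi y.
  by move=> My; apply: ge_inf; [exact: Sinf.2|exists y].
have mad e : 0 < e -> exists y, M y /\ Phi y < m + e.
  by move=> e0; have [_ [y My <-] h] := inf_adherent e0 Sinf; exists y.
have Mhalf y y' : M y -> M y' -> M (2^-1%:C *: (y + y')).
  move=> My My'; rewrite -[X in M X]addr0; apply: (Ml) => //.
  by rewrite -[y]scale1r; exact: (Ml 1).
have FD x y : M x -> M y -> F (x + y) = F x + F y.
  by move=> Mx My; rewrite -[x]scale1r (Fl 1)// scale1r mul1r.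
have F0 : F 0 = 0.
  by have := FD 0 0 M0 M0; rewrite addr0 => /eqP; rewrite -subr_eq0 opprD addrA subrr sub0r oppr_eq0 => /eqP.
have FZ c x : M x -> F (c%:C *: x) = c * F x.
  by move=> Mx; rewrite -[X in F X]addr0 Fl// F0 addr0.
have MN x : M x -> M (- x).
  move=> Mx; have := Ml (-1) x 0 Mx M0.
  by rewrite rmorphN1 scaleN1r addr0.
have FN x : M x -> F (- x) = - F x.
  by move=> Mx; have := FZ (-1) x Mx; rewrite rmorphN1 scaleN1r mulN1r.
have MD x y : M x -> M y -> M (x + y).
  by move=> Mx My; rewrite -[x]scale1r; exact: (Ml 1).
(* By the parallelogram identity the left side equals [2 Phi y + 2 Phi y' - 4 Phi ((y + y') / 2)],
   the linear terms cancelling. *)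
have para y y' : M y -> M y' -> rnorm (y - y') ^+ 2 <= 2 * (Phi y + Phi y' - 2 * m).
  move=> My My'; have := mlb _ (Mhalf y y' My My').
  rewrite /Phi FZ; last exact: MD.
  rewrite FD// rnormZR exprMn real_normK ?num_real// (rnorm_sqrD norm_ip).
  rewrite (rnorm_sqrB norm_ip); lra.
pose y_ n := sval (cid (mad n.+1%:R^-1 ltac:(by rewrite invr_gt0))).
have yM n : M (y_ n) by rewrite /y_; case: cid => ? [].
have yP n : Phi (y_ n) < m + n.+1%:R^-1 by rewrite /y_; case: cid => ? [].
have [z yz] : exists z : H, y_ n @[n --> \oo] --> z.
  apply: rnorm_cauchy => e e0.
  (* [para] bounds the squared distance of two terms beyond [N] by [4 / (N + 1)]. *)
  have [N hN] : exists N : nat, N.+1%:R^-1 < e ^+ 2 / 4.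
    have e2 : 0 < e ^+ 2 / 4 by rewrite divr_gt0// exprn_gt0.
    have := near_infty_natSinv_lt (PosNum e2).
    by case=> N _ /(_ N (leqnn N)) h; exists N.
  exists N => p q Np Nq.
  have hS k : (N <= k)%N -> k.+1%:R^-1 <= N.+1%:R^-1 :> R.
    by move=> Nk; rewrite lef_pV2 ?posrE// ler_nat ltnS.
  rewrite -(@ltr_pXn2r _ 2)// ?nnegrE ?rnorm_ge0 ?ltW//.
  apply: le_lt_trans (para _ _ (yM p) (yM q)) _.
  move: (yP p) (yP q) (hS p Np) (hS q Nq) hN.
  move: (Phi _) (Phi _) (_^-1) (_^-1) (_^-1) => ? ? ? ? ? ? ? ? ? ?; lra.
have yz' := (rnorm_cvgP y_ z).1 yz.
have Mz : M z.
  by apply: Mc => e /yz'[N hN]; exists (y_ N); split => //; exact: hN.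
exists z; split=> // y My.
(* Compare [Phi] at the minimizer [z] with [Phi] at [z + t y]; a quadratic in [t] without constant
   term is nonnegative only if its linear coefficient vanishes. *)
have key t : 0 <= 2 * t * (rip z y - F y) + t ^+ 2 * rnorm y ^+ 2.
  have mt : m <= Phi (z + t%:C *: y) by apply: mlb; rewrite addrC; exact: (Ml).
  have mz : Phi z <= m.
    apply/ler_addgt0Pr => e e0.
    set K := 2 * rnorm z + 1 + 2 * `|C|.
    have K0 : 0 < K by rewrite /K ltr_pwDl// ltr_wpDl// mulr_ge0// rnorm_ge0.
    have e1 : 0 < Num.min 1 (e / 2 / K) by rewrite lt_min ltr01 !divr_gt0.
    have [N hN] := yz' _ e1.
    have [N2 hN2] : exists N : nat, N.+1%:R^-1 < e / 2.
      have e2 : 0 < e / 2 by rewrite divr_gt0.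
      have := near_infty_natSinv_lt (PosNum e2).
      by case=> k _ /(_ k (leqnn k)) h; exists k.
    pose n := maxn N N2.
    have := hN n (leq_maxl _ _); rewrite lt_min => /andP[r1 r2].
    have := yP n.
    have : n.+1%:R^-1 <= N2.+1%:R^-1 :> R.
      by rewrite lef_pV2 ?posrE// ler_nat ltnS leq_maxr.
    set r := rnorm (z - y_ n) in r1 r2.
    have yE : y_ n = z - (z - y_ n) by rewrite opprB addrC subrK.
    have PE : Phi (y_ n) = Phi z - 2 * rip z (z - y_ n) + r ^+ 2 + 2 * F (z - y_ n).
      rewrite {1}yE /Phi (rnorm_sqrB norm_ip) FD//; last by do 2 apply: (MN _ _) || apply: (MD) => //; apply: (MN).
      rewrite FN; last by apply: (MD) => //; apply: (MN).
      rewrite -/r; lra.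
    rewrite PE.
    have h1 := rip_le norm_ip z (z - y_ n).
    have h2 : - F (z - y_ n) <= `|C| * r.
      have : M (z - y_ n) by apply: (MD) => //; apply: (MN).
      move=> /Fb h; apply: le_trans (ler_norm _) _; rewrite normrN.
      by apply: le_trans h _; rewrite ler_wpM2r ?rnorm_ge0// ler_norm.
    have r0 : 0 <= r by exact: rnorm_ge0.
    have h3 : K * r <= e / 2.
      by rewrite mulrC -ler_pdivlMr// ltW.
    move: h1 h2 h3 hN2 r0 (sqr_ge0 r); rewrite -/r /K; clear.
    move: (Phi z) (rip _ _) (F _) n.+1%:R^-1 N2.+1%:R^-1 => p1 p2 p3 p4 p5.
    move: (rnorm z) `|C| => p6 p7; move: r => r h1 h2 h3 h4 h5 h6 h7 h8; nra.
  have Mty : M (t%:C *: y) by have := Ml t y 0 My M0; rewrite addr0.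
  move: mt mz; rewrite /Phi (rnorm_sqrD norm_ip) ripZr rnormZR exprMn.
  by rewrite real_normK ?num_real// FD// FZ//; lra.
set q := rip z y - F y in key *.
apply/eqP; rewrite -subr_eq0 -/q -sqrf_eq0 eq_le sqr_ge0 andbT.
have := @quad_disc R 0 q (rnorm y ^+ 2) (lexx _) (sqr_ge0 _).
rewrite mul0r; apply => t; rewrite add0r; exact: key.
Qed.

Lemma riesz (F : H -> R) (C : R) :
  (forall (c : R) x y, F (c%:C *: x + y) = c * F x + F y) ->
  (forall x, `|F x| <= C * rnorm x) ->
  exists z, forall y, rip z y = F y.
Proof.
move=> Fl Fb; have [z [_ h]] := @riesz_on setT F C I (fun _ _ _ _ _ => I)
  (fun _ _ => I) (fun c x y _ _ => Fl c x y) (fun x _ => Fb x).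
by exists z => y; exact: h.
Qed.

(** [riesz_on] applied to [rip x] projects [x] onto [M]; the difference is orthogonal to [M], hence
    zero. *)
Lemma closed_subspace_full (M : set H) :
  M 0 -> (forall (c : R) x y, M x -> M y -> M (c%:C *: x + y)) ->
  (forall x, (forall e, 0 < e -> exists y, M y /\ rnorm (x - y) < e) -> M x) ->
  (forall z, (forall y, M y -> rip z y = 0) -> z = 0) ->
  forall x, M x.
Proof.
move=> M0 Ml Mc Mo x.
have [||z [Mz zP]] := @riesz_on M (rip x) (rnorm x) M0 Ml Mc.
- by move=> c u v _ _; rewrite ripDr ripZr.
- by move=> u _; exact: rip_CS.
suff -> : x = z by [].
apply/eqP; rewrite -subr_eq0; apply/eqP/Mo => y My.
by rewrite ripBl zP// subrr.
Qed.

End Riesz.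

(** * Resolvents of selfadjoint operators *)

Section Resolvent.
Context {R : realType} {H : completeNormedModType R[i]}.
Variable ip : {dot H for Num.conj}.
Hypothesis norm_ip : forall x : H, `|x| ^+ 2 = ip x x.
Local Notation rip := (re_ip ip).
Variable A : set (H * H).
Hypothesis sA : selfadjoint ip A.

Lemma sadj_lin (c : R[i]) f g f' g' :
  A (f, g) -> A (f', g') -> A (c *: f + f', c *: g + g').
Proof. by case: sA => [[_ h _] _ _]; exact: (h c (f, g) (f', g')). Qed.

Lemma sadj0 : A (0, 0).
Proof. by case: sA => [[h _ _] _ _]. Qed.

Lemma sadjZ (c : R[i]) f g : A (f, g) -> A (c *: f, c *: g).
Proof. by move=> h; have := sadj_lin c h sadj0; rewrite !addr0. Qed.

Lemma sadjD f g f' g' : A (f, g) -> A (f', g') -> A (f + f', g + g').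
Proof. by move=> h h'; have := sadj_lin 1 h h'; rewrite !scale1r. Qed.

Lemma sadjN f g : A (f, g) -> A (- f, - g).
Proof. by move=> h; have := sadjZ (-1) h; rewrite !scaleN1r. Qed.

Lemma sadj_sym f g f' g' : A (f, g) -> A (f', g') -> ip f g' = ip g f'.
Proof.
case: sA => [_ _ h] Afg Afg'; move: Afg; rewrite -[in X in X -> _]h.
by move=> /(_ _ Afg').
Qed.

Lemma sadj_rsym f g f' g' : A (f, g) -> A (f', g') -> rip f g' = rip g f'.
Proof. by rewrite /ip_norm => h h'; rewrite /re_ip (sadj_sym h h'). Qed.

Lemma sadj_skew f g f' g' : A (f, g) -> A (f', g') ->
  rip ('i%C *: g) f' = - rip f ('i%C *: g').
Proof.
move=> h h'; have := sadj_rsym (sadjZ 'i%C h) h' => <-.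
by rewrite ripiC.
Qed.

Lemma sadj_skew0 f g : A (f, g) -> rip ('i%C *: g) f = 0.
Proof. by move=> h; have := sadj_skew h h; rewrite (ripC ip f); lra. Qed.

(** Real parts suffice: the domain of [A] is stable under ['i], and testing against ['i f'] gives
    the imaginary parts. *)
Lemma sadjI f g : (forall f' g', A (f', g') -> rip f g' = rip g f') -> A (f, g).
Proof.
move=> h; case: sA => [_ _ <-] [f' g'] /= Afg'.
by rewrite !ipE (h _ _ Afg') (h _ _ (sadjZ 'i%C Afg')).
Qed.

(** The cross term is a multiple of [rip f ('i g)], which vanishes because the quadratic form of a
    symmetric operator is real. Injectivity, closed range and contractivity of the resolvent all
    come from this identity. *)
Lemma sadj_norm (d : R) f g : A (f, g) ->
  rnorm (f - (d%:C * 'i%C) *: g) ^+ 2 = rnorm f ^+ 2 + d ^+ 2 * rnorm g ^+ 2.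
Proof.
move=> h; rewrite -scalerA (rnorm_sqrB norm_ip) rnormZR rnormi ripZr ripC sadj_skew0//.
by rewrite exprMn real_normK ?num_real//; ring.
Qed.

Lemma small_inv (e : R) : 0 < e -> exists N : nat, forall n, (N <= n)%N -> n.+1%:R^-1 < e.
Proof.
move=> e0; have := near_infty_natSinv_lt (PosNum e0).
by case=> N _ h; exists N => n /h.
Qed.

(** The range of [1 - i d A] is closed: by [sadj_norm] the preimages of a Cauchy sequence are Cauchy
    together with their images under [A], and [A], being an adjoint, is closed. It is dense: a
    vector [z] orthogonal to it satisfies [A (- i d z) = z], which [sadj_skew0] excludes unless
    [z = 0]. *)
Lemma sadj_range (d : R) : d != 0 -> forall y, exists f g,
  A (f, g) /\ f - (d%:C * 'i%C) *: g = y.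
Proof.
move=> d0; apply: (closed_subspace_full norm_ip).
- by exists 0, 0; split; [exact: sadj0|rewrite scaler0 subr0].
- move=> c x y [f [g [Afg <-]]] [f' [g' [Afg' <-]]].
  exists (c%:C *: f + f'), (c%:C *: g + g'); split; first exact: sadj_lin.
  by rewrite !scalerDr (scalerA _ c%:C) (mulrC _ c%:C) -!scalerA; vec norm_ip.
- move=> x hx.
  pose P (n : nat) (p : H * H) :=
    A p /\ rnorm (x - (p.1 - (d%:C * 'i%C) *: p.2)) < n.+1%:R^-1.
  have ex n : exists p, P n p.
    have [|_ [[f [g [Afg <-]]] h]] := hx n.+1%:R^-1; first by rewrite invr_gt0.
    by exists (f, g).
  pose p_ n := sval (cid (ex n)).
  have pP n : P n (p_ n) by rewrite /p_; case: cid.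
  have cau m n : rnorm ((p_ m).1 - (p_ n).1) ^+ 2 +
      d ^+ 2 * rnorm ((p_ m).2 - (p_ n).2) ^+ 2 <= (m.+1%:R^-1 + n.+1%:R^-1) ^+ 2.
    have [[Am hm] [An hn]] := (pP m, pP n).
    rewrite -sadj_norm; last first.
      by apply: sadjD; [rewrite -surjective_pairing|apply: sadjN; rewrite -surjective_pairing].
    rewrite lerXn2r ?nnegrE ?addr_ge0 ?rnorm_ge0 ?invr_ge0//.
    rewrite scalerBr.
    have -> : (p_ m).1 - (p_ n).1 - ((d%:C * 'i%C) *: (p_ m).2 - (d%:C * 'i%C) *: (p_ n).2)
      = (x - ((p_ n).1 - (d%:C * 'i%C) *: (p_ n).2)) - (x - ((p_ m).1 - (d%:C * 'i%C) *: (p_ m).2)).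
      by move: ((d%:C * 'i) *: _) ((d%:C * 'i) *: _) => u v; vec norm_ip.
    apply: le_trans (rnormD _ _) _; rewrite rnormN addrC lerD// ltW//.
  have cau1 : forall e, 0 < e -> exists N, forall m n, (N <= m)%N -> (N <= n)%N ->
      m.+1%:R^-1 + n.+1%:R^-1 < e :> R.
    move=> e e0; have [|N hN] := @small_inv (e / 2); first by rewrite divr_gt0.
    by exists N => m n /hN h /hN h'; rewrite [e]splitr ltrD.
  have [f hf] : exists f : H, (fun n => (p_ n).1) n @[n --> \oo] --> f.
    apply: rnorm_cauchy => e /cau1[N hN]; exists N => m n Nm Nn.
    apply: le_lt_trans (hN _ _ Nm Nn).
    rewrite -(@ler_pXn2r _ 2)// ?nnegrE ?rnorm_ge0 ?addr_ge0 ?invr_ge0//.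
    apply: le_trans (cau m n); rewrite lerDl mulr_ge0 ?sqr_ge0//.
  have inv_succ : 0 < `|d| by rewrite normr_gt0.
  have [g hg] : exists g : H, (fun n => (p_ n).2) n @[n --> \oo] --> g.
    apply: rnorm_cauchy => e e0; have [|N hN] := cau1 (`|d| * e); first by rewrite mulr_gt0.
    exists N => m n Nm Nn.
    rewrite -(ltr_pM2l inv_succ).
    apply: le_lt_trans (hN _ _ Nm Nn).
    rewrite -(@ler_pXn2r _ 2)// ?nnegrE ?mulr_ge0 ?rnorm_ge0 ?addr_ge0 ?invr_ge0//.
    apply: le_trans (cau m n); rewrite exprMn real_normK ?num_real// lerDr ?sqr_ge0//.
  exists f, g; split.
    apply: sadjI => f' g' Afg'.
    apply/eqP; rewrite -subr_eq0 -normr_le0; apply/ler_addgt0Pr => e e0.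
    set K := rnorm f' + rnorm g' + 1.
    have K0 : 0 < K by rewrite /K ltr_wpDl// addr_ge0 ?rnorm_ge0.
    have [N1 h1] := (rnorm_cvgP _ f).1 hf (e / K) ltac:(by rewrite divr_gt0).
    have [N2 h2] := (rnorm_cvgP _ g).1 hg (e / K) ltac:(by rewrite divr_gt0).
    pose n := maxn N1 N2.
    have {}h1 := h1 n (leq_maxl _ _); have {}h2 := h2 n (leq_maxr _ _).
    have := pP n => -[]; rewrite [p_ n]surjective_pairing => An _.
    have En := sadj_rsym An Afg'.
    rewrite add0r.
    have -> : rip f g' - rip g f' = rip (f - (p_ n).1) g' - rip (g - (p_ n).2) f'.
      by rewrite !ripBl En; ring.
    apply: le_trans (ler_normB _ _) _.
    have c1 := rip_CS norm_ip (f - (p_ n).1) g'.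
    have c2 := rip_CS norm_ip (g - (p_ n).2) f'.
    have eK : e = e / K * rnorm f' + e / K * rnorm g' + e / K.
      by move: (divfK (lt0r_neq0 K0) e); move: (e / K) => q <-; rewrite /K; ring.
    have l1 : rnorm (f - (p_ n).1) * rnorm g' <= e / K * rnorm g'.
      by rewrite ler_wpM2r ?rnorm_ge0// ltW.
    have l2 : rnorm (g - (p_ n).2) * rnorm f' <= e / K * rnorm f'.
      by rewrite ler_wpM2r ?rnorm_ge0// ltW.
    have l3 : 0 < e / K by rewrite divr_gt0.
    rewrite eK; move: c1 c2 l1 l2 l3; clear.
    by move: (e / K) => q *; lra.
  apply/eqP; rewrite -subr_eq0 -normr_le0 -rnormE lecR; apply/ler_addgt0Pr => e e0.
  set K := `|d| + 2.
  have K0 : 0 < K by rewrite /K ltr_wpDl.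
  have eK0 : 0 < e / K by rewrite divr_gt0.
  have [N1 h1] := (rnorm_cvgP _ f).1 hf (e / K) eK0.
  have [N2 h2] := (rnorm_cvgP _ g).1 hg (e / K) eK0.
  have [N3 h3] := small_inv eK0.
  pose n := maxn N1 (maxn N2 N3).
  have {}h1 := h1 n (leq_maxl _ _).
  have {}h2 : rnorm (g - (p_ n).2) < e / K by apply: h2; lia.
  have {}h3 : n.+1%:R^-1 < e / K by apply: h3; lia.
  have [_ h4] := pP n.
  have -> : f - (d%:C * 'i%C) *: g - x = (f - (p_ n).1) - d%:C *: ('i%C *: (g - (p_ n).2)) -
     (x - ((p_ n).1 - (d%:C * 'i%C) *: (p_ n).2)).
    rewrite scalerA scalerBr; move: ((d%:C * 'i) *: _) ((d%:C * 'i) *: _) => u v.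
    by vec norm_ip.
  apply: le_trans (rnormD _ _) _; rewrite rnormN add0r.
  apply: le_trans (lerD (rnormD _ _) (lexx _)) _; rewrite rnormN rnormZR rnormi.
  have : `|d| * rnorm (g - (p_ n).2) <= `|d| * (e / K) by rewrite ler_wpM2l// ltW.
  have : e = (e / K) * `|d| + 2 * (e / K).
    by move: (divfK (lt0r_neq0 K0) e); move: (e / K) => q <-; rewrite /K; ring.
  by move: h1 h2 (lt_trans h4 h3); move: (e / K) => q *; lra.
move=> z zP.
have zz : A (- ((d%:C * 'i%C) *: z), z).
  apply: sadjI => f g Afg.
  have := zP _ (ex_intro _ f (ex_intro _ g (conj Afg erefl))).
  rewrite ripBr -!scalerA ripNl ripZr ripZl ripiC; lra.
have := sadj_skew0 zz.
rewrite ripNr -scalerA ripZr ripii => /eqP.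
by rewrite oppr_eq0 mulf_eq0 (negPf d0)/= => /eqP/(rip_eq0 norm_ip).
Qed.

End Resolvent.

(** * Algebra and strong convergence of the resolvents *)

Section ResolventFun.
Context {R : realType} {H : completeNormedModType R[i]}.
Variable ip : {dot H for Num.conj}.
Hypothesis norm_ip : forall x : H, `|x| ^+ 2 = ip x x.
Local Notation rip := (re_ip ip).
Variable A : set (H * H).
Hypothesis sA : selfadjoint ip A.

(* The resolvent (1 - i d A)^-1 and the bounded operator A (1 - i d A)^-1. *)
Definition resolv (d : R) (y : H) : H :=
  xget 0 [set f | exists g, A (f, g) /\ f - (d%:C * 'i%C) *: g = y].
Definition resolv_img (d : R) (y : H) : H := (d%:C * 'i%C)^-1 *: (resolv d y - y).

Lemma di_neq0 (d : R) : d != 0 -> d%:C * 'i%C != 0 :> R[i].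
Proof.
move=> d0; rewrite mulf_neq0//; first by rewrite (inj_eq (@complexI R)).
by rewrite eq_complex /= oner_eq0 andbF.
Qed.

Lemma JrP d y : d != 0 -> A (resolv d y, resolv_img d y).
Proof.
move=> d0; rewrite /resolv_img.
have [g []] : exists g, A (resolv d y, g) /\ resolv d y - (d%:C * 'i%C) *: g = y.
  exact: xgetPex (sadj_range norm_ip sA d0 y).
move: (resolv d y) => f Afg <-.
by rewrite opprB addrC subrK scalerA mulVf ?di_neq0// scale1r.
Qed.

Lemma JrE d y : d != 0 -> resolv d y - (d%:C * 'i%C) *: resolv_img d y = y.
Proof.
move=> d0; rewrite /resolv_img scalerA divff ?di_neq0// scale1r opprB addrC subrK//.
Qed.

Lemma Jr_uniq d f g y : d != 0 -> A (f, g) -> f - (d%:C * 'i%C) *: g = y ->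
  resolv d y = f /\ resolv_img d y = g.
Proof.
move=> d0 Afg fgy.
have h : A (resolv d y - f, resolv_img d y - g) by apply: (sadjD sA); [exact: JrP|exact: (sadjN sA)].
have := sadj_norm norm_ip sA d h.
have -> : resolv d y - f - (d%:C * 'i%C) *: (resolv_img d y - g) = 0.
  transitivity ((resolv d y - (d%:C * 'i%C) *: resolv_img d y) - (f - (d%:C * 'i%C) *: g)); last first.
    by rewrite JrE// fgy subrr.
  rewrite scalerBr.
  move: ((d%:C * 'i) *: _) ((d%:C * 'i) *: _) (resolv _ _) => u v w; vec norm_ip.
rewrite rnorm0 expr0n /= => /eqP.
rewrite eq_sym (paddr_eq0 (sqr_ge0 _) (mulr_ge0 (sqr_ge0 _) (sqr_ge0 _))).
rewrite !mulf_eq0 !orbb (negPf d0) /= => /andP[/eqP/rnorm_eq0/eqP + /eqP/rnorm_eq0/eqP].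
by rewrite !subr_eq0 => /eqP -> /eqP ->.
Qed.

Lemma JBr_lin d c x y : d != 0 ->
  resolv d (c *: x + y) = c *: resolv d x + resolv d y /\ resolv_img d (c *: x + y) = c *: resolv_img d x + resolv_img d y.
Proof.
move=> d0; apply: Jr_uniq => //; first by apply: (sadj_lin sA); exact: JrP.
rewrite -[in RHS](JrE x d0) -[in RHS](JrE y d0) !scalerDr !scalerN !scalerA (mulrC c).
vec norm_ip.
Qed.

Lemma Jr_lin d c x y : d != 0 -> resolv d (c *: x + y) = c *: resolv d x + resolv d y.
Proof. by move=> d0; have [] := JBr_lin c x y d0. Qed.

Lemma Br_lin d c x y : d != 0 -> resolv_img d (c *: x + y) = c *: resolv_img d x + resolv_img d y.
Proof. by move=> d0; have [] := JBr_lin c x y d0. Qed.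

Lemma Jr0 d : d != 0 -> resolv d 0 = 0.
Proof.
by move=> d0; have [] := @Jr_uniq d 0 0 0 d0 (sadj0 sA) ltac:(by rewrite scaler0 subrr).
Qed.

Lemma Br0 d : d != 0 -> resolv_img d 0 = 0.
Proof. by move=> d0; rewrite /resolv_img Jr0// subrr scaler0. Qed.

Lemma JrB d x y : d != 0 -> resolv d (x - y) = resolv d x - resolv d y.
Proof. by move=> d0; rewrite addrC -scaleN1r Jr_lin// scaleN1r addrC. Qed.

Lemma BrB d x y : d != 0 -> resolv_img d (x - y) = resolv_img d x - resolv_img d y.
Proof. by move=> d0; rewrite addrC -scaleN1r Br_lin// scaleN1r addrC. Qed.

Lemma JrZ d c x : d != 0 -> resolv d (c *: x) = c *: resolv d x.
Proof. by move=> d0; have := Jr_lin c x 0 d0; rewrite Jr0// !addr0. Qed.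

Lemma JBr_norm d y : d != 0 ->
  rnorm y ^+ 2 = rnorm (resolv d y) ^+ 2 + d ^+ 2 * rnorm (resolv_img d y) ^+ 2.
Proof. by move=> d0; rewrite -(sadj_norm norm_ip sA d (JrP y d0)) JrE. Qed.

Lemma Jr_norm d y : d != 0 -> rnorm (resolv d y) <= rnorm y.
Proof.
move=> d0; rewrite -(@ler_pXn2r _ 2)// ?nnegrE ?rnorm_ge0//.
by rewrite (JBr_norm y d0) lerDl mulr_ge0 ?sqr_ge0.
Qed.

Lemma Br_norm d y : d != 0 -> rnorm (resolv_img d y) <= `|d|^-1 * rnorm y.
Proof.
move=> d0; rewrite mulrC ler_pdivlMr ?normr_gt0// -(@ler_pXn2r _ 2)//
  ?nnegrE ?mulr_ge0 ?rnorm_ge0//.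
rewrite (JBr_norm y d0) exprMn real_normK ?num_real// mulrC lerDr sqr_ge0//.
Qed.

(** The pair [(y + i d J z, J z)] lies in [A], because [J z = z + i d A J z], and it solves the
    equation that defines [J y]; uniqueness does the rest. *)
Lemma Jr_comm d y z : d != 0 -> A (y, z) -> resolv_img d y = resolv d z.
Proof.
move=> d0 Ayz.
have h1 := JrP z d0; have h2 := JrE z d0.
have h : A (y + (d%:C * 'i%C) *: resolv d z, resolv d z).
  rewrite -{2}(subrK ((d%:C * 'i%C) *: resolv_img d z) (resolv d z)) h2.
  by apply: (sadjD sA) => //; exact: (sadjZ sA).
by have [] := Jr_uniq d0 h (addrK _ _).
Qed.

Lemma Jr_adj d x y : d != 0 -> rip (resolv d x) y = rip x (resolv (- d) y).
Proof.
move=> d0; have nd0 : - d != 0 by rewrite oppr_eq0.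
rewrite -[X in rip _ X = _](JrE y nd0) -[X in _ = rip X _](JrE x d0) -!scalerA ripBl ripBr rmorphN.
rewrite scaleNr ripNr ripZr ripZl.
by rewrite (sadj_skew sA (JrP x d0) (JrP y nd0)); ring.
Qed.

Lemma Br_adj d x y : d != 0 -> rip (resolv_img d x) y = rip x (resolv_img (- d) y).
Proof.
move=> d0; have nd0 : - d != 0 by rewrite oppr_eq0.
rewrite -[X in rip _ X = _](JrE y nd0) -[X in _ = rip X _](JrE x d0) -!scalerA.
rewrite ripBl ripBr rmorphN scaleNr ripNr ripZr ripZl ripiC.
by rewrite (sadj_rsym sA (JrP x d0) (JrP y nd0)); ring.
Qed.

(** On the domain of [A] the difference is [i d J A f], of order [d]; contractivity extends this to
    all [y] by density. The three summands of the decomposition account for [e / 3] each. *)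
Lemma Jr_cvg y e : 0 < e -> exists2 dl, 0 < dl &
  forall d, d != 0 -> `|d| < dl -> rnorm (resolv d y - y) < e.
Proof.
move=> e0; have [_ dA _] := sA.
have e3 : 0 < e / 3 by rewrite divr_gt0.
have [[f g] [/= Afg h]] := dA y (e / 3) e3.
have fy : rnorm (y - f) < e / 3.
  move: h; rewrite /ip_norm.
  by rewrite -/(re_ip ip _ _) (rip_norm norm_ip) sqrtr_sqr ger0_norm ?rnorm_ge0.
have K0 : 0 < rnorm g + 1 by rewrite ltr_wpDl ?rnorm_ge0.
exists (e / 3 / (rnorm g + 1)); first by rewrite divr_gt0.
move=> d d0 dl.
have -> : resolv d y - y = (d%:C * 'i%C) *: resolv d g + (f - y + resolv d (y - f)).
  rewrite JrB// -(Jr_comm d0 Afg).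
  have := JrE f d0; move: ((d%:C * 'i) *: _) => u fE; rewrite -{1}fE.
  vec norm_ip.
apply: le_lt_trans (rnormD _ _) _; apply: le_lt_trans (lerD (lexx _) (rnormD _ _)) _.
rewrite -scalerA rnormZR rnormi rnormBC.
have := Jr_norm (y - f) d0; have := Jr_norm g d0.
rewrite ltr_pdivlMr// in dl; move: dl.
have := normr_ge0 d; have := rnorm_ge0 (resolv d g); move: fy.
move: `|d| (rnorm _) (rnorm _) (rnorm _) (rnorm _) => a b c f' g'; nra.
Qed.

End ResolventFun.

(** * Strong measurability *)

Section StrongMeasurability.
Context {R : realType} {H : completeNormedModType R[i]}.
Variable ip : {dot H for Num.conj}.
Hypothesis norm_ip : forall x : H, `|x| ^+ 2 = ip x x.
Hypothesis sep : exists D : set H, countable D /\ dense D.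
Local Notation rip := (re_ip ip).
Local Notation mu := (@lebesgue_measure R).

Lemma dense_seq : exists e : nat -> H, forall x r, 0 < r -> exists n, rnorm (x - e n) < r.
Proof.
case: sep => D [/countable_injP[f fI] dD].
(* An injection of [D] into the natural numbers is inverted; indices outside its image receive the
   harmless value 0. *)
exists (fun n => xget 0 [set d | D d /\ f d = n]) => x r r0.
have rC : 0 < r%:C by rewrite ltcR.
have [|d [dB Dd]] := dD (ball x r%:C) _ (ball_open x r%:C).
  by exists x; exact: ballxx.
exists (f d); rewrite (_ : xget _ _ = d).
  by rewrite -ltcR rnormE; move: dB; rewrite -ball_normE.
case: xgetP => [d' _ [Dd' fd']|/(_ d)]; last by case.
by apply: fI => //; exact/mem_set.
Qed.

Section OnInterval.
Variable I : interval R.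
Local Notation sm := (@strongly_measurable R H I).

Lemma smZD c (f g : R -> H) : sm f -> sm g -> sm (fun t => c *: f t + g t).
Proof.
move=> [s [ss sf]] [s' [ss' sg]].
exists (fun n => c *: s n + s' n); split=> [n|t tI].
  exact: simple_onZD.
by apply: cvgD; [apply: cvgZr; exact: sf|exact: sg].
Qed.

Lemma simple_cst c : @simple_on R H I (fun=> c).
Proof.
split.
  apply: (@sub_finite_set _ _ [set c]); last exact: finite_set1.
  by move=> _ [t _ <-].
move=> h; have [->|hc] := eqVneq h c.
  by rewrite (_ : _ @^-1` _ = setT) ?setIT; [exact: measurable_itv|exact/seteqP].
rewrite (_ : _ @^-1` _ = set0) ?setI0//; apply/seteqP; split=> // t /= hc'.
by move: hc; rewrite hc' eqxx.
Qed.

Lemma sm_cst c : sm (fun=> c).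
Proof.
by exists (fun _ => fun=> c); split=> [_|t _]; [exact: simple_cst|exact: cvg_cst].
Qed.

Lemma smB f g : sm f -> sm g -> sm (fun t => f t - g t).
Proof.
move=> mf mg; have := smZD (-1) mg mf; congr sm.
by apply/funext => t; rewrite scaleN1r addrC.
Qed.

Lemma smD f g : sm f -> sm g -> sm (fun t => f t + g t).
Proof.
move=> mf mg; have := smZD 1 mf mg; congr sm.
by apply/funext => t; rewrite scale1r.
Qed.

Lemma smZ c f : sm f -> sm (fun t => c *: f t).
Proof.
move=> mf; have := smZD c mf (sm_cst 0); congr sm.
by apply/funext => t; rewrite addr0.
Qed.

Lemma sm_rnorm f : sm f -> measurable_fun [set` I] (fun t => rnorm (f t)).
Proof. exact: strongly_measurable_rnorm. Qed.

Lemma simple_comp (T : H -> H) s : simple_on I s -> simple_on I (T \o s).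
Proof.
move=> ss; split; last by move=> h; exact: (@simple_on_preimage _ _ _ _ (T @^-1` [set h])).
by rewrite -image_comp; apply: finite_image; exact: ss.1.
Qed.

Lemma sm_comp (T : H -> H) f : (forall (u : nat -> H) l, u n @[n --> \oo] --> l -> T (u n) @[n --> \oo] --> T l) ->
  sm f -> sm (fun t => T (f t)).
Proof.
move=> cT [s [ss sf]]; exists (fun n => T \o s n); split=> [n|t tI].
  exact: simple_comp.
by apply: cT; exact: sf.
Qed.

Lemma simple_if (P : set R) (c : H) (s : R -> H) : measurable ([set` I] `&` P) -> simple_on I s ->
  simple_on I (fun t => if t \in P then c else s t).
Proof.
move=> mP [fs ms]; split.
  apply: (@sub_finite_set _ _ ([set c] `|` s @` [set` I])).
    by move=> _ [t tI <-] /=; case: ifP => _; [left|right; exists t].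
  by rewrite finite_setU; split; [exact: finite_set1|].
move=> h.
have mPc : measurable ([set` I] `\` P).
  have -> : [set` I] `\` P = [set` I] `\` ([set` I] `&` P) by rewrite setDIr setDv set0U.
  by apply: measurableD => //; exact: measurable_itv.
have [<-|hc] := eqVneq c h.
  have -> : [set` I] `&` (fun t => if t \in P then c else s t) @^-1` [set c] =
      ([set` I] `&` P) `|` (([set` I] `\` P) `&` ([set` I] `&` s @^-1` [set c])).
    apply/seteqP; split=> t /=.
      move=> [tI]; case: ifPn => [/set_mem Pt _|]; first by left.
      by rewrite notin_setE => nP st; right.
    move=> [[tI Pt]|[[tI nP] [_ st]]]; split=> //; case: ifPn => //.
    by move=> /negP; rewrite inE.
  by apply: measurableU => //; apply: measurableI => //; exact: ms.
have -> : [set` I] `&` (fun t => if t \in P then c else s t) @^-1` [set h] =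
    (([set` I] `\` P) `&` ([set` I] `&` s @^-1` [set h])).
  apply/seteqP; split=> t /=.
    move=> [tI]; case: ifPn => [/set_mem Pt /eqP|]; first by rewrite (negPf hc).
    by rewrite notin_setE => nP st.
  move=> [[tI nP] [_ st]]; split=> //; case: ifPn => //.
  by rewrite inE.
by apply: measurableI => //; exact: ms.
Qed.

Lemma measurable_simple_dist (f s : R -> H) : simple_on I s ->
  (forall d, measurable_fun [set` I] (fun t => rnorm (f t - d))) ->
  measurable_fun [set` I] (fun t => rnorm (f t - s t)).
Proof.
move=> [fs ms] mf mI Y mY.
have -> : [set` I] `&` (fun t => rnorm (f t - s t)) @^-1` Y =
    \bigcup_(v in s @` [set` I]) (([set` I] `&` s @^-1` [set v]) `&`
      ([set` I] `&` (fun t => rnorm (f t - v)) @^-1` Y)).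
  apply/seteqP; split=> [t [tI /= tY]|t [v _ [[tI /= sv] [_ /= s'v]]]].
    by exists (s t); [exists t|].
  by split=> //=; rewrite sv.
apply: fin_bigcup_measurable => // v _.
by apply: measurableI; [exact: ms|exact: mf].
Qed.

(** A best approximation of [f t] among the first [n + 1] points of [e]. Its values stay among
    finitely many points, and it is replaced only on a strict improvement, a measurable
    condition. *)
Fixpoint nearest (e : nat -> H) (f : R -> H) (n : nat) : R -> H :=
  if n is m.+1 then
    fun t => if t \in [set t | rnorm (f t - e n) < rnorm (f t - nearest e f m t)]
             then e n else nearest e f m t
  else fun=> e 0.

(** Separability reduces strong measurability to scalar functions: the nearest-point functions of a
    dense sequence are simple and converge to [f] at every point of [I]. *)
Lemma sm_dist (f : R -> H) : (forall d, measurable_fun [set` I] (fun t => rnorm (f t - d))) -> sm f.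
Proof.
move=> mf; have [e eP] := dense_seq.
exists (nearest e f); split=> [n|t tI].
  elim: n => [|n IH] /=.
    exact: simple_cst.
  apply: simple_if => //.
  have m1 := mf (e n.+1); have m2 := measurable_simple_dist IH mf.
  exact: (measurable_fun_ltr m1 m2 (measurable_itv I) (Y := [set true])).
apply/(rnorm_cvgP _ _) => r r0.
have [N hN] := eP (f t) r r0; exists N => n Nn.
suff h k : (k <= n)%N -> rnorm (f t - nearest e f n t) <= rnorm (f t - e k).
  exact: le_lt_trans (h _ Nn) hN.
elim: n {Nn} => [|n IH]; first by rewrite leqn0 => /eqP ->.
rewrite leq_eqVlt => /orP[/eqP ->|] /=.
  by case: ifPn => //; rewrite notin_setE /= => /negP; rewrite -leNgt.
rewrite ltnS => /IH; apply: le_trans.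
by case: ifPn => //; rewrite inE => /ltW.
Qed.

Lemma measurable_rip f g : sm f -> sm g ->
  measurable_fun [set` I] (fun t => rip (f t) (g t)).
Proof.
move=> mf mg.
have -> : (fun t => rip (f t) (g t)) = (fun t => 2^-1 * (rnorm (f t + g t) ^+ 2 -
    rnorm (f t) ^+ 2 - rnorm (g t) ^+ 2)).
  by apply/funext => t; rewrite (rnorm_sqrD norm_ip); field.
apply: measurable_funM; first exact: measurable_cst.
by apply: measurable_funB; [apply: measurable_funB|]; apply: measurable_funX;
  apply: sm_rnorm => //; exact: smD.
Qed.

Lemma sm_scale (psi : R -> R) f : measurable_fun [set` I] psi -> sm f ->
  sm (fun t => (psi t)%:C *: f t).
Proof.
move=> mp mf; apply: sm_dist => d.
have -> : (fun t => rnorm ((psi t)%:C *: f t - d)) = (fun t => Num.sqrt (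
    (psi t) ^+ 2 * rnorm (f t) ^+ 2 - 2 * (psi t * rip (f t) d) + rnorm d ^+ 2)).
  apply/funext => t; rewrite -[LHS]ger0_norm ?rnorm_ge0// -sqrtr_sqr.
  rewrite (rnorm_sqrB norm_ip) rnormZR ripZl exprMn real_normK ?num_real//.
apply: measurableT_comp; first exact: continuous_measurable_fun (@sqrt_continuous R).
apply: measurable_funD; last exact: measurable_cst.
apply: measurable_funB.
  by apply: measurable_funM; apply: measurable_funX => //; exact: sm_rnorm.
apply: measurable_funM; first exact: measurable_cst.
by apply: measurable_funM => //; apply: measurable_rip => //; exact: sm_cst.
Qed.

Lemma sm_continuous (f : R -> H) :
  (forall t e, 0 < e -> exists2 r, 0 < r & forall s, `|t - s| < r -> rnorm (f t - f s) < e) ->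
  sm f.
Proof.
move=> cf; apply: sm_dist => d; apply: measurable_funTS.
apply: continuous_measurable_fun => t; apply/cvgrPdist_lt => e e0.
have [r r0 hr] := cf t e e0.
near=> s; apply: le_lt_trans (rnorm_dist _ _) _.
rewrite opprB addrA subrK; apply: hr; near: s.
by exists r => //= s; rewrite /ball/=.
Unshelve. all: by end_near. Qed.

End OnInterval.
End StrongMeasurability.

(** * Adjoints in inner product spaces *)

Section InnerSpaces.
Context {R : realType} (X : lmodType R[i]).
Variable ip : X -> X -> R[i].

(** A predicate shared by [H], [L2] and the direct sum. Definiteness is not part of it and is
    assumed separately in [adjoint_linear]. *)
Definition inner_product : Prop :=
  [/\ forall (c : R[i]) x y z, ip (c *: x + y) z = c * ip x z + ip y z,
      forall x y, ip x y = (ip y x)^*%C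
    & forall x, 0 <= complex.Re (ip x x)].

Hypothesis ipP : inner_product.
Local Notation re x y := (complex.Re (ip x y)).
Local Notation nrm := (ip_norm ip).

Lemma inner_linl (c : R[i]) x y z : ip (c *: x + y) z = c * ip x z + ip y z.
Proof. by case: ipP. Qed.

Lemma innerC x y : ip x y = (ip y x)^*%C.
Proof. by case: ipP. Qed.

Lemma innerDl x y z : ip (x + y) z = ip x z + ip y z.
Proof. by have := inner_linl 1 x y z; rewrite scale1r mul1r. Qed.

Lemma inner0l z : ip 0 z = 0.
Proof. by apply: (addrI (ip 0 z)); rewrite -innerDl !addr0. Qed.

Lemma innerZl c x z : ip (c *: x) z = c * ip x z.
Proof. by rewrite -[c *: x]addr0 inner_linl inner0l addr0. Qed.

Lemma innerNl x z : ip (- x) z = - ip x z.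
Proof. by rewrite -scaleN1r innerZl mulN1r. Qed.

Lemma innerBl x y z : ip (x - y) z = ip x z - ip y z.
Proof. by rewrite innerDl innerNl. Qed.

Lemma innerDr x y z : ip x (y + z) = ip x y + ip x z.
Proof. by rewrite innerC innerDl rmorphD /= -!innerC. Qed.

Lemma innerNr x z : ip x (- z) = - ip x z.
Proof. by rewrite innerC innerNl rmorphN /= -!innerC. Qed.

Lemma innerBr x y z : ip x (y - z) = ip x y - ip x z.
Proof. by rewrite innerDr innerNr. Qed.

Lemma innerZr c x z : ip x (c *: z) = c^*%C * ip x z.
Proof. by rewrite innerC innerZl rmorphM /= -!innerC. Qed.

Lemma inner0r z : ip z 0 = 0.
Proof. by rewrite innerC inner0l conjc0. Qed.

Lemma im_re x y : complex.Im (ip x y) = re x ('i%C *: y).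
Proof. by rewrite innerZr; case: (ip x y) => a b /=; ring. Qed.

Lemma inner_eqP x y x' y' : ip x y = ip x' y' <->
  re x y = re x' y' /\ re x ('i%C *: y) = re x' ('i%C *: y').
Proof.
split=> [h|[h1 h2]]; first by rewrite -!im_re h.
by move: h1 h2; rewrite -!im_re; case: (ip x y) => a b; case: (ip x' y') => a' b' /= -> ->.
Qed.

Lemma nrm_ge0 x : 0 <= nrm x. Proof. exact: sqrtr_ge0. Qed.

Lemma nrm_sqr x : nrm x ^+ 2 = re x x.
Proof. by rewrite sqr_sqrtr//; case: ipP. Qed.

Lemma nrm_i x : nrm ('i%C *: x) = nrm x.
Proof.
rewrite /ip_norm innerZl innerZr; congr Num.sqrt.
by case: (ip x x) => a b /=; ring.
Qed.

Lemma inner_CS x y : `|re x y| <= nrm x * nrm y.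
Proof.
rewrite -(@ler_pXn2r _ 2)// ?nnegrE ?mulr_ge0 ?nrm_ge0//.
rewrite real_normK ?num_real// exprMn !nrm_sqr; apply: quad_disc => [||t].
- by case: ipP.
- by case: ipP.
case: ipP => _ _ /(_ (x + t%:C *: y)).
rewrite innerDl !innerDr !innerZl !innerZr (innerC y x).
case: (ip x x) (ip y y) (ip x y) => [a b] [c d] [e f] /=; congr (0 <= _); ring.
Qed.

(** By Cauchy-Schwarz the pairing that defines the adjoint is continuous in both components of [q],
    so a relation valid on [G] persists on its closure. *)
Lemma adjoint_closure (G : set (X * X)) :
  adjoint ip (operator_closure ip G) = adjoint ip G.
Proof.
apply/seteqP; split=> [p h q Gq|p h q cq].
  apply: h => e e0; exists q; rewrite !subrr; split=> //;
  by rewrite /ip_norm inner0l /= sqrtr0.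
(* [c] will be 1 and ['i], to catch the real and the imaginary part with a single estimate. *)
have key (c : R[i]) : (forall x, nrm (c *: x) = nrm x) ->
    (forall q, G q -> re p.1 (c *: q.2) = re p.2 (c *: q.1)) ->
    re p.1 (c *: q.2) = re p.2 (c *: q.1).
  move=> nc hc; apply/eqP; rewrite -subr_eq0 -normr_le0; apply/ler_addgt0Pr => e e0.
  rewrite add0r; set K := nrm p.1 + nrm p.2 + 1.
  have K0 : 0 < K by rewrite /K ltr_wpDl// addr_ge0 ?nrm_ge0.
  have [q' [Gq' q1 q2]] := cq (e / K) ltac:(by rewrite divr_gt0).
  have -> : re p.1 (c *: q.2) - re p.2 (c *: q.1) =
      re p.1 (c *: (q.2 - q'.2)) - re p.2 (c *: (q.1 - q'.1)).
    by rewrite !scalerBr !innerBr !(ReD, ReN) (hc _ Gq'); ring.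
  apply: le_trans (ler_normB _ _) _.
  apply: le_trans (lerD (inner_CS _ _) (inner_CS _ _)) _; rewrite !nc.
  have eK : e = e / K * (nrm p.1 + nrm p.2 + 1) by rewrite divfK// gt_eqF.
  have l1 : nrm p.1 * nrm (q.2 - q'.2) <= nrm p.1 * (e / K).
    by rewrite ler_wpM2l ?nrm_ge0// ltW.
  have l2 : nrm p.2 * nrm (q.1 - q'.1) <= nrm p.2 * (e / K).
    by rewrite ler_wpM2l ?nrm_ge0// ltW.
  have l3 : 0 < e / K by rewrite divr_gt0.
  by move: l1 l2 l3 eK; move: (e / K) => r *; lra.
apply/inner_eqP; split.
  have := key 1; rewrite !scale1r; apply=> [x|q' Gq']; rewrite ?scale1r//.
  by rewrite (h _ Gq').
apply: key => [x|q' Gq']; first exact: nrm_i.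
by rewrite -!im_re (h _ Gq').
Qed.

Lemma dense_ortho (G : set (X * X)) x : densely_defined ip G ->
  (forall p, G p -> re x p.1 = 0) -> re x x = 0.
Proof.
move=> dG h; apply/eqP; rewrite eq_le; apply/andP; split; last by case: ipP.
apply/ler_addgt0Pr => e e0; rewrite add0r.
have n1 : 0 < nrm x + 1 by rewrite ltr_wpDl ?nrm_ge0.
have [p [Gp pe]] := dG x (e / (nrm x + 1)) ltac:(by rewrite divr_gt0).
have -> : re x x = re x (x - p.1) by rewrite innerBr !(ReD, ReN) (h _ Gp) oppr0 addr0.
apply: le_trans (ler_norm _) _; apply: le_trans (inner_CS _ _) _.
apply: (@le_trans _ _ (nrm x * (e / (nrm x + 1)))).
  by rewrite ler_wpM2l ?nrm_ge0// ltW.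
rewrite mulrCA ger_pMr// ler_pdivrMr// mul1r lerDl//.
Qed.

(** Density of the domain makes the adjoint single-valued: two values differ by a vector orthogonal
    to a dense set. *)
Lemma adjoint_linear (G : set (X * X)) :
  (forall x, re x x = 0 -> x = 0) -> densely_defined ip G ->
  linear_operator (adjoint ip G).
Proof.
move=> def dG; split.
- by move=> q _ /=; rewrite !inner0l.
- by move=> c p q hp hq r Gr /=; rewrite !inner_linl hp// hq.
- move=> x y z hy hz; apply/eqP; rewrite -subr_eq0; apply/eqP/def.
  apply: (dense_ortho dG) => p Gp.
  by rewrite innerBl -(hy _ Gp) -(hz _ Gp) /= subrr.
Qed.

End InnerSpaces.

Section SumInner.
Context {R : realType} (X1 X2 : lmodType R[i]).
Variables (ip1 : X1 -> X1 -> R[i]) (ip2 : X2 -> X2 -> R[i]).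
Hypotheses (h1 : inner_product ip1) (h2 : inner_product ip2).

Lemma sum_inner : inner_product (sum_ip ip1 ip2).
Proof.
split=> [c x y z|x y|x]; rewrite /sum_ip /=.
- by rewrite (inner_linl h1) (inner_linl h2); ring.
- by rewrite (innerC h1) (innerC h2) rmorphD.
- by rewrite ReD addr_ge0//; [case: h1|case: h2].
Qed.

Lemma sum_norm_le x : ip_norm (sum_ip ip1 ip2) x <= ip_norm ip1 x.1 + ip_norm ip2 x.2.
Proof.
rewrite -(@ler_pXn2r _ 2)// ?nnegrE ?addr_ge0 ?nrm_ge0//.
rewrite (nrm_sqr sum_inner) /sum_ip ReD sqrrD (nrm_sqr h1) (nrm_sqr h2).
by rewrite lerD2r lerDl mulrn_wge0// mulr_ge0 ?nrm_ge0.
Qed.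

End SumInner.

Lemma dot_inner {R : realType} (H : lmodType R[i]) (ip : {dot H for Num.conj}) :
  inner_product ip.
Proof.
split=> [c x y z|x y|x].
- by rewrite linearPl.
- by rewrite (hermC ip) expr0 mul1r.
- by have := dnorm_ge0 ip x; rewrite lecE => /andP[].
Qed.

(** * The inner product of L^2 *)

Section AlmostEverywhere.
Context {R : realType}.
Local Notation mu := (@lebesgue_measure R).

Lemma measurable_Itv (I : interval R) : measurable ([set` I] : set (measurableTypeR R)).
Proof. exact: measurable_itv. Qed.

Lemma ae_sub (P Q : R -> Prop) : (forall t, P t -> Q t) ->
  {ae mu, forall t, P t} -> {ae mu, forall t, Q t}.
Proof. by move=> PQ; apply: filterS PQ; exact: (ae_filter_ringOfSetsType mu). Qed.

Lemma ae_sub2 (P Q S : R -> Prop) : (forall t, P t -> Q t -> S t) ->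
  {ae mu, forall t, P t} -> {ae mu, forall t, Q t} -> {ae mu, forall t, S t}.
Proof. by move=> PQ; apply: filterS2 PQ; exact: (ae_filter_ringOfSetsType mu). Qed.

Lemma ae_and (P Q : R -> Prop) :
  {ae mu, forall t, P t} -> {ae mu, forall t, Q t} -> {ae mu, forall t, P t /\ Q t}.
Proof. by apply: ae_sub2. Qed.

End AlmostEverywhere.

Section SquareIntegrableFunctions.
Context {R : realType} {H : completeNormedModType R[i]}.
Variable ip : {dot H for Num.conj}.
Hypothesis norm_ip : forall x : H, `|x| ^+ 2 = ip x x.
Local Notation rip := (re_ip ip).
Local Notation mu := (@lebesgue_measure R).
Variable I : interval R.
Local Notation sm := (@strongly_measurable R H I).
Local Notation sq := (@square_integrable R H I).
Local Notation int f := (mu.-integrable [set` I] (EFin \o f)).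
Let mI : measurable ([set` I] : set (measurableTypeR R)) := measurable_Itv I.

Lemma sqZD c f g : sq f -> sq g -> sq (fun t => c *: f t + g t).
Proof.
move=> hf hg; have [_ h] := @sq_integrable_submod_closed R H I.
by have := h c f g; rewrite !inE; apply.
Qed.

Lemma sq0 : sq (fun=> 0).
Proof. by have [h _] := @sq_integrable_submod_closed R H I; rewrite inE in h. Qed.

Lemma sqB f g : sq f -> sq g -> sq (fun t => f t - g t).
Proof.
move=> mf mg; have := sqZD (-1) mg mf; congr sq.
by apply/funext => t; rewrite scaleN1r addrC.
Qed.

Lemma sqD f g : sq f -> sq g -> sq (fun t => f t + g t).
Proof.
move=> mf mg; have := sqZD 1 mf mg; congr sq.
by apply/funext => t; rewrite scale1r.
Qed.

Lemma sqZ c f : sq f -> sq (fun t => c *: f t).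
Proof.
move=> mf; have := sqZD c mf sq0; congr sq.
by apply/funext => t; rewrite addr0.
Qed.

Lemma sq_sm f : sq f -> sm f. Proof. by case. Qed.

Lemma sq_int f : sq f -> int (fun t => rnorm (f t) ^+ 2).
Proof.
move=> [mf If]; apply/integrableP; split.
  by apply/measurable_EFinP; apply: measurable_funX; exact: sm_rnorm.
by under eq_integral do rewrite /= ger0_norm ?sqr_ge0//.
Qed.

Lemma int_sq f : sm f -> int (fun t => rnorm (f t) ^+ 2) -> sq f.
Proof.
move=> mf /integrableP[_ h]; split=> //; apply: le_lt_trans h.
by under [leRHS]eq_integral do rewrite /= ger0_norm ?sqr_ge0//.
Qed.

Lemma int_le (f g : R -> R) : measurable_fun [set` I] f ->
  (forall t, t \in I -> `|f t| <= g t) -> int g -> int f.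
Proof.
move=> mf fg; apply: le_integrable => //; first exact/measurable_EFinP.
move=> t tI /=; rewrite lee_fin; apply: le_trans (fg t tI) _; exact: ler_norm.
Qed.

Lemma sq_le f g C : sm f -> sq g -> (forall t, t \in I -> rnorm (f t) <= C * rnorm (g t)) -> sq f.
Proof.
move=> mf hg fg; apply: int_sq => //.
apply: (@int_le _ (fun t => C ^+ 2 * rnorm (g t) ^+ 2)).
- by apply: measurable_funX; exact: sm_rnorm.
- move=> t tI; rewrite ger0_norm ?sqr_ge0// -exprMn lerXn2r ?nnegrE ?rnorm_ge0//.
    by apply: le_trans (fg t tI); exact: rnorm_ge0.
  exact: fg.
- have := integrableZl mI (C ^+ 2) (sq_int hg).
  by apply: eq_integrable => // t _; rewrite /= EFinM.
Qed.

Lemma int_rip f g : sq f -> sq g -> int (fun t => rip (f t) (g t)).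
Proof.
move=> hf hg.
apply: (@int_le _ (fun t => rnorm (f t) ^+ 2 + rnorm (g t) ^+ 2)).
- by apply: measurable_rip => //; exact: sq_sm.
- move=> t _; apply: le_trans (rip_CS norm_ip _ _) _.
  have := sqr_ge0 (rnorm (f t) - rnorm (g t)); rewrite sqrrB.
  have := sqr_ge0 (rnorm (f t)); have := sqr_ge0 (rnorm (g t)); lra.
- have := integrableD mI (sq_int hf) (sq_int hg).
  by apply: eq_integrable => // t _.
Qed.

Lemma int_D (f g : R -> R) : int f -> int g -> int (fun t => f t + g t).
Proof. by move=> hf hg; have := integrableD mI hf hg; apply: eq_integrable. Qed.

Lemma int_B (f g : R -> R) : int f -> int g -> int (fun t => f t - g t).
Proof. by move=> hf hg; have := integrableB mI hf hg; apply: eq_integrable. Qed.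

Lemma int_Z c (f : R -> R) : int f -> int (fun t => c * f t).
Proof. by move=> hf; have := integrableZl mI c hf; apply: eq_integrable. Qed.

Lemma Rintegral_ae (f g : R -> R) :
  measurable_fun [set` I] f -> measurable_fun [set` I] g ->
  {ae mu, forall t, [set` I] t -> f t = g t} ->
  \int[mu]_(t in [set` I]) f t = \int[mu]_(t in [set` I]) g t.
Proof.
move=> mf mg fg; congr fine; apply: ae_eq_integral => //.
- exact/measurable_EFinP.
- exact/measurable_EFinP.
by apply: ae_sub fg => t h tI; rewrite h.
Qed.

Definition re_rint (f g : R -> H) := \int[mu]_(t in [set` I]) rip (f t) (g t).
Local Notation rint := re_rint.

Lemma eq_rint f g f' g' : sm f -> sm g -> sm f' -> sm g' ->
  {ae mu, forall t, [set` I] t -> f t = f' t} ->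
  {ae mu, forall t, [set` I] t -> g t = g' t} -> rint f g = rint f' g'.
Proof.
move=> mf mg mf' mg' ff gg; apply: Rintegral_ae; try exact: measurable_rip.
by apply: ae_sub2 ff gg => t h1 h2 tI; rewrite h1// h2.
Qed.

Lemma rintC f g : rint f g = rint g f.
Proof. by apply: eq_Rintegral => t _; rewrite ripC. Qed.

Lemma rintDl f g h : sq f -> sq g -> sq h -> rint (fun t => f t + g t) h = rint f h + rint g h.
Proof.
move=> hf hg hh; rewrite /re_rint -RintegralD//; try exact: int_rip.
by apply: eq_Rintegral => t _; rewrite ripDl.
Qed.

Lemma rintBl f g h : sq f -> sq g -> sq h -> rint (fun t => f t - g t) h = rint f h - rint g h.
Proof.
move=> hf hg hh; rewrite /re_rint -RintegralB//; try exact: int_rip.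
by apply: eq_Rintegral => t _; rewrite ripBl.
Qed.

Lemma rintZl (c : R) f g : sq f -> sq g -> rint (fun t => c%:C *: f t) g = c * rint f g.
Proof.
move=> hf hg; rewrite /re_rint -RintegralZl//; try exact: int_rip.
by apply: eq_Rintegral => t _; rewrite ripZl.
Qed.

Lemma rintiC f g : sq f -> sq g -> rint (fun t => 'i%C *: f t) g = - rint f (fun t => 'i%C *: g t).
Proof.
move=> hf hg; rewrite -mulN1r -rintC -rintZl//; last by exact: sqZ.
rewrite rintC; apply: eq_Rintegral => t _.
by rewrite ripZl mulN1r ripiC ripC.
Qed.

Lemma rint_ge0 f : 0 <= rint f f.
Proof. by apply: Rintegral_ge0 => t _; exact: rip_ge0. Qed.

End SquareIntegrableFunctions.

(** * Classes of square integrable functions as an inner product space *)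

Section L2Space.
Context {R : realType} {H : completeNormedModType R[i]}.
Variable ip : {dot H for Num.conj}.
Hypothesis norm_ip : forall x : H, `|x| ^+ 2 = ip x x.
Local Notation rip := (re_ip ip).
Local Notation mu := (@lebesgue_measure R).
Variable I : interval R.
Local Notation sm := (@strongly_measurable R H I).
Local Notation sq := (@square_integrable R H I).
Local Notation rint := (re_rint ip I).

Lemma L2_sq (u : L2 H I) : sq (L2_repr u).
Proof. by case: (L2_repr u) => f /=; rewrite inE. Qed.

Definition toL2 (f : R -> H) (hf : sq f) : L2 H I := L2_class (SqIntegrableFun (mem_set hf)).

Lemma toL2_repr f (hf : sq f) : represents (toL2 hf) f.
Proof.
have : L2_class (L2_repr (toL2 hf)) == L2_class (SqIntegrableFun (mem_set hf)).
  by rewrite L2_reprK.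
rewrite L2_classE inE; apply: ae_sub => t /= h /h /eqP.
by rewrite subr_eq0 => /eqP.
Qed.

Lemma represents_inj (u v : L2 H I) f : represents u f -> represents v f -> u = v.
Proof.
move=> hu hv; rewrite -[u]L2_reprK -[v]L2_reprK; apply/eqP; rewrite L2_classE inE.
apply: ae_sub2 hu hv => t h1 h2 tI.
by rewrite -[LHS]/(L2_repr u t - L2_repr v t) h1// h2// subrr.
Qed.

Lemma represents_self (u : L2 H I) : represents u (L2_repr u).
Proof. exact: aeW. Qed.

Lemma representsZD c (u v : L2 H I) f g : represents u f -> represents v g ->
  represents (c *: u + v) (fun t => c *: f t + g t).
Proof.
move=> hu hv.
have hs := sqZD c (L2_sq u) (L2_sq v).
have -> : c *: u + v = toL2 hs.
  rewrite -[u in LHS]L2_reprK -[v in LHS]L2_reprK.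
  rewrite -[c *: _]/(L2_scale _ _) L2_scale_class -L2_classD.
  by rewrite /toL2; congr L2_class; apply: val_inj.
have := toL2_repr hs; rewrite /represents => h3.
have h12 := ae_and hu hv; apply: ae_sub2 h12 h3 => t [h1 h2] h3 tI.
by rewrite h3//= h1// h2.
Qed.

(** [L2_ip] integrates the chosen representatives; measurability of [f] and [g] is what allows them
    to take their place. *)
Lemma L2_ipE (u v : L2 H I) f g : sm f -> sm g -> represents u f -> represents v g ->
  L2_ip ip u v = rint f g +i* rint f (fun t => 'i%C *: g t).
Proof.
move=> mf mg hu hv; rewrite /L2_ip; congr (_ +i* _).
  by apply: eq_rint => //; apply: sq_sm; exact: L2_sq.
transitivity (rint (L2_repr u) (fun t => 'i%C *: L2_repr v t)).
  by apply: eq_Rintegral => t _; exact: Im_ip.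
apply: eq_rint => //; try by apply: smZ.
- by apply: sq_sm; exact: L2_sq.
- by apply: smZ; apply: sq_sm; exact: L2_sq.
by apply: ae_sub hv => t h tI; rewrite h.
Qed.

Lemma L2_ip_repr (u v : L2 H I) :
  L2_ip ip u v = rint (L2_repr u) (L2_repr v) +i* rint (L2_repr u) (fun t => 'i%C *: L2_repr v t).
Proof. by apply: L2_ipE; try exact: represents_self; apply: sq_sm; exact: L2_sq. Qed.

Lemma L2_inner : inner_product (@L2_ip R H I ip).
Proof.
have rD f g h : sq f -> sq g -> sq h -> rint (fun t => f t + g t) h = rint f h + rint g h.
  exact: rintDl.
split=> [c x y z|x y|x].
- have hx := L2_sq x; have hy := L2_sq y; have hz := L2_sq z.
  have hi := sqZ 'i%C hz.
  rewrite (@L2_ipE _ _ (fun t => c *: L2_repr x t + L2_repr y t) (L2_repr z)); try exact: represents_self.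
  (* [re_rint] is only real-linear, so the scalar [c] is split into real and imaginary part, the
     latter acting through ['i]. *)
  + have cE f : sq f -> rint (fun t => c *: L2_repr x t + L2_repr y t) f =
       complex.Re c * rint (L2_repr x) f - complex.Im c * rint (L2_repr x) (fun t => 'i%C *: f t)
        + rint (L2_repr y) f.
      move=> hf; rewrite rD//; last exact: sqZ.
      congr (_ + _).
      have -> : (fun t => c *: L2_repr x t) = (fun t => (complex.Re c)%:C *: L2_repr x t +
          (complex.Im c)%:C *: ('i%C *: L2_repr x t)).
        by apply/funext => t; rewrite scalerA -scalerDl [in LHS](complexE c) (mulrC 'i).
      rewrite rD//; try by repeat apply: sqZ.
      by rewrite !rintZl//; [rewrite rintiC// mulrN|exact: sqZ].
    rewrite !cE//.
    rewrite !L2_ip_repr.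
    have -> : rint (L2_repr x) (fun t => 'i%C *: ('i%C *: L2_repr z t)) = - rint (L2_repr x) (L2_repr z).
      rewrite rintC -mulN1r [in RHS]rintC -rintZl//.
      by apply: eq_Rintegral => t _; rewrite scalerA -expr2 sqr_i rmorphN1.
    case: c {cE} => a b /=.
    by apply/eqP; rewrite eq_complex /=; apply/andP; split; apply/eqP; ring.
  + by apply: smZD; apply: sq_sm.
  + by apply: sq_sm.
  + by apply: representsZD; exact: represents_self.
- have hx := L2_sq x; have hy := L2_sq y.
  rewrite !L2_ip_repr.
  rewrite rintC; congr (_ +i* _).
  by rewrite rintC rintiC.
- exact: rint_ge0.
Qed.

Lemma toL2_0 : toL2 (@sq0 R H I) = 0.
Proof.
have h := toL2_repr (@sq0 R H I).
apply: (@represents_inj _ _ (fun=> 0)) => //.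
have := representsZD (-1) h h; rewrite scaleN1r addNr; congr represents.
by apply/funext => t; rewrite scaler0 addr0.
Qed.

Lemma L2_re0 (u : L2 H I) : complex.Re (L2_ip ip u u) = 0 -> u = 0.
Proof.
move=> u0; have hu := L2_sq u; rewrite -toL2_0.
apply: (@represents_inj _ _ (fun=> 0)); last exact: toL2_repr.
have m : measurable_fun ([set` I] : set (measurableTypeR R)) (EFin \o (fun t => rnorm (L2_repr u t) ^+ 2)).
  by apply/measurable_EFinP; apply: measurable_funX; apply: sm_rnorm; exact: sq_sm.
have [+ _] := ae_eq_integral_abs (@lebesgue_measure R) (measurable_itv I) m.
have -> : (\int[mu]_(x in [set` I]) `|(EFin \o (fun t => (rnorm (L2_repr u t) ^+ 2)%R)) x| = 0)%E.
  under eq_integral do rewrite /= ger0_norm ?sqr_ge0//.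
  have h := integrable_fin_num (measurable_Itv I) (sq_int hu).
  rewrite -[LHS]fineK//; congr (_%:E); rewrite -[RHS]u0.
  by apply: eq_Rintegral => t _; rewrite -(rip_norm norm_ip).
move=> /(_ erefl); apply: ae_sub => t /= h /h /eqP.
by rewrite eqe sqrf_eq0 => /eqP/rnorm_eq0.
Qed.

End L2Space.

(** * Smooth functions with compact support *)

Section SmoothFunctions.
Context {R : realType}.
Implicit Types f g : R -> R.

Definition has_deriv f f' := forall t : R, is_derive t (1 : R) f (f' t).

(** The derivatives are given as witnesses, so that sums, products and inverses are handled by
    induction on [n]; [diffn_smooth] returns to the iterated [derive1n]. *)
Fixpoint diffn (n : nat) f : Prop :=
  if n is m.+1 then exists f', has_deriv f f' /\ diffn m f' else True.

Lemma has_derivE f f' : has_deriv f f' -> derive1 f = f'.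
Proof. by move=> h; apply/funext => t; rewrite derive1E; have := h t => -[]. Qed.

Lemma diffn_smooth f : (forall n, diffn n f) -> smooth f.
Proof.
move=> h n; elim: n f h => [|n IH] f h t.
  by have [f' [hf _]] := h 1%N; have := hf t => -[].
rewrite derive1Sn; apply: IH => m.
have [f' [hf hm]] := h m.+1; by rewrite (has_derivE hf).
Qed.

Lemma diffnW n f : diffn n.+1 f -> diffn n f.
Proof.
elim: n f => // n IH f [f' [hf h]]; exists f'; split=> //.
exact: IH.
Qed.

Lemma has_deriv_eq f f' g : has_deriv f f' -> (forall t, f' t = g t) -> has_deriv f g.
Proof. by move=> h fg t; rewrite -fg. Qed.

Lemma has_derivD f f' g g' : has_deriv f f' -> has_deriv g g' ->
  has_deriv (fun t => f t + g t) (fun t => f' t + g' t).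
Proof. by move=> hf hg t; have := hf t; have := hg t => ? ?; exact: is_deriveD. Qed.

Lemma has_derivM f f' g g' : has_deriv f f' -> has_deriv g g' ->
  has_deriv (fun t => f t * g t) (fun t => f' t * g t + f t * g' t).
Proof.
move=> hf hg t; have := hf t; have := hg t => ? ?.
by apply: is_derive_eq; rewrite addrC /GRing.scale /= mulrC.
Qed.

Lemma has_deriv_cst c : has_deriv (fun=> c) (fun=> 0).
Proof. by move=> t; exact: is_derive_cst. Qed.

Lemma has_deriv_id : has_deriv (fun t => t) (fun=> 1).
Proof. by move=> t; exact: is_derive_id. Qed.

Lemma has_deriv_affine f f' c d : has_deriv f f' ->
  has_deriv (fun t => f (c * t + d)) (fun t => c * f' (c * t + d)).
Proof.
move=> hf t.
have h1 : is_derive t (1 : R) (fun t => c * t + d) c.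
  have := has_derivD (has_derivM (has_deriv_cst c) has_deriv_id) (has_deriv_cst d) t.
  by move=> h; apply: is_derive_eq; rewrite mul0r add0r mulr1 addr0.
have h2 := hf (c * t + d).
have := is_derive1_comp (f := f) (g := fun t => c * t + d).
by move=> /(_ _ _ _ h2 h1) h; rewrite mulrC.
Qed.

Lemma has_derivV f f' : (forall t, f t != 0) -> has_deriv f f' ->
  has_deriv (fun t => (f t)^-1) (fun t => - f' t * ((f t)^-1 * (f t)^-1)).
Proof.
move=> f0 hf t; have [d e] := hf t.
apply: DeriveDef; first exact: derivableV.
by rewrite deriveV// e /GRing.scale /= mulrC mulrN mulNr -expr2 exprVn.
Qed.

Lemma diffnD n f g : diffn n f -> diffn n g -> diffn n (fun t => f t + g t).
Proof.
elim: n f g => // n IH f g [f' [hf h]] [g' [hg h']].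
by exists (fun t => f' t + g' t); split; [exact: has_derivD|exact: IH].
Qed.

Lemma diffnM n f g : diffn n f -> diffn n g -> diffn n (fun t => f t * g t).
Proof.
elim: n f g => // n IH f g hf hg; have hf1 := diffnW hf; have hg1 := diffnW hg.
move: hf hg => [f' [hf h]] [g' [hg h']].
exists (fun t => f' t * g t + f t * g' t); split; first exact: has_derivM.
by apply: diffnD; exact: IH.
Qed.

Lemma diffn_cst n c : diffn n (fun=> c).
Proof. by elim: n c => // n IH c; exists (fun=> 0); split=> //; exact: has_deriv_cst. Qed.

Lemma diffn_affine n f c d : diffn n f -> diffn n (fun t => f (c * t + d)).
Proof.
elim: n f => // n IH f [f' [hf h]]; exists (fun t => c * f' (c * t + d)); split.
  exact: has_deriv_affine.
by apply: diffnM; [exact: diffn_cst|exact: IH].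
Qed.

Lemma diffnV n f : (forall t, f t != 0) -> diffn n f -> diffn n (fun t => (f t)^-1).
Proof.
move=> f0; elim: n => // n IH hf; have hV := IH (diffnW hf).
move: hf => [f' [hf h]].
exists (fun t => - f' t * ((f t)^-1 * (f t)^-1)); split; first exact: has_derivV.
apply: diffnM; last exact: diffnM.
have := diffnM (diffn_cst n (-1)) h; congr diffn.
by apply/funext => t; rewrite mulN1r.
Qed.

(* [x ^ - k * exp (- 1 / x)] on the positive half-line; the derivative of the k-th function
   is a combination of the next two, which gives smoothness by induction. *)
Definition flat (k : nat) (x : R) : R := if 0 < x then x ^- k * expR (- x^-1) else 0.

(** The Taylor term of order [k + 1] bounds [expR x^-1] from below; the spare power of [x] on the
    right gives the derivative at 0. *)
Lemma flat_le k (x : R) : 0 < x -> x ^- k * expR (- x^-1) <= k.+1`!%:R * x.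
Proof.
move=> x0; have xV : 0 <= x^-1 by rewrite invr_ge0 ltW.
have h := expR_ge1Dxn k xV.
rewrite expRN ler_pdivrMr ?expR_gt0//.
have F0 : 0 < (k.+1)`!%:R :> R by rewrite ltr0n fact_gt0.
have h1 : (x^-1) ^+ k.+1 <= k.+1`!%:R * expR x^-1.
  rewrite mulrC -ler_pdivrMr//; apply: le_trans h; rewrite lerDr//.
rewrite -mulrA mulrCA -ler_pdivrMl//; apply: le_trans h1.
by rewrite exprVn exprS invfM.
Qed.

Lemma flat_deriv k : has_deriv (flat k) (fun x => - k%:R * flat k.+1 x + flat k.+2 x).
Proof.
move=> x; have [x0|x0|<-] := ltgtP 0 x.
- have E : \near x, x ^- k * expR (- x^-1) = flat k x.
    near=> y; rewrite /flat ifT//; near: y; exact: (cvgr_gt x).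
  apply: (near_eq_is_derive E); rewrite /flat x0.
  have xn : x != 0 by rewrite gt_eqF.
  have h1 : is_derive x (1 : R) (fun y => y^-1) (- x ^- 2).
    by apply: DeriveDef; [exact: derivableV|rewrite deriveV// derive_id /GRing.scale /= mulr1].
  have h2 : is_derive x (1 : R) (fun y => expR (- y^-1)) (expR (- x^-1) * x ^- 2).
    have h := is_deriveN h1.
    have := @is_derive1_comp _ expR (fun y => - y^-1) x _ _ (is_derive_expR _) h.
    by rewrite opprK.
  have h3 : is_derive x (1 : R) (fun y => y ^- k) (- k%:R * x ^- k.+1).
    have -> : (fun y : R => y ^- k) = (fun y => y^-1) ^+ k.
      by apply/funext => y; rewrite -exprVn; elim: k {E} => // k IH; rewrite !exprS IH.
    have h := is_deriveX k h1; apply: is_derive_eq.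
    rewrite /GRing.scale /= -!exprVn; case: k {E h} => [|k]; first by rewrite !mul0r oppr0 mul0r.
    by rewrite /= !exprS; ring.
  have h := is_deriveM h3 h2.
  apply: is_derive_eq; rewrite /GRing.scale /= -!exprVn !exprS; ring.
- have E : \near x, 0 = flat k x.
    near=> y; rewrite /flat ifF//; apply/negbTE; rewrite -leNgt; near: y.
    exact: (cvgr_le x).
  apply: (near_eq_is_derive E).
  rewrite /flat ltNge (ltW x0)/= !(mulr0, addr0).
  exact: is_derive_cst.
- rewrite /flat ltxx !(mulr0, addr0).
  (* From the left the difference quotient at 0 is 0; from the right it is the flat function of
     index [k + 1], which [flat_le] makes small. *)
  have c : (fun h : R => h^-1 *: ((flat k \o shift 0) (h *: 1) - flat k 0)) @ 0^' --> (0 : R).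
    apply/cvgrPdist_le => e e0; near=> h.
    have h0 : h != 0 by near: h; exact: nbhs_dnbhs_neq.
    rewrite /= /flat ltxx subr0 addr0 sub0r normrN /GRing.scale /= mulr1.
    case: ltgtP (h0) => // h1 _; last by rewrite mulr0 normr0 ltW.
    rewrite ger0_norm; last by rewrite !mulr_ge0 ?invr_ge0 ?exprn_ge0 ?expR_ge0// ltW.
    have -> : h^-1 * (h ^- k * expR (- h^-1)) = h ^- k.+1 * expR (- h^-1) by rewrite exprS invfM mulrA.
    have F0 : 0 < k.+2`!%:R :> R by rewrite ltr0n fact_gt0.
    apply: le_trans (flat_le k.+1 h1) _; rewrite mulrC -ler_pdivlMr//.
    apply: le_trans (ler_norm _) _; near: h.
    apply: cvg_within; exists (e / k.+2`!%:R) => /=; first by rewrite divr_gt0.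
    by move=> h /=; rewrite sub0r normrN => /ltW.
  by apply: DeriveDef; [apply/cvg_ex; exists 0|exact/cvg_lim].
Unshelve. all: by end_near. Qed.

End SmoothFunctions.

Section SmoothStep.
Context {R : realType}.
Implicit Types x t : R.

Lemma flat_ge0 k x : 0 <= flat k x.
Proof.
rewrite /flat; case: ifP => // x0.
by rewrite mulr_ge0 ?expR_ge0// invr_ge0 exprn_ge0// ltW.
Qed.

Lemma flat_gt0 k x : 0 < x -> 0 < flat k x.
Proof. by move=> x0; rewrite /flat x0 mulr_gt0 ?expR_gt0// invr_gt0 exprn_gt0. Qed.

Lemma flat_eq0 k x : x <= 0 -> flat k x = 0.
Proof. by move=> x0; rewrite /flat ltNge x0. Qed.

Lemma diffn_flat n k : diffn n (@flat R k).
Proof.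
elim: n k => // n IH k; exists (fun x => - k%:R * flat k.+1 x + flat k.+2 x); split.
  exact: flat_deriv.
by apply: diffnD => //; apply: diffnM => //; exact: diffn_cst.
Qed.

(** Positive, because [x] and [1 - x] are never both nonpositive; this makes [step] a smooth
    transition from 0 to 1. *)
Definition step_den x : R := flat 0 x + flat 0 (-1 * x + 1).

Lemma step_den_gt0 x : 0 < step_den x.
Proof.
rewrite /step_den; have [x0|x0] := ltP 0 x.
  by rewrite ltr_pwDl ?flat_ge0// flat_gt0.
by rewrite ltr_wpDl ?flat_ge0// flat_gt0//; lra.
Qed.

Definition step x : R := flat 0 x * (step_den x)^-1.

Lemma diffn_step n : diffn n step.
Proof.
apply: diffnM; first exact: diffn_flat.
apply: diffnV; first by move=> t; rewrite gt_eqF// step_den_gt0.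
by apply: diffnD; [exact: diffn_flat|apply: (diffn_affine (f := flat 0)); exact: diffn_flat].
Qed.

Lemma step_le0 x : x <= 0 -> step x = 0.
Proof. by move=> x0; rewrite /step flat_eq0// mul0r. Qed.

Lemma step_ge1 x : 1 <= x -> step x = 1.
Proof.
move=> x1; rewrite /step /step_den [flat 0 (_ + _)]flat_eq0 ?addr0 ?divff//; last by lra.
by rewrite gt_eqF// flat_gt0//; lra.
Qed.

Lemma step_ge0 x : 0 <= step x.
Proof. by rewrite /step divr_ge0 ?flat_ge0// ltW// step_den_gt0. Qed.

Lemma step_le1 x : step x <= 1.
Proof. by rewrite /step ler_pdivrMr ?step_den_gt0// mul1r /step_den lerDl flat_ge0. Qed.

Lemma deriv_uniq (f f' g : R -> R) : has_deriv f f' -> has_deriv f g -> f' = g.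
Proof. by move=> /has_derivE <- /has_derivE. Qed.

Lemma has_deriv_cts (f f' : R -> R) : has_deriv f f' -> continuous f.
Proof.
move=> h t; have [d _] := h t.
by apply/differentiable_continuous/derivable1_diffP.
Qed.

(** Continuity of [d] comes from [diffn_step]; the explicit quotient rule [e] serves to see that [d]
    vanishes outside []0, 1[]. Boundedness then follows by compactness of [[0, 1]]. *)
Lemma step_deriv : exists d M, [/\ has_deriv step d, continuous d,
  forall x, `|d x| <= M, 0 <= M & forall x, ~ (0 < x < 1) -> d x = 0].
Proof.
have [d [hd [d' [hd' _]]]] := diffn_step 2.
have cd := has_deriv_cts hd'.
pose e := fun x : R => (- 0%:R * flat 1 x + flat 2 x) * (step_den x)^-1 +
  flat 0 x * (- ((- 0%:R * flat 1 x + flat 2 x) + (-1) * (- 0%:R * flat 1 (-1 * x + 1) + flat 2 (-1 * x + 1)))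
     * ((step_den x)^-1 * (step_den x)^-1)).
have he : has_deriv step e.
  apply: has_derivM; first exact: flat_deriv.
  apply: has_derivV; first by move=> t; rewrite gt_eqF// step_den_gt0.
  by apply: has_derivD; [exact: flat_deriv|exact: (@has_deriv_affine _ (flat 0) _ (-1) 1 (flat_deriv 0))].
have de := deriv_uniq hd he.
have d0 x : ~ (0 < x < 1) -> d x = 0.
  move=> /negP; rewrite negb_and -!leNgt => /orP[x0|x1].
    by rewrite de /e !(flat_eq0 _ x0) !(mulr0, mul0r, addr0).
  have n0 : step_den x != 0 by rewrite gt_eqF// step_den_gt0.
  have x2 : -1 * x + 1 <= 0 by lra.
  have sE : step_den x = flat 0 x by rewrite /step_den (flat_eq0 _ x2) addr0.
  rewrite de /e !(flat_eq0 _ x2) -sE.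
  by field; rewrite n0.
have [M hM] : exists M, forall x, x \in `[0, 1] -> `|d x| <= M.
  have [||c _ hc] := @EVT_max R (fun x => `|d x|) 0 1 => //.
    apply: continuous_subspaceT => x.
    exact: (@continuous_comp _ _ _ d Num.norm x (cd x) (@norm_continuous _ _ _)).
  by exists `|d c|.
have M0 : 0 <= M by apply: le_trans (hM 0 _) => //; rewrite in_itv /= lexx ler01.
exists d, M; split=> // x.
have [x01|x01] := boolP (0 < x < 1); last by rewrite d0 ?normr0//; exact/negP.
by apply: hM; rewrite in_itv /=; move: x01 => /andP[/ltW -> /ltW ->].
Qed.

Lemma real_test_function (I : interval R) (phi : R -> R) p q :
  (forall n, diffn n phi) -> (forall t, ~ (p <= t <= q) -> phi t = 0) ->
  (forall t, p <= t <= q -> t \in I) -> test_function I (fun t => (phi t)%:C).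
Proof.
move=> dp p0 pI.
have cl : closure [set t | (phi t)%:C != 0] `<=` `[p, q]%classic.
  rewrite closureE => t; apply; split; first exact: itv_closed.
  move=> s /=; rewrite (inj_eq (@complexI R)) => ps; rewrite in_itv /=.
  by apply/negPn/negP => /negP/p0 /eqP; rewrite (negPf ps).
split.
- exact: (diffn_smooth dp).
- by apply: diffn_smooth => n; exact: diffn_cst.
- exact: (subclosed_compact (@closed_closure _ _) (@segment_compact _ p q) cl).
- by move=> t /cl /=; rewrite in_itv /=; exact: pI.
Qed.

Lemma cderive_real (phi phi' : R -> R) t : has_deriv phi phi' ->
  cderive (fun t => (phi t)%:C) t = (phi' t)%:C.
Proof.
move=> h; rewrite /cderive; congr (_ +i* _); first by rewrite -(has_derivE h).
exact: (congr1 (fun f : R -> R => f t) (has_derivE (has_deriv_cst 0))).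
Qed.

(** Product of a rising and a falling step; the slope [2 / r] places each transition between the
    distances [r / 2] and [r] from [c]. *)
Lemma plateau (c r : R) : 0 < r -> exists phi, [/\ forall n, diffn n phi,
  forall t, 0 <= phi t <= 1, forall t, `|t - c| <= r / 2 -> phi t = 1
  & forall t, ~ (`|t - c| <= r) -> phi t = 0].
Proof.
move=> r0; pose f t := step (2 / r * t + 2 / r * (r - c)) * step (- (2 / r) * t + 2 / r * (r + c)).
have k0 : 0 < 2 / r by rewrite divr_gt0.
have E1 t : 2 / r * t + 2 / r * (r - c) = 2 / r * (r + (t - c)) by ring.
have E2 t : - (2 / r) * t + 2 / r * (r + c) = 2 / r * (r - (t - c)) by ring.
have k1 t : (1 <= 2 / r * t) = (r / 2 <= t).
  by rewrite -ler_pdivrMl// mulr1 invf_div.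
have k2 t : (2 / r * t <= 0) = (t <= 0) by rewrite pmulr_rle0.
exists f; split=> [n|t|t|t].
- by apply: diffnM; apply: (diffn_affine (f := step)); exact: diffn_step.
- by rewrite mulr_ge0 ?step_ge0//= mulr_ile1 ?step_ge0 ?step_le1.
- rewrite ler_norml => /andP[h1 h2].
  by rewrite /f E1 E2 !step_ge1 ?mulr1// k1; lra.
- move=> /negP; rewrite ler_norml negb_and -!ltNge => /orP[h|h]; rewrite /f E1 E2.
    by rewrite step_le0 ?mul0r// k2; lra.
  by rewrite [X in _ * X]step_le0 ?mulr0// k2; lra.
Qed.

End SmoothStep.

(** * Weak derivatives *)

Section WeakDerivative.
Context {R : realType}.
Local Notation mu := (@lebesgue_measure R).
Local Notation Int s t f := (\int[mu]_(r in `[s, t]%classic) f r).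
Local Notation intg s t f := (mu.-integrable `[s, t]%classic (EFin \o f)).

Definition loc_integrable (w : R -> R) := measurable_fun (setT : set (measurableTypeR R)) w /\
  forall s t, intg s t w.

Lemma measurable_segment (s t : R) : measurable (`[s, t]%classic : set (measurableTypeR R)).
Proof. exact: measurable_Itv. Qed.

Lemma locint_locally w : loc_integrable w -> locally_integrable setT w.
Proof.
move=> [mw iw]; split=> //; first exact: openT.
move=> K _ cK; have [M [_ hM]] := compact_bounded cK.
have KI : K `<=` `[- (M + 1), M + 1]%classic.
  by move=> x Kx /=; rewrite in_itv /= -ler_norml; apply: hM => //; rewrite ltrDl.
have /integrableP[_] := iw (- (M + 1)) (M + 1); apply: le_lt_trans.
apply: ge0_subset_integral => //=.
- exact: compact_measurable.
- by apply: measurable_funTS; apply/measurable_EFinP; apply: measurableT_comp.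
Qed.

Lemma Rintegral_subset (A B : set (measurableTypeR R)) (f : R -> R) :
  A `<=` B -> (forall r, B r -> ~ A r -> f r = 0) ->
  \int[mu]_(r in B) f r = \int[mu]_(r in A) f r.
Proof.
move=> AB h; rewrite Rintegral_mkcond [RHS]Rintegral_mkcond; congr Rintegral.
apply/funext => r; rewrite !patchE.
case: ifPn => [/set_mem resolv_img|]; case: ifPn => //.
  by rewrite notin_setE => nA; rewrite h.
by move=> /set_mem /AB resolv_img; rewrite notin_setE.
Qed.

Lemma intg_bounded_mul s t (w h : R -> R) M : intg s t w ->
  measurable_fun (`[s, t]%classic : set (measurableTypeR R)) h ->
  (forall r, r \in `[s, t] -> `|h r| <= M) -> intg s t (fun r => w r * h r).
Proof.
move=> iw mh hM.
have mw : measurable_fun (`[s, t]%classic : set (measurableTypeR R)) w.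
  by apply/measurable_EFinP; exact: measurable_int iw.
apply: (@int_le _ `[s, t] _ (fun r => M * `|w r|)).
- exact: measurable_funM.
- move=> r rst; rewrite normrM mulrC ler_wpM2r//; exact: hM.
- apply: (@int_Z _ `[s, t] M (fun r => `|w r|)); exact: integrable_norm.
Qed.

(** With [K = n + 1] the kernel is the derivative of [step (K (r - s))]: it has mass 1 on
    [[s, s + 1 / K]] and is bounded by [K M], so the error is at most [K M] times the integral of
    [|w - w s|] there, which is small at a Lebesgue point. The kernel sits to the right of [s],
    which is why [weak_ftc] asks for room on that side. *)
Lemma delta_limit (w : R -> R) (s : R) (d : R -> R) (M : R) :
  loc_integrable w -> lebesgue_pt w s -> has_deriv step d -> continuous d -> (forall x, `|d x| <= M) ->
  forall e, 0 < e -> exists N, forall n, (N <= n)%N ->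
  `| Int s (s + n.+1%:R^-1) (fun r => w r * (n.+1%:R * d (n.+1%:R * r - n.+1%:R * s))) - w s| < e.
Proof.
move=> [mw iw] lw hd cd dM e e0.
have M0 : 0 <= M by apply: le_trans (dM 0).
have M1 : 0 < 4 * M + 1 by lra.
have /fine_cvgP[fin /cvgrPdist_lt/(_ (e / (4 * M + 1)))] := lw.
rewrite divr_gt0// => /(_ isT) near1.
have [del /= del0 hdel] := filterI fin near1.
have [N hN] := small_inv (ltac:(by rewrite divr_gt0) : 0 < del / 2).
exists N => n Nn; set K := n.+1%:R : R.
have K0 : 0 < K by rewrite ltr0n.
(* With radius [2 / K] the open ball contains the closed segment of length [1 / K]; its measure
   [4 / K] turns the factor [K M] into [4 M]. *)
have {hdel} [dfin dlt] : davg w s (2 / K) \is a fin_num /\ fine (davg w s (2 / K)) < e / (4 * M + 1).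
  have r0 : 0 < 2 / K by rewrite divr_gt0.
  have [] := hdel (2 / K) _ r0.
    rewrite /= sub0r normrN gtr0_norm//; have := hN n Nn.
    by rewrite -/K ltr_pdivlMr// mulrC.
  move=> h1; rewrite sub0r normrN => h2; split=> //; apply: le_lt_trans h2; exact: ler_norm.
pose D := `[s, s + K^-1]%classic : set (measurableTypeR R).
pose dl r := K * d (K * r - K * s).
have dlM r : `|dl r| <= K * M.
  by rewrite normrM (gtr0_norm K0) ler_wpM2l ?(ltW K0).
have cdl : continuous dl.
  have -> : dl = (fun r => K * d (K * r + - (K * s))) by [].
  move=> r; apply: cvgM; first exact: cvg_cst.
  apply: (@continuous_comp _ _ _ (fun r => K * r + - (K * s)) d r); last exact: cd.
  by apply: cvgD; [apply: cvgM; [exact: cvg_cst|exact: cvg_id]|exact: cvg_cst].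
have mdl : measurable_fun D dl by apply: measurable_funTS; exact: continuous_measurable_fun.
have ss : s < s + K^-1 by rewrite ltrDl invr_gt0.
have hdl : has_deriv (fun r => step (K * r + - (K * s))) dl by exact: has_deriv_affine.
have one : Int s (s + K^-1) dl = 1.
  rewrite /Rintegral (@continuous_FTC2 _ dl (fun r => step (K * r + - (K * s))))//.
  - have -> : K * (s + K^-1) + - (K * s) = 1 by field; rewrite gt_eqF.
    have -> : K * s + - (K * s) = 0 by ring.
    by rewrite /= step_ge1// step_le0// subr0.
  - exact: continuous_subspaceT.
  - have c := has_deriv_cts hdl; split.
    + by move=> r _; have [] := hdl r.
    + by apply: cvg_at_right_filter; exact: c.
    + by apply: cvg_at_left_filter; exact: c.
  - by move=> r _; rewrite (has_derivE hdl).
have iwD := iw s (s + K^-1).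
have fD : (mu D < +oo)%E by rewrite /D lebesgue_measure_itv /= lte_fin; case: ifP => _; rewrite ?ltry.
have mD : measurable D by exact: measurable_segment.
have icst c : intg s (s + K^-1) (fun=> c).
  apply: measurable_bounded_integrable => //.
  by exists `|c|; split; [exact: num_real|move=> x hx y _ /=; exact: ltW].
have ic : intg s (s + K^-1) (fun r => w r - w s) by apply: int_B => //; exact: icst.
have dM' : forall r, r \in `[s, s + K^-1] -> `|dl r| <= K * M by move=> r _; exact: dlM.
have id1 := intg_bounded_mul ic mdl dM'.
have id2 := intg_bounded_mul (icst (w s)) mdl dM'.
have idl : intg s (s + K^-1) dl.
  by have := intg_bounded_mul (icst 1) mdl dM'; apply: eq_integrable => // r _ /=; rewrite mul1r.
have -> : Int s (s + K^-1) (fun r => w r * dl r) - w s = Int s (s + K^-1) (fun r => (w r - w s) * dl r).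
  rewrite -[X in _ - X]mulr1 -one -RintegralZl// -RintegralB//; last exact: (intg_bounded_mul iwD mdl dM').
  by apply: eq_Rintegral => r _; rewrite mulrBl.
apply: le_lt_trans (le_normr_Rintegral mD id1) _.
have ian : intg s (s + K^-1) (fun r => `|w r - w s|) by exact: integrable_norm.
apply: (@le_lt_trans _ _ (K * M * Int s (s + K^-1) (fun r => `|w r - w s|))).
  rewrite -RintegralZl//; apply: le_Rintegral => //.
  - exact: integrable_norm id1.
  - by apply: (@int_Z _ `[s, s + K^-1] (K * M) (fun r => `|w r - w s|)).
  - by move=> r _; rewrite normrM mulrC ler_wpM2r// dlM.
have muB : mu (ball s (2 / K)) = (4 / K)%:E.
  by rewrite lebesgue_measure_ball ?divr_ge0// ?ltW//; congr (_%:E); rewrite mulr2n; field; rewrite gt_eqF.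
have dE : (\int[mu]_(y in ball s (2 / K)) `|(center (w s) \o w) y|%:E)%E =
    ((4 / K)%:E * davg w s (2 / K))%E.
  rewrite /davg /iavg muB muleA; rewrite inver gt_eqF ?divr_gt0// -EFinM divff ?mul1e//.
  by rewrite gt_eqF// divr_gt0.
have le1 : (Int s (s + K^-1) (fun r => `|w r - w s|)) <= 4 / K * fine (davg w s (2 / K)).
  rewrite -lee_fin EFinM (fineK dfin) -dE /Rintegral fineK; last exact: (integrable_fin_num mD ian).
  apply: ge0_subset_integral => //=.
  - exact: measurable_ball.
  - apply: measurable_funTS; apply/measurable_EFinP; apply: measurableT_comp => //.
    by apply: measurable_funB => //; exact: measurable_cst.
  - move=> r; rewrite /D /= in_itv /= => /andP[sr rs]; rewrite /ball /= ltr_norml.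
    have : K^-1 < 2 / K by rewrite ltr_pdivlMr// mulVf ?gt_eqF// ltr1n.
    by have := K0; rewrite -invr_gt0; move: (K^-1) (2 / K) rs => p q; lra.
have h1 : K * M * Int s (s + K^-1) (fun r => `|w r - w s|) <= K * M * (4 / K * fine (davg w s (2 / K))).
  by rewrite ler_wpM2l// mulr_ge0// ltW.
apply: le_lt_trans h1 _.
have -> : K * M * (4 / K * fine (davg w s (2 / K))) = 4 * M * fine (davg w s (2 / K)).
  by field; rewrite gt_eqF.
have f0 : 0 <= fine (davg w s (2 / K)) by rewrite fine_ge0// davg_ge0.
move: dlt; rewrite ltr_pdivlMr//; move: (fine _) f0 => q; nra.
Qed.

End WeakDerivative.

(** * From a weak derivative to increments between Lebesgue points *)

Section WeakFTC.
Context {R : realType}.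
Local Notation mu := (@lebesgue_measure R).
Local Notation Int s t f := (\int[mu]_(r in `[s, t]%classic) f r).
Local Notation intg s t f := (mu.-integrable `[s, t]%classic (EFin \o f)).

Lemma Rintegral_dominated_cvg (D : set (measurableTypeR R)) (f_ : nat -> R -> R) (f g : R -> R) :
  measurable D -> (forall n, measurable_fun D (f_ n)) ->
  (forall x, D x -> f_ n x @[n --> \oo] --> f x) ->
  mu.-integrable D (EFin \o g) -> (forall n x, D x -> `|f_ n x| <= g x) ->
  mu.-integrable D (EFin \o f) /\
  \int[mu]_(x in D) f_ n x @[n --> \oo] --> \int[mu]_(x in D) f x.
Proof.
move=> mD mf ff ig fg.
have mf' n : measurable_fun D (EFin \o f_ n) by exact/measurable_EFinP.
have ff' x : D x -> (fun n => (EFin \o f_ n) x) @ \oo --> (EFin \o f) x.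
  by move=> Dx; apply: cvg_EFin; [exact: nearW|exact: ff].
have fin x : D x -> (EFin \o g) x \is a fin_num by [].
have fg' n x : D x -> (`|(EFin \o f_ n) x| <= (EFin \o g) x)%E.
  by move=> Dx; rewrite /= lee_fin; exact: fg.
have if' : mu.-integrable D (EFin \o f) := lebesgue_integral_dominated_convergence.dominated_integrable mD _ _ _ mf' ff' ig fg'.
split=> //.
have := dominated_cvg mD mf' ff' fin ig fg'.
rewrite -[X in _ --> X]fineK; last exact: integrable_fin_num.
by move=> /fine_cvgP[_].
Qed.

Lemma cvgn_eps (u : nat -> R) l : u n @[n --> \oo] --> l ->
  forall e, 0 < e -> exists N, forall n, (N <= n)%N -> `|u n - l| < e.
Proof.
move=> /cvgrPdist_lt h e /h[N _ hN]; exists N => n Nn.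
by rewrite distrC; exact: hN.
Qed.

Lemma eps_eq (x y : R) : (forall e, 0 < e -> `|x - y| <= e) -> x = y.
Proof.
move=> h; apply/eqP; rewrite -subr_eq0 -normr_le0; apply/ler_addgt0Pr => e /h.
by rewrite add0r.
Qed.

Lemma near_cst_cvg (u : nat -> R) l N : (forall n, (N <= n)%N -> u n = l) -> u n @[n --> \oo] --> l.
Proof.
move=> h; apply: cvg_near_cst; exists N => // n Nn /=; exact/eqP/h.
Qed.

(** Test with the difference of two steps, one starting at [s] and one at [t]: its derivative tends
    to the difference of the point masses at [s] and [t], and it tends itself to the indicator of
    []s, t]]. Each transition has length [1 / K], hence the margin [eta] beyond [t]. The weak
    derivative of [w] is [- k], which explains the order of [w s] and [w t]. *)
Lemma weak_ftc (I : interval R) (w k : R -> R) (s t eta : R) : loc_integrable w -> loc_integrable k ->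
  (forall phi phi' p q, (forall n, diffn n phi) -> has_deriv phi phi' ->
     (forall r, ~ (p <= r <= q) -> phi r = 0) -> (forall r, p <= r <= q -> r \in I) ->
     Int p q (fun r => w r * phi' r) = Int p q (fun r => k r * phi r)) ->
  s < t -> 0 < eta -> (forall r, s <= r <= t + eta -> r \in I) ->
  lebesgue_pt w s -> lebesgue_pt w t -> w s - w t = Int s t k.
Proof.
move=> lw lk hweak st eta0 hI lws lwt.
have [d [M [hd cd dM M0 d0]]] := @step_deriv R.
pose K n : R := n.+1%:R.
have K0 n : 0 < K n by rewrite ltr0n.
pose phi n r := step (K n * r + - (K n * s)) + -1 * step (K n * r + - (K n * t)).
pose dl c n r := K n * d (K n * r + - (K n * c)).
have hdl c n : has_deriv (fun r => step (K n * r + - (K n * c))) (dl c n) by exact: has_deriv_affine.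
have cdl c n : continuous (dl c n).
  move=> r; apply: cvgM; first exact: cvg_cst.
  apply: (@continuous_comp _ _ _ (fun r => K n * r + - (K n * c)) d r); last exact: cd.
  by apply: cvgD; [apply: cvgM; [exact: cvg_cst|exact: cvg_id]|exact: cvg_cst].
have mdl c n (D : set (measurableTypeR R)) : measurable_fun D (dl c n).
  by apply: measurable_funTS; exact: continuous_measurable_fun.
have dlM c n r : `|dl c n r| <= K n * M.
  by rewrite normrM (gtr0_norm (K0 n)) ler_wpM2l ?(ltW (K0 n)).
have argE c n r : K n * r + - (K n * c) = K n * (r - c) by ring.
have dl0 c n r : ~ (c < r < c + (K n)^-1) -> dl c n r = 0.
  move=> h; rewrite /dl d0 ?mulr0// argE => /andP[h1 h2]; apply: h.
  move: h1; rewrite pmulr_rgt0// subr_gt0 => -> /=.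
  by rewrite -ltrBlDl -[X in _ < X]mulr1 ltr_pdivlMl.
set q := t + eta.
have dq : phi 0%N = phi 0%N by [].
have hphi n : has_deriv (phi n) (fun r => dl s n r + (0 * step (K n * r + - (K n * t)) + -1 * dl t n r)).
  apply: has_derivD; first exact: hdl.
  by apply: has_derivM; [exact: has_deriv_cst|exact: hdl].
have sphi n m : diffn m (phi n).
  apply: diffnD; first by apply: (diffn_affine (f := step)); exact: diffn_step.
  apply: diffnM; first exact: diffn_cst.
  by apply: (diffn_affine (f := step)); exact: diffn_step.
have step0 c n r : r <= c -> step (K n * r + - (K n * c)) = 0.
  by move=> rc; rewrite argE step_le0// pmulr_rle0// subr_le0.
have step1 c n r : c + (K n)^-1 <= r -> step (K n * r + - (K n * c)) = 1.
  by move=> rc; rewrite argE step_ge1// -ler_pdivrMl// mulr1 lerBrDl.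
have phi0 n r : (K n)^-1 <= eta -> ~ (s <= r <= q) -> phi n r = 0.
  move=> Ke /negP; rewrite negb_and -!ltNge => /orP[rs|qr]; rewrite /phi.
    by rewrite !step0 ?mulr0 ?addr0//; lra.
  move: Ke qr; rewrite /q; move E : ((K n)^-1) => z Ke qr.
  by rewrite !step1 ?mulr1 ?subrr// E; lra.
have lim c : c = s \/ c = t -> lebesgue_pt w c -> forall e, 0 < e -> exists N, forall n, (N <= n)%N ->
    `|Int s q (fun r => w r * dl c n r) - w c| < e.
  move=> cst lwc e e0.
  have [N1 hN1] := delta_limit lw lwc hd cd dM e0.
  have [N2 hN2] := small_inv eta0.
  exists (maxn N1 N2) => n; rewrite geq_max => /andP[/hN1 h1 /hN2 h2].
  rewrite (@Rintegral_subset _ `[c, c + n.+1%:R^-1]%classic); first exact: h1.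
    move=> r /=; rewrite !in_itv /= /q => /andP[h3 h4].
    move: h2 h3 h4; move: (n.+1%:R^-1) => z.
    by case: cst => -> h2 h3 h4; apply/andP; split; lra.
  move=> r _ /= nr; have := @dl0 c n r; rewrite /dl => ->; rewrite ?mulr0// => /andP[h3 h4].
  by apply: nr; rewrite in_itv /= !ltW.
have mk (D : set (measurableTypeR R)) : measurable_fun D k by apply: measurable_funTS; case: lk.
have mphi n (D : set (measurableTypeR R)) : measurable_fun D (phi n).
  by apply: measurable_funTS; apply: continuous_measurable_fun; exact: has_deriv_cts (hphi n).
(* [step] vanishes at the start of its transition, so the pointwise limit is 0 at [s] and 1 at
   [t]. *)
have [_ climk] : intg s q (fun r => k r * (r \in `]s, t])%:R) /\
    Int s q (fun r => k r * phi n r) @[n --> \oo] --> Int s q (fun r => k r * (r \in `]s, t])%:R).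
  apply: (@Rintegral_dominated_cvg _ _ _ (fun r => 2 * `|k r|)).
  - exact: measurable_segment.
  - by move=> n; apply: measurable_funM.
  - move=> r _; apply: cvgM; first exact: cvg_cst.
    have [rs|sr] := leP r s.
      apply: (@near_cst_cvg _ _ 0%N) => n _; rewrite /phi !step0 ?mulr0 ?addr0//; last by lra.
      by rewrite in_itv /= ltNge rs.
    have [rt|tr] := leP r t.
      have [N hN] := small_inv (ltac:(by rewrite subr_gt0) : 0 < r - s).
      apply: (@near_cst_cvg _ _ N) => n /hN hn; rewrite /phi (step0 t)// step1 ?mulr0 ?addr0.
        by rewrite in_itv /= sr rt.
      by move: hn; rewrite /K; move: (n.+1%:R^-1) => z; lra.
    have [N hN] := small_inv (ltac:(by rewrite subr_gt0) : 0 < r - t).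
    apply: (@near_cst_cvg _ _ N) => n /hN hn.
    have e1 : t + (K n)^-1 <= r by move: hn; rewrite /K; move: (n.+1%:R^-1) => z; lra.
    have e2 : s + (K n)^-1 <= r by move: hn; rewrite /K; move: (n.+1%:R^-1) => z; lra.
    rewrite /phi (step1 _ _ _ e1) (step1 _ _ _ e2) mulr1 subrr.
    by rewrite in_itv /= sr leNgt tr.
  - have ik : intg s q k by case: lk.
    exact: (@int_Z R `[s, q] 2 (fun r => `|k r|) (integrable_norm ik)).
  - move=> n r _; rewrite normrM mulrC ler_wpM2r//.
    apply: le_trans (ler_normD _ _) _; rewrite mulN1r normrN.
    rewrite !ger0_norm ?step_ge0//.
    have h1 := step_le1 (K n * r + - (K n * s)); have h2 := step_le1 (K n * r + - (K n * t)); lra.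
have limE : Int s q (fun r => k r * (r \in `]s, t])%:R) = Int s t k.
  rewrite (@Rintegral_subset _ `]s, t]%classic); last 2 first.
  - move=> r /=; rewrite !in_itv /= /q => /andP[h1 h2]; apply/andP; split; lra.
  - by move=> r _ /= /negP/negbTE ->; rewrite mulr0.
  have ist : mu.-integrable `]s, t]%classic (EFin \o k).
    apply: (integrableS (measurable_segment s t) (measurable_Itv _)); last by case: lk.
    by move=> r /=; rewrite !in_itv /= => /andP[/ltW -> ->].
  rewrite -(Rintegral_itv_obnd_cbnd ist); apply: eq_Rintegral => r.
  by rewrite inE /= => ->; rewrite mulr1.
rewrite limE in climk.
apply: eps_eq => e e0.
have e3 : 0 < e / 3 by rewrite divr_gt0.
have [N1 h1] := lim s (or_introl erefl) lws _ e3.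
have [N2 h2] := lim t (or_intror erefl) lwt _ e3.
have [N3 h3] := cvgn_eps climk e3.
have [N4 h4] := small_inv eta0.
pose n := maxn (maxn N1 N2) (maxn N3 N4).
have {}h1 := h1 n ltac:(by rewrite !leq_max leqnn); have {}h2 := h2 n ltac:(by rewrite !leq_max leqnn orbT).
have {}h3 := h3 n ltac:(by rewrite !leq_max leqnn !orbT); have {}h4 := h4 n ltac:(by rewrite !leq_max leqnn !orbT).
have E := hweak (phi n) _ s q (sphi n) (hphi n) (fun r => @phi0 n r (ltW h4)) hI.
have iw c : intg s q (fun r => w r * dl c n r).
  have [_ /(_ s q) iwq] := lw.
  exact: (intg_bounded_mul iwq (mdl c n _) (fun r _ => dlM c n r)).
have E' : Int s q (fun r => w r * dl s n r) - Int s q (fun r => w r * dl t n r) =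
    Int s q (fun r => k r * phi n r).
  rewrite -E -(RintegralB (measurable_segment s q) (iw s) (iw t)).
  by apply: eq_Rintegral => r _; rewrite mul0r add0r mulN1r -mulrBr.
rewrite -E' in h3.
move: h1 h2 h3; move: (Int s q (fun r => w r * dl s n r)) (Int s q (fun r => w r * dl t n r)) => x y.
rewrite !ltr_norml ler_norml; move: (Int s t k) (w s) (w t) e0; clear => ? ? ?; lra.
Qed.

End WeakFTC.

(** * Primitives and the energy identity *)

Section Primitives.
Context {R : realType} {H : completeNormedModType R[i]}.
Variable ip : {dot H for Num.conj}.
Hypothesis norm_ip : forall x : H, `|x| ^+ 2 = ip x x.
Hypothesis sep : exists D : set H, countable D /\ dense D.
Local Notation rip := (re_ip ip).
Local Notation mu := (@lebesgue_measure R).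
Local Notation Int s t f := (\int[mu]_(r in `[s, t]%classic) f r).
Local Notation intg s t f := (mu.-integrable `[s, t]%classic (EFin \o f)).
Local Notation T := (`]-oo, +oo[ : interval R).
Local Notation sm := (@strongly_measurable R H T).
Implicit Types s t : R.

Definition loc_sq (f : R -> H) := sm f /\ forall s t, intg s t (fun r => rnorm (f r) ^+ 2).

Lemma setTE : [set` T] = setT :> set R.
Proof. by rewrite set_itvNyy. Qed.

Lemma intg_le s t (f g : R -> R) : measurable_fun (setT : set (measurableTypeR R)) f ->
  (forall r, `|f r| <= g r) -> intg s t g -> intg s t f.
Proof.
move=> mf fg ig; apply: (@int_le R `[s, t] f g) => //.
exact: measurable_funTS.
Qed.

Lemma sm_rnormT f : sm f -> measurable_fun (setT : set (measurableTypeR R)) (fun r => rnorm (f r)).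
Proof. by move=> /sm_rnorm; rewrite setTE. Qed.

Lemma sm_ripT f g : sm f -> sm g ->
  measurable_fun (setT : set (measurableTypeR R)) (fun r => rip (f r) (g r)).
Proof. by move=> mf mg; have := measurable_rip norm_ip mf mg; rewrite setTE. Qed.

Lemma locint_rip f g : loc_sq f -> loc_sq g -> loc_integrable (fun r => rip (f r) (g r)).
Proof.
move=> [mf hf] [mg hg]; split; first exact: sm_ripT.
move=> s t; apply: (@intg_le _ _ _ (fun r => rnorm (f r) ^+ 2 + rnorm (g r) ^+ 2)).
- exact: sm_ripT.
- move=> r; apply: le_trans (rip_CS norm_ip _ _) _.
  have := sqr_ge0 (rnorm (f r) - rnorm (g r)); rewrite sqrrB.
  have := sqr_ge0 (rnorm (f r)); have := sqr_ge0 (rnorm (g r)); lra.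
- exact: (int_D (I := `[s, t])).
Qed.

Lemma intg_cst s t c : intg s t (fun=> c).
Proof.
have fD : (mu `[s, t]%classic < +oo)%E.
  by rewrite lebesgue_measure_itv /= lte_fin; case: ifP => _; rewrite ?ltry.
apply: measurable_bounded_integrable => //.
by exists `|c|; split; [exact: num_real|move=> x hx y _ /=; exact: ltW].
Qed.

Lemma Int_cst s t c : s <= t -> Int s t (fun=> c) = c * (t - s).
Proof.
move=> st; transitivity (c * fine (mu `[s, t]%classic)).
  exact: (Rintegral_cst mu (measurable_segment s t) c).
rewrite lebesgue_measure_itv /= lte_fin.
by have [->|ts] := eqVneq s t; [rewrite ltxx subrr|rewrite lt_neqAle ts st].
Qed.

Lemma locint_norm f : loc_sq f -> loc_integrable (fun r => rnorm (f r)).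
Proof.
move=> [mf hf]; split; first exact: sm_rnormT.
move=> s t; apply: (@intg_le _ _ _ (fun r => rnorm (f r) ^+ 2 + 1)).
- exact: sm_rnormT.
- move=> r; rewrite ger0_norm ?rnorm_ge0//.
  have := sqr_ge0 (rnorm (f r) - 1); rewrite sqrrB.
  have := sqr_ge0 (rnorm (f r)); lra.
- by apply: (int_D (I := `[s, t])); [exact: hf|exact: intg_cst].
Qed.

Lemma sql_cst c : loc_sq (fun=> c).
Proof. by split; [exact: sm_cst|move=> s t; exact: intg_cst]. Qed.

Lemma sql_cts (f : R -> H) :
  (forall t e, 0 < e -> exists2 r, 0 < r & forall s, `|t - s| < r -> rnorm (f t - f s) < e) ->
  loc_sq f.
Proof.
move=> cf; split; first exact: sm_continuous.
move=> s t; apply: (@continuous_compact_integrable R (fun r => rnorm (f r) ^+ 2)).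
  exact: segment_compact.
apply: continuous_subspaceT => x; apply: exprn_continuous_subproof || apply: (@continuous_comp _ _ _ (fun r => rnorm (f r)) (fun y => y ^+ 2)).
  apply/cvgrPdist_lt => e e0; have [r r0 hr] := cf x e e0.
  near=> y; apply: le_lt_trans (rnorm_dist _ _) _; apply: hr; near: y.
  by exists r.
exact: exprn_continuous.
Unshelve. all: by end_near. Qed.

Lemma Int_cat s t r (f : R -> R) : loc_integrable f -> s <= t -> t <= r ->
  Int s r f = Int s t f + Int t r f.
Proof.
move=> [_ lf] st tr; apply/eqP; rewrite addrC -subr_eq; apply/eqP.
rewrite Rintegral_itvB//; try by rewrite bnd_simp.
apply: Rintegral_itv_obnd_cbnd; apply: (integrableS (measurable_segment t r) (measurable_Itv _)); last exact: lf.
by move=> x /=; rewrite !in_itv /= => /andP[/ltW -> ->].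
Qed.

Lemma Int_pt s (f : R -> R) : Int s s f = 0.
Proof. by rewrite set_itv1 Rintegral_set1. Qed.

Lemma Int_ge0 s t (f : R -> R) : (forall r, 0 <= f r) -> 0 <= Int s t f.
Proof. by move=> f0; apply: Rintegral_ge0 => r _; exact: f0. Qed.

Lemma Int_le s t (f g : R -> R) : loc_integrable f -> loc_integrable g ->
  (forall r, s <= r <= t -> f r <= g r) -> Int s t f <= Int s t g.
Proof.
move=> [_ lf] [_ lg] fg; by apply: le_Rintegral => // r; rewrite /= in_itv /=; exact: fg.
Qed.

Lemma Int_norm s t (f : R -> R) : loc_integrable f -> `|Int s t f| <= Int s t (fun r => `|f r|).
Proof. by move=> [_ lf]; apply: le_normr_Rintegral => //. Qed.

Lemma locint_abs (f : R -> R) : loc_integrable f -> loc_integrable (fun r => `|f r|).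
Proof.
move=> [mf lf]; split; first exact: measurableT_comp.
by move=> s t; exact: integrable_norm.
Qed.

Lemma locintZ c (f : R -> R) : loc_integrable f -> loc_integrable (fun r => c * f r).
Proof.
move=> [mf lf]; split; first by apply: measurable_funM => //; exact: measurable_cst.
by move=> s t; exact: (int_Z (I := `[s, t])).
Qed.

Lemma locintD (f g : R -> R) : loc_integrable f -> loc_integrable g -> loc_integrable (fun r => f r + g r).
Proof.
move=> [mf lf] [mg lg]; split; first exact: measurable_funD.
by move=> s t; exact: (int_D (I := `[s, t])).
Qed.

Lemma locintB (f g : R -> R) : loc_integrable f -> loc_integrable g -> loc_integrable (fun r => f r - g r).
Proof.
move=> [mf lf] [mg lg]; split; first exact: measurable_funB.
by move=> s t; exact: (int_B (I := `[s, t])).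
Qed.

Lemma IntZ s t c (f : R -> R) : loc_integrable f -> Int s t (fun r => c * f r) = c * Int s t f.
Proof. by move=> [_ lf]; rewrite RintegralZl//. Qed.

Lemma IntD s t (f g : R -> R) : loc_integrable f -> loc_integrable g ->
  Int s t (fun r => f r + g r) = Int s t f + Int s t g.
Proof. by move=> [_ lf] [_ lg]; rewrite RintegralD//. Qed.

Lemma IntB s t (f g : R -> R) : loc_integrable f -> loc_integrable g ->
  Int s t (fun r => f r - g r) = Int s t f - Int s t g.
Proof. by move=> [_ lf] [_ lg]; rewrite RintegralB//. Qed.

Lemma locint_sq f : loc_sq f -> loc_integrable (fun r => rnorm (f r) ^+ 2).
Proof.
by move=> [mf lf]; split=> //; apply: measurable_funX; exact: sm_rnormT.
Qed.

(** Integrating [(|f| + y)^2 >= 0] over the segment gives the quadratic in [y] for [quad_disc]. *)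
Lemma Int_CS s t f : loc_sq f -> s <= t ->
  Int s t (fun r => rnorm (f r)) ^+ 2 <= (t - s) * Int s t (fun r => rnorm (f r) ^+ 2).
Proof.
move=> hf st; rewrite mulrC; have h1 := locint_norm hf; have h2 := locint_sq hf.
apply: quad_disc => [||y].
- by apply: Int_ge0 => r; exact: sqr_ge0.
- by rewrite subr_ge0.
have lc c : loc_integrable (fun=> c : R) by split; [exact: measurable_cst|move=> *; exact: intg_cst].
have -> : Int s t (fun r => rnorm (f r) ^+ 2) + 2 * y * Int s t (fun r => rnorm (f r)) +
    y ^+ 2 * (t - s) = Int s t (fun r => (rnorm (f r) ^+ 2 + (2 * y) * rnorm (f r)) + y ^+ 2).
  rewrite IntD//; last by apply: locintD => //; exact: locintZ.
  by rewrite IntD//; [rewrite IntZ// Int_cst|exact: locintZ].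
apply: Int_ge0 => r; have := sqr_ge0 (rnorm (f r) + y); rewrite sqrrD mulr2n; lra.
Qed.

(** A primitive in the weak sense: its increments are integrals of [k] only through scalar
    products. *)
Definition prim (W k : R -> H) := forall s t x, s <= t ->
  rip (W t - W s) x = Int s t (fun r => rip (k r) x).

(** Test the primitive against its own increment [v] and divide by the norm of [v]. *)
Lemma prim_bound W k s t : loc_sq k -> prim W k -> s <= t ->
  rnorm (W t - W s) <= Int s t (fun r => rnorm (k r)).
Proof.
move=> hk pW st; set v := W t - W s.
have [->|v0] := eqVneq (rnorm v) 0; first by apply: Int_ge0 => r; exact: rnorm_ge0.
have vp : 0 < rnorm v by rewrite lt_neqAle eq_sym v0 rnorm_ge0.
rewrite -(ler_pM2l vp) -expr2 -(rip_norm norm_ip) {1}/v pW// -IntZ; last exact: locint_norm.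
apply: Int_le; [exact: (locint_rip hk (sql_cst v))|by apply: locintZ; exact: locint_norm|].
by move=> r _; rewrite mulrC; exact: rip_le.
Qed.

(** By [Int_CS] increments are at most the square root of length times [M], where [M] is the mass of
    [|k|^2] on the window of radius 1; hence the minimum with 1. *)
Lemma prim_cts W k : loc_sq k -> prim W k -> forall t e, 0 < e ->
  exists2 r, 0 < r & forall s, `|t - s| < r -> rnorm (W t - W s) < e.
Proof.
move=> hk pW t e e0.
set M := Int (t - 1) (t + 1) (fun r => rnorm (k r) ^+ 2).
have M0 : 0 <= M by apply: Int_ge0 => r; exact: sqr_ge0.
have hM s s' : t - 1 <= s -> s <= s' -> s' <= t + 1 -> rnorm (W s' - W s) ^+ 2 <= (s' - s) * M.
  move=> h1 h2 h3.
  apply: (@le_trans _ _ (Int s s' (fun r => rnorm (k r)) ^+ 2)).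
    by rewrite lerXn2r ?nnegrE ?rnorm_ge0//; [apply: Int_ge0 => r; exact: rnorm_ge0|exact: prim_bound].
  apply: le_trans (Int_CS hk h2) _; rewrite ler_wpM2l ?subr_ge0//.
  have h0 u v : 0 <= Int u v (fun r => rnorm (k r) ^+ 2) by apply: Int_ge0 => r; exact: sqr_ge0.
  have lk := locint_sq hk.
  rewrite /M (Int_cat lk h1 (le_trans h2 h3)) (Int_cat lk h2 h3).
  have := h0 (t - 1) s; have := h0 s' (t + 1); lra.
exists (Num.min 1 (e ^+ 2 / (M + 1))).
  by rewrite lt_min ltr01 divr_gt0 ?exprn_gt0//; lra.
move=> s; rewrite lt_min => /andP[h1 h2].
rewrite -(@ltr_pXn2r _ 2)// ?nnegrE ?rnorm_ge0 ?(ltW e0)//.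
have Mp : 0 < M + 1 by lra.
apply: (@le_lt_trans _ _ (`|t - s| * M)).
  move: h1; rewrite ltr_norml; have [st|ts] := leP s t => /andP[h3 h4].
    by rewrite ger0_norm ?subr_ge0//; apply: hM => //; lra.
  rewrite rnormBC ltr0_norm ?subr_lt0// opprB; apply: hM; lra.
move: h2; rewrite ltr_pdivlMr//; have := normr_ge0 (t - s); move: `|t - s| => z; nra.
Qed.

Lemma prim_sql W k : loc_sq k -> prim W k -> loc_sq W.
Proof. by move=> hk pW; apply: sql_cts; exact: prim_cts hk pW. Qed.

(** [W] need not be differentiable everywhere, so the product rule is replaced by subdivision. The
    defect [G] is additive over adjacent intervals and bounded on each by twice the length times the
    mass [M] of [|k|^2]; equal pieces of length [h] add up to at most [2 h M], which tends to 0. *)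
Lemma energy W k s t : loc_sq k -> prim W k -> s <= t ->
  rnorm (W t) ^+ 2 - rnorm (W s) ^+ 2 = 2 * Int s t (fun r => rip (k r) (W r)).
Proof.
move=> hk pW st; have hW := prim_sql hk pW.
have lkW := locint_rip hk hW; have lk := locint_norm hk; have lk2 := locint_sq hk.
pose G u v := rnorm (W v) ^+ 2 - rnorm (W u) ^+ 2 - 2 * Int u v (fun r => rip (k r) (W r)).
pose M u v := Int u v (fun r => rnorm (k r) ^+ 2).
have M0 u v : 0 <= M u v by apply: Int_ge0 => r; exact: sqr_ge0.
have Gb u v : u <= v -> `|G u v| <= 2 * (v - u) * M u v.
  move=> uv; pose c := Int u v (fun r => rnorm (k r)).
  have lx x : loc_integrable (fun r => rip (k r) x) by exact: (locint_rip hk (sql_cst x)).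
  (* [|W v|^2 - |W u|^2] is the product of [W v - W u] with [W v + W u], so the defect is one
     integral against [k]. *)
  have -> : G u v = Int u v (fun r => rip (k r) (W v + W u) - 2 * rip (k r) (W r)).
    rewrite IntB//; last exact: locintZ.
    rewrite IntZ// /G -(pW _ _ _ uv); congr (_ - _).
    by rewrite -!(rip_norm norm_ip) ripBl !ripDr (ripC ip (W u) (W v)); ring.
  have lg : loc_integrable (fun r => rip (k r) (W v + W u) - 2 * rip (k r) (W r)).
    by apply: locintB => //; exact: locintZ.
  apply: le_trans (Int_norm _ _ lg) _.
  apply: (@le_trans _ _ (Int u v (fun r => (2 * c) * rnorm (k r)))).
    apply: Int_le; [exact: locint_abs|exact: locintZ|move=> r /andP[ur rv]].
    have -> : rip (k r) (W v + W u) - 2 * rip (k r) (W r) =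
        rip (k r) (W v - W r) - rip (k r) (W r - W u).
      by rewrite !(ripDr, ripNr); ring.
    have k0 x y : 0 <= Int x y (fun r => rnorm (k r)) by apply: Int_ge0 => ?; exact: rnorm_ge0.
    have cE : c = Int u r (fun r => rnorm (k r)) + Int r v (fun r => rnorm (k r)).
      exact: Int_cat.
    have b1 := prim_bound hk pW rv; have b2 := prim_bound hk pW ur.
    apply: le_trans (ler_normB _ _) _.
    have c1 := rip_CS norm_ip (k r) (W v - W r).
    have c2 := rip_CS norm_ip (k r) (W r - W u).
    have r0 := rnorm_ge0 (k r).
    have d1 : rnorm (k r) * rnorm (W v - W r) <= rnorm (k r) * c.
      by rewrite ler_wpM2l// cE; have := k0 u r; lra.
    have d2 : rnorm (k r) * rnorm (W r - W u) <= rnorm (k r) * c.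
      by rewrite ler_wpM2l// cE; have := k0 r v; lra.
    by move: c1 c2 d1 d2; clear; lra.
  have := Int_CS hk uv; rewrite IntZ// -/c -/(M u v); clear.
  move: c (M u v) => y z; rewrite expr2 -!mulrA; lra.
have Gcat u v w : u <= v -> v <= w -> G u w = G u v + G v w.
  by move=> uv vw; rewrite /G (Int_cat lkW uv vw); ring.
have Mcat u v w : u <= v -> v <= w -> M u w = M u v + M v w.
  by move=> uv vw; exact: Int_cat.
have part h n : 0 <= h -> `|G s (s + n%:R * h)| <= 2 * h * M s (s + n%:R * h).
  move=> h0; elim: n => [|n IH].
    by rewrite mul0r addr0 /G subrr Int_pt mulr0 subr0 normr0 mulr_ge0// mulr_ge0.
  have p1 : s <= s + n%:R * h by rewrite lerDl mulr_ge0.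
  have E : s + n.+1%:R * h = s + n%:R * h + h by rewrite -natr1; ring.
  have p2 : s + n%:R * h <= s + n.+1%:R * h by rewrite E lerDl.
  rewrite (Gcat _ _ _ p1 p2) (Mcat _ _ _ p1 p2) mulrDr.
  apply: le_trans (ler_normD _ _) _; apply: lerD => //.
  apply: le_trans (Gb _ _ p2) _; rewrite le_eqVlt; apply/orP; left; apply/eqP; congr (_ * _ * _).
  by rewrite E; ring.
suff G0 : G s t = 0 by apply/eqP; rewrite -subr_eq0; apply/eqP.
apply: eps_eq => e e0; rewrite subr0.
have K0 : 0 < 2 * (t - s) * M s t + 1 by rewrite ltr_wpDl// !mulr_ge0// subr_ge0.
have [N hN] := small_inv (ltac:(by rewrite divr_gt0) : 0 < e / (2 * (t - s) * M s t + 1)).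
have {}hN := hN N (leqnn N).
have h0 : 0 <= (t - s) / N.+1%:R by rewrite divr_ge0// subr_ge0.
have := part ((t - s) / N.+1%:R) N.+1 h0.
rewrite [N.+1%:R * _]mulrC divfK ?pnatr_eq0// addrC subrK => h; apply: le_trans h _.
have z0 : 0 <= N.+1%:R^-1 :> R by rewrite invr_ge0.
move: hN; rewrite ltr_pdivlMr// mulrDr mulr1; move: (N.+1%:R^-1) z0 => z z0.
have -> : 2 * ((t - s) * z) * M s t = z * (2 * (t - s) * M s t) by ring.
by move: (z * _) => y; lra.
Qed.

End Primitives.

(** * Existence of weak primitives *)

Section Pettis.
Context {R : realType} {H : completeNormedModType R[i]}.
Variable ip : {dot H for Num.conj}.
Hypothesis norm_ip : forall x : H, `|x| ^+ 2 = ip x x.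
Hypothesis sep : exists D : set H, countable D /\ dense D.
Local Notation rip := (re_ip ip).
Local Notation mu := (@lebesgue_measure R).
Local Notation Int s t f := (\int[mu]_(r in `[s, t]%classic) f r).
Local Notation T := (`]-oo, +oo[ : interval R).
Local Notation sm := (@strongly_measurable R H T).
Local Notation sq := (@square_integrable R H T).
Implicit Types s t : R.

(** For fixed end points the integral of [rip (k r) x] is a bounded functional of [x], and Riesz
    representation gives the increment; it is taken with a minus sign to the left of [s0]. *)
Lemma pettis (k : R -> H) s0 w0 : loc_sq k -> exists W, W s0 = w0 /\ prim ip W k.
Proof.
move=> hk.
have lk x : loc_integrable (fun r => rip (k r) x) by exact: (locint_rip norm_ip hk (sql_cst x)).
have ex s t : exists z, forall x, rip z x = Int s t (fun r => rip (k r) x).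
  apply: (riesz norm_ip (C := Int s t (fun r => rnorm (k r)))).
    move=> c x y; rewrite -IntZ// -IntD//; last exact: locintZ.
    by apply: eq_Rintegral => r _; rewrite ripDr ripZr.
  move=> x; apply: le_trans (Int_norm _ _ (lk x)) _.
  rewrite mulrC -IntZ; last exact: locint_norm hk.
  apply: Int_le; [exact: locint_abs|by apply: locintZ; exact: locint_norm hk|].
  by move=> r _; rewrite mulrC; exact: rip_CS.
pose z s t := sval (cid (ex s t)).
have zE s t x : rip (z s t) x = Int s t (fun r => rip (k r) x).
  by rewrite /z; case: cid => ? /=.
exists (fun t => w0 + (if s0 <= t then z s0 t else - z t s0)); split.
  rewrite lexx -[RHS]addr0; congr (_ + _); apply: (rip_ext norm_ip) => x.
  by rewrite zE Int_pt rip0l.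
move=> s t x st; rewrite opprD addrACA subrr add0r.
have [h1|h1] := leP s0 s.
  rewrite (le_trans h1 st) ripBl !zE (Int_cat (lk x) h1 st); ring.
rewrite opprK; have [h2|h2] := leP s0 t.
  rewrite ripDl !zE (Int_cat (lk x) (ltW h1) h2); ring.
rewrite ripDl ripNl !zE (Int_cat (lk x) st (ltW h2)); ring.
Qed.

Lemma ae_pt (P : R -> Prop) p q : p < q -> {ae mu, forall t, P t} ->
  exists2 t, p <= t <= q & P t.
Proof.
move=> pq [N [mN N0 hN]]; apply/not_exists2P => h.
have : (mu `[p, q]%classic <= mu N)%E.
  apply: le_measure; rewrite ?inE//.
  by move=> t /=; rewrite in_itv /= => pt; apply: hN => /= Pt; case: (h t).
rewrite N0; have -> : (mu `[p, q]%classic = (q - p)%:E).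
  by rewrite lebesgue_measure_itv /= lte_fin pq -EFinD.
by rewrite lee_fin subr_le0 leNgt pq.
Qed.

Variable I : interval R.

(** Extension by zero, so that the tools for functions on the line apply to functions on [I]. *)
Definition zero_ext (f : R -> H) (t : R) : H := if t \in I then f t else 0.
Local Notation off := zero_ext.

Lemma off_sq f : @square_integrable R H I f -> sq (off f).
Proof.
move=> hf; have mf := sq_sm hf; apply: int_sq.
  apply: (sm_dist sep) => d; rewrite setTE.
  have -> : (fun t => rnorm (off f t - d)) =
      (fun t => ((fun t => rnorm (f t - d) - rnorm d) \_ [set` I]) t + rnorm d).
    apply/funext => t; rewrite patchE /zero_ext mem_setE; case: ifP => _.
      by rewrite subrK.
    by rewrite sub0r rnormN add0r.
  apply: measurable_funD; last exact: measurable_cst.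
  have m : measurable_fun ([set` I] : set (measurableTypeR R)) (fun t => rnorm (f t - d) - rnorm d).
    apply: measurable_funB; last exact: measurable_cst.
    by apply: sm_rnorm; apply: smB => //; exact: sm_cst.
  exact: (measurable_restrictT _ (measurable_Itv I)).1 m.
rewrite setTE; have := (integrable_mkcond _ (measurable_Itv I)).1 (sq_int hf); apply: eq_integrable => // t _.
by rewrite patchE /zero_ext mem_setE /=; case: ifP => //= _; rewrite rnorm0 expr0n.
Qed.

Lemma sq_sql f : sq f -> loc_sq f.
Proof.
move=> hf; split=> [|s t]; first exact: sq_sm.
have := sq_int hf; rewrite setTE; apply: integrableS => //; exact: measurable_Itv.
Qed.

Definition sq_mass (f : R -> H) : R := \int[mu]_(r in setT) (rnorm (f r) ^+ 2).

Lemma sq_intT f : sq f -> mu.-integrable setT (EFin \o (fun r => rnorm (f r) ^+ 2)).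
Proof. by move=> /sq_int; rewrite setTE. Qed.

Lemma Int_leT s t (f : R -> R) : (forall r, 0 <= f r) -> mu.-integrable setT (EFin \o f) ->
  Int s t f <= \int[mu]_(r in setT) f r.
Proof.
move=> f0 fi; have fi' : mu.-integrable `[s, t]%classic (EFin \o f).
  by apply: integrableS fi.
rewrite -lee_fin /Rintegral !fineK; try by apply: integrable_fin_num.
apply: ge0_subset_integral => //=; first by have := measurable_int _ fi.
by move=> r _; rewrite lee_fin.
Qed.

End Pettis.

(** * Traces of weak solutions *)

Section Traces.
Context {R : realType} {H : completeNormedModType R[i]}.
Variable ip : {dot H for Num.conj}.
Hypothesis norm_ip : forall x : H, `|x| ^+ 2 = ip x x.
Hypothesis sep : exists D : set H, countable D /\ dense D.
Local Notation rip := (re_ip ip).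
Local Notation mu := (@lebesgue_measure R).
Local Notation Int s t f := (\int[mu]_(r in `[s, t]%classic) f r).
Local Notation T := (`]-oo, +oo[ : interval R).
Local Notation sqT := (@square_integrable R H T).
Implicit Types s t : R.
Variable A : set (H * H).
Hypothesis sA : selfadjoint ip A.
Variable I : interval R.
Hypothesis Iopen : forall t, t \in I -> exists2 eta, 0 < eta & t + eta \in I.
Local Notation off := (zero_ext I).
Local Notation J d := (resolv A d).
Local Notation B d := (resolv_img A d).

Lemma itv_convex s t r : s \in I -> t \in I -> s <= r <= t -> r \in I.
Proof. by move=> sI tI h; exact: (interval_is_interval sI tI h). Qed.

(* The equation i u' + A u = g on I, tested against phi(t) f with phi real. *)
Definition weak_sol (u g : R -> H) :=
  [/\ square_integrable I u, square_integrable I g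
    & forall f h phi phi' p q, A (f, h) -> (forall n, diffn n phi) -> has_deriv phi phi' ->
      (forall r, ~ (p <= r <= q) -> phi r = 0) -> (forall r, p <= r <= q -> r \in I) ->
      Int p q (fun r => rip (u r) ('i%C *: f) * phi' r) =
      Int p q (fun r => (rip (g r) f - rip (u r) h) * phi r)].

Lemma offE (f : R -> H) t : t \in I -> off f t = f t.
Proof. by rewrite /zero_ext => ->. Qed.

Lemma weak_sol_pts u g f h s t : weak_sol u g -> A (f, h) ->
  s \in I -> t \in I -> s < t ->
  lebesgue_pt (fun r => rip (off u r) ('i%C *: f)) s ->
  lebesgue_pt (fun r => rip (off u r) ('i%C *: f)) t ->
  rip (u s) ('i%C *: f) - rip (u t) ('i%C *: f) =
  Int s t (fun r => rip (off g r) f - rip (off u r) h).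
Proof.
move=> [hu hg hw] Afh sI tI st ls lt.
have lu := sq_sql (off_sq sep hu); have lg := sq_sql (off_sq sep hg).
have lr (k : R -> H) x : loc_sq k -> loc_integrable (fun r => rip (k r) x).
  by move=> hk; exact: (locint_rip norm_ip hk (sql_cst x)).
have [eta eta0 etaI] := Iopen tI.
have sub r : s <= r <= t + eta -> r \in I by move=> hr; exact: (itv_convex sI etaI hr).
have := @weak_ftc R I (fun r => rip (off u r) ('i%C *: f)) (fun r => rip (off g r) f - rip (off u r) h)
  s t eta (lr _ _ lu).
rewrite !offE//; apply=> //.
  by apply: locintB; exact: lr.
move=> phi phi' p q dphi hphi phi0 pI.
have E := hw f h phi phi' p q Afh dphi hphi phi0 pI.
transitivity (Int p q (fun r => rip (u r) ('i%C *: f) * phi' r)).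
  by apply: eq_Rintegral => r; rewrite inE /= in_itv /= => /pI rI; rewrite offE.
rewrite E; apply: eq_Rintegral => r; rewrite inE /= in_itv /= => /pI rI.
by rewrite !offE.
Qed.

(** The parameters of the regularizing resolvents, shifted by one so that they are nonzero from
    [n = 0] on. *)
Definition inv_succ (n : nat) : R := n.+1%:R^-1.
Lemma dn_neq0 n : inv_succ n != 0. Proof. by rewrite invr_eq0 pnatr_eq0. Qed.

Lemma cvg_lip (F : H -> H) C : (forall x y, rnorm (F x - F y) <= C * rnorm (x - y)) ->
  forall (u : nat -> H) l, u n @[n --> \oo] --> l -> F (u n) @[n --> \oo] --> F l.
Proof.
move=> hF u l /(rnorm_cvgP u l) h; apply/rnorm_cvgP => e e0.
have C1 : 0 < `|C| + 1 by rewrite ltr_wpDl.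
have [N hN] := h (e / (`|C| + 1)) (divr_gt0 e0 C1); exists N => n /hN hn.
apply: le_lt_trans (hF _ _) _.
move: hn; rewrite ltr_pdivlMr//; have := ler_norm C; have := normr_ge0 C; have := rnorm_ge0 (l - u n).
move: (rnorm _) `|C| => x c; nra.
Qed.

Lemma sq_lip (I' : interval R) (F : H -> H) C (f : R -> H) :
  (forall x y, rnorm (F x - F y) <= C * rnorm (x - y)) ->
  (forall x, rnorm (F x) <= C * rnorm x) ->
  square_integrable I' f -> square_integrable I' (fun t => F (f t)).
Proof.
move=> h1 h2 hf; apply: (sq_le (g := f) (C := C)) => //.
apply: sm_comp; last exact: sq_sm.
by move=> u l; exact: (cvg_lip h1).
Qed.

Lemma sqJ n (I' : interval R) f : square_integrable I' f ->
  square_integrable I' (fun t => J (inv_succ n) (f t)).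
Proof.
apply: (@sq_lip _ _ 1) => [x y|x]; rewrite mul1r; last exact: (Jr_norm norm_ip sA _ (dn_neq0 n)).
by rewrite -(JrB norm_ip sA _ _ (dn_neq0 n)); exact: (Jr_norm norm_ip sA _ (dn_neq0 n)).
Qed.

Lemma sqBr n (I' : interval R) f : square_integrable I' f ->
  square_integrable I' (fun t => B (inv_succ n) (f t)).
Proof.
apply: (@sq_lip _ _ `|inv_succ n|^-1) => [x y|x]; last exact: (Br_norm norm_ip sA _ (dn_neq0 n)).
by rewrite -(BrB norm_ip sA _ _ (dn_neq0 n)); exact: (Br_norm norm_ip sA _ (dn_neq0 n)).
Qed.

(** The derivative of [J u]: solving [i u' + A u = g] for [u'] and applying [J] gives
    [i (A J u - J g)], where [A J] is the bounded operator [B]. *)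
Definition reg_source u g n (r : R) : H := 'i%C *: (B (inv_succ n) (off u r) - J (inv_succ n) (off g r)).

Lemma kap_sql u g n : weak_sol u g -> loc_sq (reg_source u g n).
Proof.
move=> [hu hg _]; apply: sq_sql; apply: sqZ; apply: sqB.
  by apply: sqBr; exact: off_sq.
by apply: sqJ; exact: off_sq.
Qed.

Lemma rip_dense x y : (exists e : nat -> H, (forall z r, 0 < r -> exists n, rnorm (z - e n) < r) /\
  forall n, rip x (e n) = rip y (e n)) -> x = y.
Proof.
move=> [e [ed he]]; apply/eqP; rewrite -subr_eq0; apply/eqP; set v := x - y.
have hv n : rip v (e n) = 0 by rewrite ripBl he subrr.
apply: (rip_eq0 norm_ip); apply: eps_eq => r r0; rewrite subr0 ger0_norm ?rip_ge0//.
have K0 : 0 < rnorm v + 1 by rewrite ltr_wpDl ?rnorm_ge0.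
have [n hn] := ed v (r / (rnorm v + 1)) (divr_gt0 r0 K0).
have -> : rip v v = rip v (v - e n) by rewrite [in RHS]ripBr hv subr0.
apply: le_trans (rip_le norm_ip _ _) _.
move: hn; rewrite ltr_pdivlMr//; have := rnorm_ge0 v; have := rnorm_ge0 (v - e n).
move: (rnorm _) (rnorm _) => a b; nra.
Qed.

(* Off a null set the regularized function J u is a primitive of reg_source. *)
Lemma good_points u g : weak_sol u g -> exists E : set R,
  [/\ E `<=` [set` I], {ae mu, forall t, t \in I -> E t}
    & forall n s t x, E s -> E t -> s <= t ->
      rip (J (inv_succ n) (u t) - J (inv_succ n) (u s)) x = Int s t (fun r => rip (reg_source u g n r) x)].
Proof.
move=> hw; have [hu hg _] := hw; have [e ed] := dense_seq sep.
have lu := sq_sql (off_sq sep hu); have lg := sq_sql (off_sq sep hg).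
have lr (k : R -> H) x : loc_sq k -> loc_integrable (fun r => rip (k r) x).
  by move=> hk; exact: (locint_rip norm_ip hk (sql_cst x)).
(* These vectors lie in the domain of [A] whatever [e j] is, and there are countably many of them,
   so a single null set contains all bad points. *)
pose f n j := J (- inv_succ n) (e j).
have nd n : - inv_succ n != 0 by rewrite oppr_eq0 dn_neq0.
pose w n j r := rip (off u r) ('i%C *: f n j).
pose E := [set t | t \in I /\ forall n j, lebesgue_pt (w n j) t].
have aeE : {ae mu, forall t, t \in I -> E t}.
  have : {ae mu, forall t, forall n, forall j, lebesgue_pt (w n j) t}.
    apply: ae_foralln => n; apply: ae_foralln => j.
    by apply: lebesgue_differentiation; apply: locint_locally; exact: lr.
  by apply: ae_sub => t ht tI; split.
exists E; split=> //; first by move=> t [].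
move=> n s t x [sI Es] [tI Et]; rewrite le_eqVlt => /orP[/eqP <-|st].
  by rewrite subrr rip0l Int_pt.
have lk := kap_sql n hw.
have [z zE] : exists z, forall x, rip z x = Int s t (fun r => rip (reg_source u g n r) x).
  have [W [_ pW]] := pettis norm_ip 0 0 lk.
  by exists (W t - W s) => y; rewrite pW// ltW.
(* The weak equation tests [u] against ['i f]; the vectors [- 'i e_j] match this and are dense
   again. *)
rewrite -zE; congr rip; apply: rip_dense; exists (fun j => - ('i%C *: e j)); split.
  move=> y r r0; have [j hj] := ed ('i%C *: y) r r0; exists j.
  rewrite -rnormi scalerBr scalerN scalerA -expr2 sqr_i scaleN1r opprK.
  by move: hj.
move=> j; rewrite zE.
have := weak_sol_pts hw (JrP norm_ip sA (e j) (nd n)) sI tI st (Es n j) (Et n j).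
have e1 y : rip y ('i%C *: J (- inv_succ n) (e j)) = rip (J (inv_succ n) y) ('i%C *: e j).
  rewrite -[in LHS](JrZ norm_ip sA 'i%C _ (nd n)).
  by rewrite -(Jr_adj norm_ip sA _ _ (dn_neq0 n)).
rewrite !e1 => h.
transitivity (rip (J (inv_succ n) (u s)) ('i%C *: e j) - rip (J (inv_succ n) (u t)) ('i%C *: e j)).
  by rewrite ripNr ripBl; ring.
rewrite h; apply: eq_Rintegral => r _.
rewrite -(Jr_adj norm_ip sA _ _ (dn_neq0 n)) -(Br_adj norm_ip sA _ _ (dn_neq0 n)).
by rewrite /reg_source ripNr ripii ripBl; ring.
Qed.

End Traces.

(** * Uniform convergence of the regularized solutions *)

Section TraceTheorem.
Context {R : realType} {H : completeNormedModType R[i]}.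
Variable ip : {dot H for Num.conj}.
Hypothesis norm_ip : forall x : H, `|x| ^+ 2 = ip x x.
Hypothesis sep : exists D : set H, countable D /\ dense D.
Local Notation rip := (re_ip ip).
Local Notation mu := (@lebesgue_measure R).
Local Notation Int s t f := (\int[mu]_(r in `[s, t]%classic) f r).
Local Notation T := (`]-oo, +oo[ : interval R).
Local Notation sqT := (@square_integrable R H T).
Implicit Types s t : R.
Variable A : set (H * H).
Hypothesis sA : selfadjoint ip A.
Variable I : interval R.
Hypothesis Iopen : forall t, t \in I -> exists2 eta, 0 < eta & t + eta \in I.
Local Notation off := (zero_ext I).
Local Notation J n := (resolv A (inv_succ n)).
Local Notation B n := (resolv_img A (inv_succ n)).

Lemma dn_cvg (x : H) e : 0 < e -> exists N, forall n, (N <= n)%N -> rnorm (J n x - x) < e.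
Proof.
move=> e0; have [dl dl0 h] := Jr_cvg norm_ip sA x e0.
have [N hN] := small_inv dl0; exists N => n /hN hn.
by apply: h; [exact: dn_neq0|rewrite ger0_norm// /inv_succ invr_ge0].
Qed.

(** Pointwise [J n] tends to the identity, and contractivity gives the majorant [4 |f|^2]. *)
Lemma NT_J_cvg f : sqT f -> sq_mass (fun r => J n (f r) - f r) @[n --> \oo] --> 0.
Proof.
move=> hf.
have -> : 0 = \int[mu]_(r in setT) (0 : R) by rewrite /Rintegral integral0.
have [|n|r _||n r _|_] := @Rintegral_dominated_cvg R setT (fun n r => rnorm (J n (f r) - f r) ^+ 2) (fun=> 0)
    (fun r => 4 * rnorm (f r) ^+ 2) => //.
- apply: measurable_funX; apply: sm_rnormT; apply: sq_sm; apply: sqB => //.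
  exact: (sqJ norm_ip sA).
- apply/cvgrPdist_lt => e e0.
  have [N hN] := dn_cvg (f r) (ltac:(by rewrite lt_min ltr01 e0) : 0 < Num.min 1 e).
  exists N => // n /= /hN; rewrite lt_min => /andP[h1 h2].
  rewrite sub0r normrN ger0_norm ?sqr_ge0//.
  have := rnorm_ge0 (J n (f r) - f r); move: (rnorm _) h1 h2 => x; nra.
- have := @int_Z R T 4 (fun r => rnorm (f r) ^+ 2); rewrite setTE; apply; exact: sq_intT.
- rewrite ger0_norm ?sqr_ge0//.
  have h1 := rnormD (J n (f r)) (- f r); rewrite rnormN in h1.
  have h2 := Jr_norm norm_ip sA (f r) (dn_neq0 n).
  have := rnorm_ge0 (J n (f r) - f r).
  by move: (rnorm _) (rnorm (f r)) (rnorm _) h1 h2 => x y z; nra.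
Qed.

Lemma NT_triangle (f g : R -> H) : sqT f -> sqT g ->
  sq_mass (fun r => f r - g r) <= 2 * sq_mass f + 2 * sq_mass g.
Proof.
move=> hf hg; have i1 := sq_intT hf; have i2 := sq_intT hg; have i3 := sq_intT (sqB hf hg).
have j1 : mu.-integrable setT (EFin \o (fun r => 2 * rnorm (f r) ^+ 2)).
  by have := @int_Z R T 2 (fun r => rnorm (f r) ^+ 2); rewrite setTE; apply.
have j2 : mu.-integrable setT (EFin \o (fun r => 2 * rnorm (g r) ^+ 2)).
  by have := @int_Z R T 2 (fun r => rnorm (g r) ^+ 2); rewrite setTE; apply.
have j3 : mu.-integrable setT (EFin \o (fun r => 2 * rnorm (f r) ^+ 2 + 2 * rnorm (g r) ^+ 2)).
  by have := @int_D R T (fun r => 2 * rnorm (f r) ^+ 2) (fun r => 2 * rnorm (g r) ^+ 2); rewrite setTE; apply.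
rewrite /sq_mass -!RintegralZl// -RintegralD//; apply: le_Rintegral => // r _.
have := rnormD (f r) (- g r); rewrite rnormN.
have := rnorm_ge0 (f r - g r); have := sqr_ge0 (rnorm (f r) - rnorm (g r)).
move: (rnorm _) (rnorm (f r)) (rnorm _) => x y z; nra.
Qed.

Lemma Int_ae s t (f g : R -> R) : loc_integrable f -> loc_integrable g ->
  {ae mu, forall r, f r = g r} -> Int s t f = Int s t g.
Proof.
move=> [mf _] [mg _] fg; apply: (@Rintegral_ae R `[s, t]); try exact: measurable_funTS.
by apply: ae_sub fg => r.
Qed.

Lemma rip_cvg (x y : nat -> H) lx ly : x n @[n --> \oo] --> lx -> y n @[n --> \oo] --> ly ->
  rip (x n) (y n) @[n --> \oo] --> rip lx ly.
Proof.
have E (v w : H) : rip v w = 2^-1 * (rnorm (v + w) * rnorm (v + w) - rnorm v * rnorm v - rnorm w * rnorm w).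
  by rewrite -!expr2 (rnorm_sqrD norm_ip); field.
move=> cx cy; rewrite E; under eq_fun do rewrite E.
apply: cvgM; first exact: cvg_cst.
have cxy : x n + y n @[n --> \oo] --> lx + ly by exact: cvgD.
by apply: cvgB; [apply: cvgB|]; apply: cvgM; apply: cvg_rnorm.
Qed.

Definition cts_fun (f : R -> H) := forall t e, 0 < e ->
  exists2 r, 0 < r & forall s, `|t - s| < r -> rnorm (f t - f s) < e.

Section Solution.
Variables u g : R -> H.
Hypothesis hw : weak_sol ip A I u g.
Let hu : sqT (off u). Proof. by have [h _ _] := hw; exact: off_sq. Qed.
Let hg : sqT (off g). Proof. by have [_ h _] := hw; exact: off_sq. Qed.
Let kap n := reg_source A I u g n.
Variable E : set R.
Hypotheses (EI : E `<=` [set` I]) (aeE : {ae mu, forall t, t \in I -> E t}).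
Hypothesis Egood : forall n s t x, E s -> E t -> s <= t ->
  rip (J n (u t) - J n (u s)) x = Int s t (fun r => rip (kap n r) x).
Variable s0 : R.
Hypothesis Es0 : E s0.

(** The primitive is normalized at the good point [s0]; at any other good point both sides have the
    same increment from [s0]. *)
Lemma regularized n : exists W, prim ip W (kap n) /\ forall t, E t -> W t = J n (u t).
Proof.
have lk := kap_sql norm_ip sep sA n hw.
have [W [W0 pW]] := pettis norm_ip s0 (J n (u s0)) lk.
exists W; split=> // t Et; apply: (rip_ext norm_ip) => x.
apply/eqP; rewrite -subr_eq0 -ripBl; apply/eqP.
have [st|/ltW ts] := leP s0 t.
  have := pW _ _ x st; rewrite -(Egood n x Es0 Et st) W0 !ripBl; lra.
have := pW _ _ x ts; rewrite -(Egood n x Et Es0 ts) W0 !ripBl; lra.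
Qed.

Let W n := sval (cid (regularized n)).
Let pW n : prim ip (W n) (kap n). Proof. by rewrite /W; case: cid => ? []. Qed.
Let WE n t : E t -> W n t = J n (u t).
Proof. by move=> Et; rewrite /W; case: cid => w [_ h] /=; exact: h. Qed.
Let lk n : loc_sq (kap n). Proof. exact: kap_sql. Qed.

Let d n m r := J n (off u r) - J m (off u r).
Let dg n m r := J n (off g r) - J m (off g r).
Let sqd n m : sqT (d n m). Proof. by apply: sqB; exact: (sqJ norm_ip sA). Qed.
Let sqdg n m : sqT (dg n m). Proof. by apply: sqB; exact: (sqJ norm_ip sA). Qed.

Lemma prim_diff n m : prim ip (fun t => W n t - W m t) (fun r => kap n r - kap m r).
Proof.
move=> s t x st.
have lr k : loc_integrable (fun r => rip (kap k r) x) by exact: (locint_rip norm_ip (lk k) (sql_cst x)).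
have -> : W n t - W m t - (W n s - W m s) = (W n t - W n s) - (W m t - W m s).
  by vec norm_ip.
rewrite ripBl !pW// -IntB//; apply: eq_Rintegral => r _; by rewrite ripBl.
Qed.

Lemma kap_diff_sql n m : loc_sq (fun r => kap n r - kap m r).
Proof.
apply: sq_sql; rewrite /kap /reg_source; apply: sqB; apply: sqZ; apply: sqB;
  by [exact: (sqBr norm_ip sA)|exact: (sqJ norm_ip sA)].
Qed.

(** In the energy of [W n - W m] the operator part is [rip ('i A v) v = 0], so only the source [g]
    remains. This makes the estimate independent of the norm of [B], whose bound grows with [n]. *)
Lemma energy_diff n m s t : s <= t ->
  rnorm (W n t - W m t) ^+ 2 - rnorm (W n s - W m s) ^+ 2 =
  2 * Int s t (fun r => rip (- ('i%C *: dg n m r)) (d n m r)).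
Proof.
move=> st; rewrite (energy norm_ip sep (kap_diff_sql n m) (prim_diff n m) st); congr (_ * _).
have lD := prim_sql norm_ip sep (kap_diff_sql n m) (prim_diff n m).
apply: Int_ae.
- exact: (locint_rip norm_ip (kap_diff_sql n m) lD).
- apply: (locint_rip norm_ip); apply: sq_sql => //.
  have := sqZ (- 'i%C) (sqdg n m); congr square_integrable.
  by apply/funext => r; rewrite scaleNr.
apply: ae_sub aeE => r hr; have [rI|rI] := boolP (r \in I).
  rewrite (WE n (hr rI)) (WE m (hr rI)) /kap /reg_source /d /dg !offE//.
  set v := J n (u r) - J m (u r).
  have Av : A (v, B n (u r) - B m (u r)).
    by apply: (sadjD sA); [exact: (JrP norm_ip sA _ (dn_neq0 n))|
       apply: (sadjN sA); exact: (JrP norm_ip sA _ (dn_neq0 m))].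
  have := sadj_skew0 sA Av.
  rewrite !scalerBr !(ripDl, ripNl) => h; move: h; lra.
rewrite /kap /reg_source /d /dg /zero_ext (negbTE rI).
rewrite (Jr0 norm_ip sA (dn_neq0 n)) (Jr0 norm_ip sA (dn_neq0 m)).
rewrite (Br0 norm_ip sA (dn_neq0 n)) (Br0 norm_ip sA (dn_neq0 m)).
by rewrite !(subr0, scaler0, oppr0, rip0l).
Qed.

(** Twice the scalar product in [energy_diff] is at most the sum of the squares, whose integral over
    the whole line does not depend on [t]. *)
Lemma unif_diff n m t : rnorm (W n t - W m t) ^+ 2 <=
  rnorm (J n (u s0) - J m (u s0)) ^+ 2 + (sq_mass (dg n m) + sq_mass (d n m)).
Proof.
have key s s' : `|2 * Int s s' (fun r => rip (- ('i%C *: dg n m r)) (d n m r))| <= sq_mass (dg n m) + sq_mass (d n m).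
  have i1 := sq_intT (sqdg n m); have i2 := sq_intT (sqd n m).
  have sdg : sqT (fun r => - ('i%C *: dg n m r)).
    have := sqZ (- 'i%C) (sqdg n m); congr square_integrable.
    by apply/funext => r; rewrite scaleNr.
  have lr : loc_integrable (fun r => rip (- ('i%C *: dg n m r)) (d n m r)).
    by apply: (locint_rip norm_ip); apply: sq_sql.
  rewrite normrM ger0_norm//.
  have i3 : mu.-integrable setT (EFin \o (fun r => rnorm (dg n m r) ^+ 2 + rnorm (d n m r) ^+ 2)).
    by have := @int_D R T (fun r => rnorm (dg n m r) ^+ 2) (fun r => rnorm (d n m r) ^+ 2); rewrite setTE; apply.
  apply: (@le_trans _ _ (Int s s' (fun r => rnorm (dg n m r) ^+ 2 + rnorm (d n m r) ^+ 2))); last first.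
    apply: le_trans (Int_leT _ _ _ i3) _; first by move=> r; rewrite addr_ge0 ?sqr_ge0.
    by rewrite RintegralD.
  have l2 : loc_integrable (fun r => rnorm (dg n m r) ^+ 2 + rnorm (d n m r) ^+ 2).
    by apply: locintD; apply: locint_sq; exact: sq_sql.
  apply: (@le_trans _ _ (2 * Int s s' (fun r => `|rip (- ('i%C *: dg n m r)) (d n m r)|))).
    by rewrite ler_pM2l//; exact: Int_norm.
  rewrite -IntZ; last exact: locint_abs.
  apply: Int_le => //; first by apply: locintZ; exact: locint_abs.
  move=> r _; have := rip_CS norm_ip (- ('i%C *: dg n m r)) (d n m r).
  rewrite rnormN rnormi; have := sqr_ge0 (rnorm (dg n m r) - rnorm (d n m r)).
  move: `|_| (rnorm _) (rnorm _) => x y z; nra.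
have [st|/ltW ts] := leP s0 t.
  have := energy_diff n m st; have := key s0 t; rewrite ler_norml => /andP[].
  rewrite !(WE _ Es0); move: (2 * _) => x; lra.
have := energy_diff n m ts; have := key t s0; rewrite ler_norml => /andP[].
rewrite !(WE _ Es0); move: (2 * _) => x; lra.
Qed.

Lemma unif_cauchy e : 0 < e -> exists N, forall n m t, (N <= n)%N -> (N <= m)%N ->
  rnorm (W n t - W m t) < e.
Proof.
(* Each of the two masses is below [4 c] by [NT_triangle], together [e^2 / 2]; the value at [s0]
   contributes at most [e^2 / 4]. *)
move=> e0; pose c := e ^+ 2 / 16; have c0 : 0 < c by rewrite divr_gt0// exprn_gt0.
have [N1 h1] := dn_cvg (u s0) (ltac:(by rewrite divr_gt0) : 0 < e / 4).
have [N2 h2] := cvgn_eps (NT_J_cvg hu) c0.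
have [N3 h3] := cvgn_eps (NT_J_cvg hg) c0.
have N0 f : 0 <= sq_mass f by apply: Rintegral_ge0 => r _; exact: sqr_ge0.
exists (maxn N1 (maxn N2 N3)) => n m t Nn Nm.
rewrite -(@ltr_pXn2r _ 2)// ?nnegrE ?rnorm_ge0 ?(ltW e0)//.
apply: le_lt_trans (unif_diff n m t) _.
have b1 : rnorm (J n (u s0) - J m (u s0)) <= e / 2.
  have -> : J n (u s0) - J m (u s0) = (J n (u s0) - u s0) - (J m (u s0) - u s0) by vec norm_ip.
  apply: le_trans (rnormD _ _) _; rewrite rnormN.
  have := h1 n ltac:(lia); have := h1 m ltac:(lia); lra.
have tri f : sqT f -> sq_mass (fun r => J n (f r) - J m (f r)) <=
    2 * sq_mass (fun r => J n (f r) - f r) + 2 * sq_mass (fun r => J m (f r) - f r).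
  move=> hf; apply: le_trans (NT_triangle _ _); last 2 first.
  - by apply: sqB => //; exact: (sqJ norm_ip sA).
  - by apply: sqB => //; exact: (sqJ norm_ip sA).
  rewrite le_eqVlt; apply/orP; left; apply/eqP; congr sq_mass; apply/funext => r.
  by move: (J n (f r)) (J m (f r)) (f r) => x y z; vec norm_ip.
pose nu k := sq_mass (fun r => J k (off u r) - off u r).
pose ng k := sq_mass (fun r => J k (off g r) - off g r).
have t1 : sq_mass (d n m) <= 2 * nu n + 2 * nu m := tri _ hu.
have t2 : sq_mass (dg n m) <= 2 * ng n + 2 * ng m := tri _ hg.
have bu k : (maxn N1 (maxn N2 N3) <= k)%N -> nu k < c.
  move=> Nk; have Nk' : (N2 <= k)%N by move: Nk; rewrite !geq_max => /and3P[].
  by have := h2 k Nk'; rewrite subr0 ger0_norm ?N0.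
have bg k : (maxn N1 (maxn N2 N3) <= k)%N -> ng k < c.
  move=> Nk; have Nk' : (N3 <= k)%N by move: Nk; rewrite !geq_max => /and3P[].
  by have := h3 k Nk'; rewrite subr0 ger0_norm ?N0.
have b2 : rnorm (J n (u s0) - J m (u s0)) ^+ 2 <= e ^+ 2 / 4.
  have -> : e ^+ 2 / 4 = (e / 2) ^+ 2 by field.
  by rewrite lerXn2r ?nnegrE ?rnorm_ge0 ?divr_ge0 ?(ltW e0).
move: c0 t1 t2 b2 (bu n Nn) (bu m Nm) (bg n Nn) (bg m Nm); rewrite /c; clear.
move: (rnorm _ ^+ 2) (sq_mass (d n m)) (sq_mass (dg n m)) (nu n) (nu m) (ng n) (ng m) (e ^+ 2).
by move=> *; lra.
Qed.

(** The uniform limit of the [W n] is continuous. Their energy identity contains [u] and [g] only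
    through [J n], the operator part having dropped out, so it passes to the limit by dominated
    convergence. *)
Lemma trace_solution : exists U : R -> H, [/\ cts_fun U, forall t, E t -> U t = u t
  & forall s t, s <= t -> rnorm (U t) ^+ 2 - rnorm (U s) ^+ 2 =
      2 * Int s t (fun r => rip ('i%C *: off u r) (off g r))].
Proof.
have lim t : exists l : H, W n t @[n --> \oo] --> l.
  by apply: rnorm_cauchy => e /unif_cauchy[N hN]; exists N => m n Nm Nn; exact: hN.
pose U t := sval (cid (lim t)).
have UE t : W n t @[n --> \oo] --> U t by rewrite /U; case: cid.
have unif e : 0 < e -> exists N, forall n t, (N <= n)%N -> rnorm (U t - W n t) <= e.
  move=> e0; have [N hN] := unif_cauchy e0; exists N => n t Nn.
  apply/ler_addgt0Pr => e' e'0.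
  have [N' hN'] := (rnorm_cvgP (fun n => W n t) (U t)).1 (UE t) e' e'0.
  pose m := maxn N N'.
  have -> : U t - W n t = (W m t - W n t) + (U t - W m t) by vec norm_ip.
  apply: le_trans (rnormD _ _) _; apply: lerD; apply: ltW.
    by apply: hN => //; rewrite leq_maxl.
  by apply: hN'; rewrite leq_maxr.
exists U; split.
- move=> t e e0; have e4 : 0 < e / 4 by rewrite divr_gt0.
  have [N hN] := unif _ e4.
  have [r r0 hr] := prim_cts norm_ip (lk N) (pW N) t e4; exists r => // s /hr hs.
  have -> : U t - U s = (U t - W N t) + ((W N t - W N s) - (U s - W N s)) by vec norm_ip.
  apply: le_lt_trans (rnormD _ _) _; apply: le_lt_trans (lerD (lexx _) (rnormD _ _)) _.
  rewrite rnormN; have := hN N t (leqnn _); have := hN N s (leqnn _); lra.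
- move=> t Et; apply/eqP; rewrite -subr_eq0; apply/eqP/rnorm_eq0.
  apply: eps_eq => e e0; rewrite subr0 ger0_norm ?rnorm_ge0//.
  have e2 : 0 < e / 2 by rewrite divr_gt0.
  have [N1 h1] := unif _ e2; have [N2 h2] := dn_cvg (u t) e2.
  pose m := maxn N1 N2.
  have -> : U t - u t = (U t - W m t) + (J m (u t) - u t) by rewrite WE//; vec norm_ip.
  apply: le_trans (rnormD _ _) _.
  have := h1 m t (leq_maxl _ _); have := h2 m (leq_maxr _ _); lra.
- move=> s t st.
  have En n : rnorm (W n t) ^+ 2 - rnorm (W n s) ^+ 2 =
      2 * Int s t (fun r => rip ('i%C *: J n (off u r)) (J n (off g r))).
    rewrite (energy norm_ip sep (lk n) (pW n) st); congr (_ * _).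
    have h1 : sqT (fun r => J n (off u r)) by exact: (sqJ norm_ip sA).
    have h2 : sqT (fun r => J n (off g r)) by exact: (sqJ norm_ip sA).
    apply: Int_ae.
    + exact: (locint_rip norm_ip (lk n) (prim_sql norm_ip sep (lk n) (pW n))).
    + by apply: (locint_rip norm_ip); apply: sq_sql => //; exact: sqZ.
    apply: ae_sub aeE => r hr; have [rI|rI] := boolP (r \in I).
      rewrite (WE n (hr rI)) /kap /reg_source !offE//.
      have := sadj_skew0 sA (JrP norm_ip sA (u r) (dn_neq0 n)).
      by rewrite scalerBr ripBl => ->; rewrite sub0r [in LHS]ripiC opprK ripC.
    rewrite /kap /reg_source /zero_ext (negbTE rI).
    rewrite (Jr0 norm_ip sA (dn_neq0 n)) (Br0 norm_ip sA (dn_neq0 n)).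
    by rewrite !(subr0, scaler0, oppr0, rip0l).
  have cn t' : rnorm (W n t') ^+ 2 @[n --> \oo] --> rnorm (U t') ^+ 2.
    by rewrite expr2; under eq_fun do rewrite expr2; apply: cvgM; apply: cvg_rnorm.
  have c1 : rnorm (W n t) ^+ 2 - rnorm (W n s) ^+ 2 @[n --> \oo] --> rnorm (U t) ^+ 2 - rnorm (U s) ^+ 2.
    by apply: cvgB.
  have jc f : (fun n => J n f) @ \oo --> f.
    by apply/rnorm_cvgP => e /(dn_cvg f)[N hN]; exists N => n /hN; rewrite rnormBC.
  have hui : sqT (fun r => 'i%C *: off u r) by exact: sqZ.
  have [_ c2] : mu.-integrable `[s, t]%classic (EFin \o (fun r => rip ('i%C *: off u r) (off g r))) /\
      Int s t (fun r => rip ('i%C *: J n (off u r)) (J n (off g r))) @[n --> \oo] -->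
      Int s t (fun r => rip ('i%C *: off u r) (off g r)).
    apply: (@Rintegral_dominated_cvg _ _ _ _ (fun r => rnorm (off u r) ^+ 2 + rnorm (off g r) ^+ 2)).
    + exact: measurable_Itv.
    + move=> n; apply: measurable_funTS; apply: (sm_ripT norm_ip); apply: sq_sm.
        by apply: sqZ; exact: (sqJ norm_ip sA).
      exact: (sqJ norm_ip sA).
    + by move=> r _; apply: rip_cvg; [apply: cvgZr; exact: jc|exact: jc].
    + have := locintD (locint_sq (sq_sql hu)) (locint_sq (sq_sql hg)); by case.
    + move=> n r _; apply: le_trans (rip_CS norm_ip _ _) _; rewrite rnormi.
      have h1 := Jr_norm norm_ip sA (off u r) (dn_neq0 n).
      have h2 := Jr_norm norm_ip sA (off g r) (dn_neq0 n).
      apply: le_trans (ler_pM (rnorm_ge0 _) (rnorm_ge0 _) h1 h2) _.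
      have := sqr_ge0 (rnorm (off u r) - rnorm (off g r)); rewrite sqrrB.
      have := sqr_ge0 (rnorm (off u r)); have := sqr_ge0 (rnorm (off g r)); lra.
  have c3 : 2 * Int s t (fun r => rip ('i%C *: J n (off u r)) (J n (off g r))) @[n --> \oo] -->
      2 * Int s t (fun r => rip ('i%C *: off u r) (off g r)).
    by apply: cvgM => //; exact: cvg_cst.
  move: c1; rewrite (funext En) => c1.
  exact: (cvg_unique _ c1 c3).
Qed.

End Solution.
End TraceTheorem.

(** * Vanishing of the energy at infinity *)

Section HalfLines.
Context {R : realType} {H : completeNormedModType R[i]}.
Variable ip : {dot H for Num.conj}.
Hypothesis norm_ip : forall x : H, `|x| ^+ 2 = ip x x.
Hypothesis sep : exists D : set H, countable D /\ dense D.
Local Notation rip := (re_ip ip).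
Local Notation mu := (@lebesgue_measure R).
Local Notation Int s t f := (\int[mu]_(r in `[s, t]%classic) f r).
Local Notation T := (`]-oo, +oo[ : interval R).
Local Notation sqT := (@square_integrable R H T).
Implicit Types s t : R.
Variable A : set (H * H).
Hypothesis sA : selfadjoint ip A.

Lemma Int_lim (x y : nat -> R) (D : set (measurableTypeR R)) (h : R -> R) :
  mu.-integrable setT (EFin \o h) ->
  (forall r, exists N, forall n, (N <= n)%N -> (x n <= r <= y n <-> D r)) ->
  Int (x n) (y n) h @[n --> \oo] --> \int[mu]_(r in D) h r.
Proof.
move=> hi hD.
have mh : measurable_fun (setT : set (measurableTypeR R)) h.
  by apply/measurable_EFinP; exact: measurable_int hi.
rewrite Rintegral_mkcond; under eq_fun do rewrite Rintegral_mkcond.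
have [|n|r _||n r _|_] := @Rintegral_dominated_cvg R setT (fun n => h \_ `[x n, y n]%classic) (h \_ D) (fun r => `|h r|) => //.
- apply: (measurable_restrictT _ (measurable_segment _ _)).1; exact: measurable_funTS.
- have [N hN] := hD r; apply: (@near_cst_cvg _ _ _ N) => n /hN h1.
  rewrite !patchE; congr (if _ then _ else _); apply/idP/idP => /set_mem /=.
    by rewrite in_itv /= => /h1 ?; apply/mem_set.
  by move=> /h1 ?; apply/mem_set; rewrite /= in_itv.
- exact: integrable_norm.
- by rewrite patchE; case: ifP => // _; rewrite normr0.
Qed.

Variable I : interval R.
Hypothesis Iopen : forall t, t \in I -> exists2 eta, 0 < eta & t + eta \in I.
Hypothesis Ine : exists p q, p < q /\ forall r, p <= r <= q -> r \in I.
Local Notation off := (zero_ext I).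

Lemma trace_exists u g : weak_sol ip A I u g -> exists U : R -> H,
  [/\ cts_fun U, {ae mu, forall t, t \in I -> u t = U t}
    & forall s t, s <= t -> rnorm (U t) ^+ 2 - rnorm (U s) ^+ 2 =
      2 * Int s t (fun r => rip ('i%C *: off u r) (off g r))].
Proof.
move=> hw; have [E [EI aeE Eg]] := good_points norm_ip sep sA Iopen hw.
have [p [q [pq hpq]]] := Ine.
have [s0 ps0 Es0] := ae_pt pq aeE.
have [U [cU UE en]] := trace_solution norm_ip sep sA hw aeE Eg (Es0 (hpq s0 ps0)).
exists U; split=> //; apply: ae_sub aeE => t hE tI.
by rewrite UE//; exact: hE.
Qed.

(* U is square integrable and its energy is eventually almost constant, hence U vanishes at infinity. *)
Lemma energy_vanishes (x : nat -> R) u g U : weak_sol ip A I u g ->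
  {ae mu, forall t, t \in I -> u t = U t} -> cts_fun U ->
  (forall s t, s <= t -> rnorm (U t) ^+ 2 - rnorm (U s) ^+ 2 =
      2 * Int s t (fun r => rip ('i%C *: off u r) (off g r))) ->
  (forall n r, x n <= r <= x n + 1 -> r \in I) ->
  (forall h, mu.-integrable setT (EFin \o h) -> Int (x n) (x n + 1) h @[n --> \oo] --> (0 : R)) ->
  rnorm (U (x n)) ^+ 2 @[n --> \oo] --> (0 : R) /\ rnorm (U (x n + 1)) ^+ 2 @[n --> \oo] --> (0 : R).
Proof.
move=> [hu hg _] uU cU en xI tail.
have hu' := off_sq sep hu; have hg' := off_sq sep hg.
pose f r := rip ('i%C *: off u r) (off g r).
have lf : loc_integrable f by apply: (locint_rip norm_ip); apply: sq_sql => //; exact: sqZ.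
have fi : mu.-integrable setT (EFin \o f).
  by have := int_rip norm_ip (sqZ 'i%C hu') hg'; rewrite setTE.
have c1 := tail _ (integrable_norm fi).
have c2 := tail _ (sq_intT hu').
have lU : loc_sq U by exact: sql_cts.
have UE n : Int (x n) (x n + 1) (fun r => rnorm (U r) ^+ 2) = Int (x n) (x n + 1) (fun r => rnorm (off u r) ^+ 2).
  apply: (@Rintegral_ae R `[x n, x n + 1]).
  - by apply: measurable_funTS; case: (locint_sq lU).
  - by apply: measurable_funTS; case: (locint_sq (sq_sql hu')).
  apply: ae_sub uU => r h /=; rewrite in_itv /= => /xI rI.
  by rewrite offE// h.
have x1 n : x n <= x n + 1 by rewrite lerDl.
(* A value exceeds the mean over the window of length 1 by at most the oscillation, which is bounded
   by twice the integral of [|f|]. *)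
have bnd n s : x n <= s <= x n + 1 -> rnorm (U s) ^+ 2 <=
    Int (x n) (x n + 1) (fun r => rnorm (off u r) ^+ 2) + 2 * Int (x n) (x n + 1) (fun r => `|f r|).
  move=> hs; rewrite -UE.
  have osc s' : x n <= s' <= x n + 1 -> rnorm (U s) ^+ 2 - 2 * Int (x n) (x n + 1) (fun r => `|f r|) <= rnorm (U s') ^+ 2.
    move=> hs'; move: hs hs' => /andP[a1 a2] /andP[b1 b2].
    have key v w : x n <= v -> v <= w -> w <= x n + 1 -> `|Int v w f| <= Int (x n) (x n + 1) (fun r => `|f r|).
      move=> h1 h2 h3; apply: le_trans (Int_norm _ _ lf) _.
      have la := locint_abs lf.
      rewrite (Int_cat la h1 (le_trans h2 h3)) (Int_cat la h2 h3).
      have p1 : 0 <= Int (x n) v (fun r => `|f r|) by apply: Int_ge0.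
      have p2 : 0 <= Int w (x n + 1) (fun r => `|f r|) by apply: Int_ge0.
      by move: p1 p2; clear; lra.
    have en' v w : v <= w -> rnorm (U w) ^+ 2 - rnorm (U v) ^+ 2 = 2 * Int v w f := @en v w.
    have [ss|/ltW ss] := leP s s'.
      by have := en' _ _ ss; have := key _ _ a1 ss b2; rewrite ler_norml => /andP[+ +]; clear; lra.
    by have := en' _ _ ss; have := key _ _ b1 ss a2; rewrite ler_norml => /andP[+ +]; clear; lra.
  have lc c : loc_integrable (fun=> c : R) by split; [exact: measurable_cst|move=> *; exact: intg_cst].
  have := Int_le (lc _) (locint_sq lU) osc.
  rewrite Int_cst// addrAC subrr add0r mulr1; by rewrite lerBlDr.
have lim : Int (x n) (x n + 1) (fun r => rnorm (off u r) ^+ 2) +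
    2 * Int (x n) (x n + 1) (fun r => `|f r|) @[n --> \oo] --> (0 : R).
  rewrite -[X in _ --> X](addr0 0) -[X in _ --> _ + X](mulr0 2).
  by apply: cvgD => //; apply: cvgM => //; exact: cvg_cst.
split; apply: (squeeze_cvgr _ (cvg_cst 0) lim); apply: nearW => n;
  by rewrite sqr_ge0 bnd//= lexx x1.
Qed.

End HalfLines.

(** * End-point values on the two half-lines *)

Section RightLeft.
Context {R : realType} {H : completeNormedModType R[i]}.
Variable ip : {dot H for Num.conj}.
Hypothesis norm_ip : forall x : H, `|x| ^+ 2 = ip x x.
Hypothesis sep : exists D : set H, countable D /\ dense D.
Local Notation rip := (re_ip ip).
Local Notation mu := (@lebesgue_measure R).
Local Notation Int s t f := (\int[mu]_(r in `[s, t]%classic) f r).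
Variable A : set (H * H).
Hypothesis sA : selfadjoint ip A.

Lemma natN (x : R) : exists N, forall n, (N <= n)%N -> x < n%:R.
Proof.
exists (Num.bound `|x|) => n Nn.
apply: le_lt_trans (ler_norm x) _; apply: lt_le_trans (_ : (Num.bound `|x|)%:R <= _).
  exact: archi_boundP.
by rewrite ler_nat.
Qed.

Lemma right_open (b t : R) : t \in `]b, +oo[ -> exists2 eta, 0 < eta & t + eta \in `]b, +oo[.
Proof. by rewrite in_itv /= andbT => bt; exists 1 => //; rewrite in_itv /= andbT; lra. Qed.

Lemma left_open (a t : R) : t \in `]-oo, a[ -> exists2 eta, 0 < eta & t + eta \in `]-oo, a[.
Proof.
by rewrite in_itv /= => ta; exists ((a - t) / 2); rewrite ?in_itv /=; lra.
Qed.

Lemma int_off (I : interval R) u g :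
  \int[mu]_r rip ('i%C *: zero_ext I u r) (zero_ext I g r) = \int[mu]_(r in [set` I]) rip ('i%C *: u r) (g r).
Proof.
rewrite [RHS]Rintegral_mkcond; apply: eq_Rintegral => r _.
by rewrite patchE /zero_ext mem_setE; case: ifP => // _; rewrite rip0r.
Qed.

(** The energy identity on [[b, x n]] with [x n] tending to infinity: the value at [x n] disappears
    and the one at [b] enters with a minus sign. *)
Lemma right_trace (b : R) u g : let I := `]b, +oo[ in weak_sol ip A I u g ->
  exists U : R -> H, [/\ cts_fun U, {ae mu, forall t, t \in I -> u t = U t}
    & rnorm (U b) ^+ 2 = - 2 * \int[mu]_(r in [set` I]) rip ('i%C *: u r) (g r)].
Proof.
move=> I hw; have Ine : exists p q, p < q /\ forall r, p <= r <= q -> r \in I.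
  by exists (b + 1), (b + 2); split=> [|r]; rewrite ?in_itv /= ?andbT; lra.
have [U [cU uU en]] := trace_exists norm_ip sep sA (@right_open b) Ine hw.
exists U; split=> //; have [hu hg _] := hw.
have hu' := off_sq sep hu; have hg' := off_sq sep hg.
pose f r := rip ('i%C *: zero_ext I u r) (zero_ext I g r).
have fi : mu.-integrable setT (EFin \o f).
  by have := int_rip norm_ip (sqZ 'i%C hu') hg'; rewrite setTE.
pose x n : R := b + n.+1%:R.
have bx n : b < x n by rewrite /x ltrDl.
have big (r : R) : exists N, forall n, (N <= n)%N -> r < x n.
  have [N hN] := natN (r - b); exists N => n /hN; rewrite /x -natr1; lra.
have xI n r : x n <= r <= x n + 1 -> r \in I.
  by move=> /andP[h _]; rewrite in_itv /= andbT; exact: lt_le_trans (bx n) h.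
have tail h : mu.-integrable setT (EFin \o h) -> Int (x n) (x n + 1) h @[n --> \oo] --> (0 : R).
  move=> hi; rewrite -(Rintegral_set0 mu h); apply: Int_lim => // r.
  have [N hN] := big r; exists N => n /hN rx; split=> // /andP[]; by rewrite leNgt rx.
have [c0 _] := energy_vanishes norm_ip sep hw uU cU en xI tail.
have c1 : Int b (x n) f @[n --> \oo] --> \int[mu]_(r in `[b, +oo[%classic) f r.
  apply: Int_lim => // r; have [N hN] := big r; exists N => n /hN rx.
  by rewrite /= in_itv /= andbT (ltW rx) andbT.
have E n : rnorm (U (x n)) ^+ 2 = rnorm (U b) ^+ 2 + 2 * Int b (x n) f.
  by have := en b (x n) (ltW (bx n)); rewrite -/(Int b (x n) f) => <-; rewrite addrC subrK.
have c2 : rnorm (U (x n)) ^+ 2 @[n --> \oo] --> rnorm (U b) ^+ 2 + 2 * \int[mu]_(r in `[b, +oo[%classic) f r.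
  rewrite (funext E); apply: cvgD; first exact: cvg_cst.
  by apply: cvgM => //; exact: cvg_cst.
have : 0 = rnorm (U b) ^+ 2 + 2 * \int[mu]_(r in `[b, +oo[%classic) f r by exact: (cvg_unique _ c0 c2).
have -> : \int[mu]_(r in `[b, +oo[%classic) f r = \int[mu]_(r in [set` I]) rip ('i%C *: u r) (g r).
  rewrite -int_off; apply/esym/Rintegral_subset => // r _ /= /negP; rewrite in_itv /= andbT -ltNge => rb.
  by rewrite /zero_ext in_itv /= andbT ltNge (ltW rb) /= rip0r.
by move=> /eqP; rewrite eq_sym addr_eq0 mulNr => /eqP.
Qed.

(** Mirror image of [right_trace], with the end point as upper limit and hence the opposite sign.
    The extra shift by 1 in [x n] keeps the window [[x n, x n + 1]] inside the open half-line. *)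
Lemma left_trace (a : R) u g : let I := (`]-oo, a[ : interval R) in weak_sol ip A I u g ->
  exists U : R -> H, [/\ cts_fun U, {ae mu, forall t, t \in I -> u t = U t}
    & rnorm (U a) ^+ 2 = 2 * \int[mu]_(r in [set` I]) rip ('i%C *: u r) (g r)].
Proof.
move=> I hw; have Ine : exists p q, p < q /\ forall r, p <= r <= q -> r \in I.
  by exists (a - 2), (a - 1); split=> [|r]; rewrite ?in_itv /=; lra.
have [U [cU uU en]] := trace_exists norm_ip sep sA (@left_open a) Ine hw.
exists U; split=> //; have [hu hg _] := hw.
have hu' := off_sq sep hu; have hg' := off_sq sep hg.
pose f r := rip ('i%C *: zero_ext I u r) (zero_ext I g r).
have fi : mu.-integrable setT (EFin \o f).
  by have := int_rip norm_ip (sqZ 'i%C hu') hg'; rewrite setTE.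
pose x n : R := a - 1 - n.+1%:R.
have bx n : x n + 1 < a by rewrite /x; have : 0 < n.+1%:R :> R by []; move: (n.+1%:R) => z; lra.
have xa n : x n <= a by have := bx n; lra.
have big (r : R) : exists N, forall n, (N <= n)%N -> x n + 1 < r.
  have [N hN] := natN (a - r); exists N => n /hN; rewrite /x -natr1; move: (n%:R) => z; lra.
have xI n r : x n <= r <= x n + 1 -> r \in I.
  by move=> /andP[_ h]; rewrite in_itv /=; exact: le_lt_trans h (bx n).
have tail h : mu.-integrable setT (EFin \o h) -> Int (x n) (x n + 1) h @[n --> \oo] --> (0 : R).
  move=> hi; rewrite -(Rintegral_set0 mu h); apply: Int_lim => // r.
  have [N hN] := big r; exists N => n /hN rx; split=> // /andP[_]; by rewrite leNgt rx.
have [c0 _] := energy_vanishes norm_ip sep hw uU cU en xI tail.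
have c1 : Int (x n) a f @[n --> \oo] --> \int[mu]_(r in `]-oo, a]%classic) f r.
  apply: Int_lim => // r; have [N hN] := big r; exists N => n /hN rx.
  have xr : x n <= r by move: rx; lra.
  by rewrite /= in_itv /= xr.
have E n : rnorm (U (x n)) ^+ 2 = rnorm (U a) ^+ 2 - 2 * Int (x n) a f.
  by have := en (x n) a (xa n); rewrite -/(Int (x n) a f) => <-; rewrite opprB addrC subrK.
have c2 : rnorm (U (x n)) ^+ 2 @[n --> \oo] --> rnorm (U a) ^+ 2 - 2 * \int[mu]_(r in `]-oo, a]%classic) f r.
  rewrite (funext E); apply: cvgB; first exact: cvg_cst.
  by apply: cvgM => //; exact: cvg_cst.
have : 0 = rnorm (U a) ^+ 2 - 2 * \int[mu]_(r in `]-oo, a]%classic) f r by exact: (cvg_unique _ c0 c2).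
have -> : \int[mu]_(r in `]-oo, a]%classic) f r = \int[mu]_(r in [set` I]) rip ('i%C *: u r) (g r).
  rewrite -int_off; apply/esym/Rintegral_subset => // r _ /= /negP; rewrite in_itv /= -ltNge => rb.
  by rewrite /zero_ext in_itv /= ltNge (ltW rb) /= rip0r.
by move=> /eqP; rewrite eq_sym subr_eq0 => /eqP.
Qed.

End RightLeft.

(** * The maximal operator *)

Section TestFunctions.
Context {R : realType} {H : completeNormedModType R[i]}.
Variable ip : {dot H for Num.conj}.
Hypothesis norm_ip : forall x : H, `|x| ^+ 2 = ip x x.
Hypothesis sep : exists D : set H, countable D /\ dense D.
Local Notation rip := (re_ip ip).
Local Notation mu := (@lebesgue_measure R).
Local Notation Int s t f := (\int[mu]_(r in `[s, t]%classic) f r).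
Variable A : set (H * H).
Hypothesis sA : selfadjoint ip A.
Variable I : interval R.
Local Notation sq := (@square_integrable R H I).
Local Notation rint := (re_rint ip I).
Local Notation int f := (mu.-integrable [set` I] (EFin \o f)).

(** Deliberately weaker than smoothness: [C^1] is all that integration by parts uses, and the real
    and imaginary parts of a [test_function] satisfy it. *)
Definition real_test (phi phi' : R -> R) := [/\ has_deriv phi phi', continuous phi' &
  exists p q, [/\ forall r, ~ (p <= r <= q) -> phi r = 0, forall r, ~ (p <= r <= q) -> phi' r = 0
    & forall r, p <= r <= q -> r \in I]].

Lemma deriv_off (phi phi' : R -> R) p q : has_deriv phi phi' ->
  (forall r, ~ (p <= r <= q) -> phi r = 0) -> forall r, ~ (p <= r <= q) -> phi' r = 0.
Proof.
move=> hphi h0 r hr.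
have near0 : \near r, 0 = phi r.
  move: hr => /negP; rewrite negb_and -!ltNge => /orP[rp|qr].
    near=> y; rewrite h0// => /andP[py _]; suff : y < p by rewrite ltNge py.
    by near: y; exact: (cvgr_lt r).
  near=> y; rewrite h0// => /andP[_ yq]; suff : q < y by rewrite ltNge yq.
  by near: y; exact: (cvgr_gt r).
have [_ d1] := near_eq_is_derive near0 (is_derive_cst (0 : R) r (1 : R)).
by have [_ <-] := hphi r.
Unshelve. all: by end_near. Qed.

Lemma rtest_diffn (phi phi' : R -> R) p q : (forall n, diffn n phi) -> has_deriv phi phi' ->
  (forall r, ~ (p <= r <= q) -> phi r = 0) -> (forall r, p <= r <= q -> r \in I) -> real_test phi phi'.
Proof.
move=> dphi hphi h0 hI; split=> //.
  have [d [hd [d' [hd' _]]]] := dphi 2%N.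
  by rewrite (deriv_uniq hphi hd); exact: has_deriv_cts hd'.
by exists p, q; split=> //; exact: deriv_off hphi h0.
Qed.

Lemma int_compact (h : R -> R) p q : continuous h -> (forall r, ~ (p <= r <= q) -> h r = 0) -> int h.
Proof.
move=> ch h0.
have i1 : mu.-integrable `[p, q]%classic (EFin \o h).
  apply: continuous_compact_integrable; first exact: segment_compact.
  exact: continuous_subspaceT.
have i2 : mu.-integrable setT (EFin \o h).
  have := (integrable_mkcond _ (measurable_segment p q)).1 i1; apply: eq_integrable => // r _.
  rewrite patchE; case: ifPn => // /negP hr; rewrite /= h0// => pq; apply: hr.
  by apply/mem_set; rewrite /= in_itv.
exact: (integrableS measurableT (measurable_Itv I) (@subsetT _ _) i2).
Qed.

Lemma sq_bump (psi : R -> R) f p q : continuous psi -> (forall r, ~ (p <= r <= q) -> psi r = 0) ->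
  sq (fun r => (psi r)%:C *: f).
Proof.
move=> cp p0; apply: int_sq.
  apply: (sm_scale norm_ip sep); last exact: sm_cst.
  by apply: measurable_funTS; exact: continuous_measurable_fun.
apply: (@int_compact _ p q); last first.
  by move=> r /p0 ->; rewrite scale0r rnorm0 expr0n.
have -> : (fun r => rnorm ((psi r)%:C *: f) ^+ 2) = (fun r => psi r * psi r * rnorm f ^+ 2).
  by apply/funext => r; rewrite rnormZR exprMn real_normK ?num_real// expr2.
by move=> r; apply: cvgM; [apply: cvgM; exact: cp|exact: cvg_cst].
Qed.

Definition test_vec (phi : R -> R) f (r : R) : H := (phi r)%:C *: f.
Definition test_img (phi phi' : R -> R) f h (r : R) : H := (phi' r)%:C *: ('i%C *: f) + (phi r)%:C *: h.

Lemma sq_T1 phi phi' f : real_test phi phi' -> sq (test_vec phi f).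
Proof. by move=> [hp _ [p [q [p0 _ _]]]]; apply: (sq_bump _ (has_deriv_cts hp) p0). Qed.

Lemma sq_T2 phi phi' f h : real_test phi phi' -> sq (test_img phi phi' f h).
Proof.
move=> [hp cp [p [q [p0 p'0 _]]]]; apply: sqD; first exact: (sq_bump _ cp p'0).
exact: (sq_bump _ (has_deriv_cts hp) p0).
Qed.

Local Notation pre := (preminimal I A).

Lemma maximalE : maximal_on ip I A = adjoint (L2_ip ip) pre.
Proof. by rewrite /maximal_on /minimal_on adjoint_closure//; exact: L2_inner. Qed.

Lemma pre_real phi phi' f h (P1 P2 : L2 H I) : (forall n, diffn n phi) -> has_deriv phi phi' ->
  (exists p q, (forall r, ~ (p <= r <= q) -> phi r = 0) /\ forall r, p <= r <= q -> r \in I) ->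
  A (f, h) -> represents P1 (test_vec phi f) -> represents P2 (test_img phi phi' f h) -> pre (P1, P2).
Proof.
move=> dphi hphi [p [q [p0 pI]]] Afh r1 r2.
exists 1%N, (fun _ t => (phi t)%:C), (fun=> f), (fun=> h); split=> /=.
- by move=> _; split=> //; exact: real_test_function dphi p0 pI.
- by apply: ae_sub r1 => t ht tI; rewrite big_ord1 ht.
- apply: ae_sub r2 => t ht tI; rewrite big_ord1 ht// /test_img; congr (_ + _).
  by rewrite (cderive_real _ hphi) scalerA mulrC.
Qed.

(** A single product [phi f] with real [phi] already lies in the preminimal domain; the real part of
    the adjoint relation for it is the weak equation. *)
Lemma maximal_weak (u g : L2 H I) : maximal_on ip I A (u, g) ->
  weak_sol ip A I (L2_repr u) (L2_repr g).
Proof.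
rewrite maximalE => hmax; split; [exact: L2_sq|exact: L2_sq|].
move=> f h phi phi' p q Afh dphi hphi p0 pI.
have rt := rtest_diffn dphi hphi p0 pI.
have [_ cphi' _] := rt; have p'0 := deriv_off hphi p0.
have s1 := sq_T1 f rt; have s2 := sq_T2 f h rt.
have hu := L2_sq u; have hg := L2_sq g.
have := hmax (toL2 s1, toL2 s2) (pre_real dphi hphi _ Afh (toL2_repr s1) (toL2_repr s2)).
move=> /(_ (ex_intro _ p (ex_intro _ q (conj p0 pI)))) /=.
rewrite (@L2_ipE _ _ _ norm_ip _ _ _ (L2_repr u) (test_img phi phi' f h)); try exact: represents_self;
  try exact: toL2_repr; try exact: sq_sm.
rewrite (@L2_ipE _ _ _ norm_ip _ _ _ (L2_repr g) (test_vec phi f)); try exact: represents_self;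
  try exact: toL2_repr; try exact: sq_sm.
move=> [E _].
have sX := sq_bump ('i%C *: f) cphi' p'0; have sY := sq_bump h (has_deriv_cts hphi) p0.
have E2 : rint (L2_repr u) (fun r => (phi' r)%:C *: ('i%C *: f)) =
    rint (L2_repr g) (test_vec phi f) - rint (L2_repr u) (fun r => (phi r)%:C *: h).
  apply/eqP; rewrite -E eq_sym subr_eq ![re_rint ip I (L2_repr u) _]rintC; apply/eqP.
  exact: (rintDl norm_ip sX sY hu).
have pqI : `[p, q]%classic `<=` [set` I].
  by move=> r /=; rewrite in_itv /=; exact: pI.
transitivity (rint (L2_repr u) (fun r => (phi' r)%:C *: ('i%C *: f))).
  rewrite /re_rint (Rintegral_subset pqI); last first.
    by move=> r _ /= nr; rewrite p'0 ?scale0r ?rip0r// => pr; apply: nr; rewrite in_itv.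
  by apply: eq_Rintegral => r _; rewrite ripZr mulrC.
have npq r : ~ `[p, q]%classic r -> phi r = 0.
  by move=> nr; apply: p0 => pr; apply: nr; rewrite /= in_itv.
have i1 := int_rip norm_ip hg s1; have i2 := int_rip norm_ip hu sY.
rewrite E2 /re_rint -(RintegralB (measurable_Itv I) i1 i2) (Rintegral_subset pqI); last first.
  by move=> r _ /npq h0; rewrite /test_vec h0 !scale0r !rip0r subrr.
by apply: eq_Rintegral => r _; rewrite /test_vec !ripZr; ring.
Qed.

Lemma test_function_parts phi : test_function I phi ->
  real_test (fun t => complex.Re (phi t)) (fun t => complex.Re (cderive phi t)) /\
  real_test (fun t => complex.Im (phi t)) (fun t => complex.Im (cderive phi t)).
Proof.
move=> [sr si ck cI].
have sm_d (f : R -> R) : smooth f -> has_deriv f (derive1 f) /\ continuous (derive1 f).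
  move=> sf; split=> [t|t].
    by apply: DeriveDef; [exact: (sf 0%N)|rewrite derive1E].
  apply/differentiable_continuous/derivable1_diffP; exact: (sf 1%N).
have [hr cr] := sm_d _ sr; have [hi ci] := sm_d _ si.
have [p [q [h0 hI]]] : exists p q, (forall r, ~ (p <= r <= q) -> phi r = 0) /\
    forall r, p <= r <= q -> r \in I.
  set K := closure _ in ck cI.
  have [K0|/set0P/negP/negPn/eqP Ke] := pselect (K !=set0); last first.
    (* The zero function has empty support, and the reversed bounds describe the empty segment. *)
    exists 1, 0; split=> r; last by move=> /andP[]; lra.
    move=> _; apply/eqP/negPn/negP => r0.
    suff : K r by rewrite Ke.
    exact: subset_closure.
  have cid : {within K, continuous (fun r : R => r)}.
    by apply: continuous_subspaceT => r; exact: cvg_id.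
  have [q Kq hq] := compact_EVT_max K0 ck cid.
  have [p Kp hp] := compact_EVT_min K0 ck cid.
  exists p, q; split=> r.
    move=> nr; apply/eqP/negPn/negP => r0; apply: nr.
    have Kr : r \in K by apply/mem_set; exact: subset_closure.
    by rewrite hp// hq.
  by apply: itv_convex; apply: cI; exact: set_mem.
split; (split=> //; exists p, q; split=> //).
- by move=> r /h0 ->.
- by apply: (deriv_off hr) => r /h0 /= ->.
- by move=> r /h0 ->.
- by apply: (deriv_off hi) => r /h0 /= ->.
Qed.

End TestFunctions.

(** * A criterion for membership in the maximal operator *)

Section MaximalCriterion.
Context {R : realType} {H : completeNormedModType R[i]}.
Variable ip : {dot H for Num.conj}.
Hypothesis norm_ip : forall x : H, `|x| ^+ 2 = ip x x.
Hypothesis sep : exists D : set H, countable D /\ dense D.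
Local Notation rip := (re_ip ip).
Local Notation mu := (@lebesgue_measure R).
Local Notation Int s t f := (\int[mu]_(r in `[s, t]%classic) f r).
Variable A : set (H * H).
Hypothesis sA : selfadjoint ip A.
Variable I : interval R.
Local Notation sq := (@square_integrable R H I).
Local Notation rint := (re_rint ip I).
Local Notation int f := (mu.-integrable [set` I] (EFin \o f)).

Lemma sq_sum n (F : 'I_n -> R -> H) : (forall j, sq (F j)) -> sq (fun r => \sum_(j < n) F j r).
Proof.
elim: n F => [|n IH] F hF.
  have := @sq0 R H I; congr square_integrable; apply/funext => r; by rewrite big_ord0.
have := sqD (hF ord0) (IH (fun j => F (lift ord0 j)) (fun j => hF _)).
by congr square_integrable; apply/funext => r; rewrite big_ord_recl.
Qed.

Lemma rint_sum n (F : 'I_n -> R -> H) u : (forall j, sq (F j)) -> sq u ->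
  rint u (fun r => \sum_(j < n) F j r) = \sum_(j < n) rint u (F j).
Proof.
move=> + hu; elim: n F => [|n IH] F hF.
  rewrite big_ord0 /re_rint; under eq_Rintegral do rewrite big_ord0 rip0r.
  by rewrite /Rintegral integral0.
rewrite big_ord_recl -(IH (fun j => F (lift ord0 j)))//.
have := rintDl norm_ip (hF ord0) (sq_sum (fun j => hF (lift ord0 j))) hu.
rewrite ![re_rint ip I u _]rintC => <-.
by apply: eq_Rintegral => r _; rewrite big_ord_recl.
Qed.

Lemma rintDr f g h : sq f -> sq g -> sq h -> rint f (fun t => g t + h t) = rint f g + rint f h.
Proof. by move=> hf hg hh; rewrite rintC (rintDl norm_ip)// ![re_rint ip I _ f]rintC. Qed.

(** A complex test function splits as [phi f = (Re phi) f + (Im phi) ('i f)] and the domain of [A]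
    is stable under ['i], so real test functions suffice. The extra scalar [c], equal to 1 or ['i],
    yields the real and the imaginary part of the inner product. *)
Lemma max_crit (U G : L2 H I) u g : sq u -> sq g -> represents U u -> represents G g ->
  (forall phi phi' f h, real_test I phi phi' -> A (f, h) ->
     rint u (test_img phi phi' f h) = rint g (test_vec phi f)) -> maximal_on ip I A (U, G).
Proof.
move=> hu hg rU rG crit; rewrite (maximalE norm_ip) => q [n [phi [f [h [hj r1 r2]]]]] /=.
pose al j t := complex.Re (phi j t); pose be j t := complex.Im (phi j t).
pose al' j t := complex.Re (cderive (phi j) t); pose be' j t := complex.Im (cderive (phi j) t).
have ta j : real_test I (al j) (al' j) by have [/test_function_parts[]] := hj j.
have tb j : real_test I (be j) (be' j) by have [/test_function_parts[]] := hj j.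
pose S1 (c : R[i]) j r := test_vec (al j) (c *: f j) r + test_vec (be j) (c *: ('i%C *: f j)) r.
pose S2 (c : R[i]) j r := test_img (al j) (al' j) (c *: f j) (c *: h j) r +
  test_img (be j) (be' j) (c *: ('i%C *: f j)) (c *: ('i%C *: h j)) r.
have s1 c j : sq (S1 c j).
  by apply: sqD; [exact: (sq_T1 norm_ip sep _ (ta j))|exact: (sq_T1 norm_ip sep _ (tb j))].
have s2 c j : sq (S2 c j).
  by apply: sqD; [exact: (sq_T2 norm_ip sep _ _ (ta j))|exact: (sq_T2 norm_ip sep _ _ (tb j))].
have E1 c r : c *: (\sum_(j < n) phi j r *: f j) = \sum_(j < n) S1 c j r.
  rewrite scaler_sumr; apply: eq_bigr => j _; rewrite /S1 /test_vec {1}(complexE (phi j r)).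
  rewrite !scalerA -scalerDl; congr (_ *: _); rewrite /al /be; ring.
have E2 c r : c *: (\sum_(j < n) (('i%C * cderive (phi j) r) *: f j + phi j r *: h j)) =
    \sum_(j < n) S2 c j r.
  rewrite scaler_sumr; apply: eq_bigr => j _; rewrite /S2 /test_img addrACA scalerDr; congr (_ + _).
    rewrite {1}(complexE (cderive (phi j) r)) !scalerA -scalerDl; congr (_ *: _); rewrite /al' /be'; ring.
  rewrite {1}(complexE (phi j r)) !scalerA -scalerDl; congr (_ *: _); rewrite /al /be; ring.
have key c : rint u (fun r => \sum_(j < n) S2 c j r) = rint g (fun r => \sum_(j < n) S1 c j r).
  rewrite !rint_sum//; apply: eq_bigr => j _; rewrite /S2 /S1.
  have [_ Aj] := hj j.
  have a1 := sadjZ sA c Aj; have a2 := sadjZ sA c (sadjZ sA 'i%C Aj).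
  have t1 := sq_T1 norm_ip sep (c *: f j) (ta j).
  have t2 := sq_T1 norm_ip sep (c *: ('i%C *: f j)) (tb j).
  have t3 := sq_T2 norm_ip sep (c *: f j) (c *: h j) (ta j).
  have t4 := sq_T2 norm_ip sep (c *: ('i%C *: f j)) (c *: ('i%C *: h j)) (tb j).
  by rewrite (rintDr hu t3 t4) (rintDr hg t1 t2) (crit _ _ _ _ (ta j) a1) (crit _ _ _ _ (tb j) a2).
have r1' : represents q.1 (fun r => \sum_(j < n) S1 1 j r).
  by apply: ae_sub r1 => t ht tI; rewrite ht// -E1 scale1r.
have r2' : represents q.2 (fun r => \sum_(j < n) S2 1 j r).
  by apply: ae_sub r2 => t ht tI; rewrite ht// -E2 scale1r.
have q1 c := sq_sum (s1 c); have q2 c := sq_sum (s2 c).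
rewrite (@L2_ipE _ _ _ norm_ip _ _ _ u (fun r => \sum_(j < n) S2 1 j r))//; try exact: sq_sm.
rewrite (@L2_ipE _ _ _ norm_ip _ _ _ g (fun r => \sum_(j < n) S1 1 j r))//; try exact: sq_sm.
rewrite key; congr (_ +i* _).
have -> : (fun t => 'i%C *: (\sum_(j < n) S2 1 j t)) = (fun t => \sum_(j < n) S2 'i%C j t).
  by apply/funext => t; rewrite -!E2 scale1r.
have -> : (fun t => 'i%C *: (\sum_(j < n) S1 1 j t)) = (fun t => \sum_(j < n) S1 'i%C j t).
  by apply/funext => t; rewrite -!E1 scale1r.
exact: key.
Qed.

(* If <u, i f> is C^1 with the derivative demanded by i u' + A u = g for all f in D(A), then
   integration by parts against test functions leaves no boundary terms. *)
Lemma c1_crit u g phi phi' f h : sq u -> sq g -> real_test I phi phi' ->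
  has_deriv (fun r => rip (u r) ('i%C *: f)) (fun r => rip (u r) h - rip (g r) f) ->
  continuous (fun r => rip (u r) h - rip (g r) f) ->
  rint u (test_img phi phi' f h) = rint g (test_vec phi f).
Proof.
move=> hu hg rt dz cz; have [hp cp [p [q [p0 p'0 pI]]]] := rt.
pose z r := rip (u r) ('i%C *: f); pose z' r := rip (u r) h - rip (g r) f.
have i1 := int_rip norm_ip hu (sq_T2 norm_ip sep f h rt).
have i2 := int_rip norm_ip hg (sq_T1 norm_ip sep f rt).
apply/eqP; rewrite -subr_eq0 /re_rint -(RintegralB (measurable_Itv I) i1 i2); apply/eqP.
pose F r := phi' r * z r + phi r * z' r.
transitivity (\int[mu]_(r in [set` I]) F r).
  by apply: eq_Rintegral => r _; rewrite /test_img /test_vec /F /z /z' ripDr !ripZr; ring.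
have F0 r : ~ (p <= r <= q) -> F r = 0 by move=> hr; rewrite /F p0// p'0// !mul0r addr0.
rewrite (@Rintegral_subset _ `[p, q]%classic); last 2 first.
- by move=> r /=; rewrite in_itv /=; exact: pI.
- by move=> r _ /= nr; apply: F0 => pr; apply: nr; rewrite in_itv.
(* The segment [[p, q]] may be empty or a single point; the enlarged one is proper and its end
   points lie outside the support, so the boundary terms vanish. *)
pose p' := p - 1; pose q' := Num.max p q + 1.
have pp : p < q' by rewrite /q' ltr_pwDr// le_max lexx.
have pq : p' < q' by apply: lt_trans pp; rewrite /p'; lra.
have qq : q < q' by rewrite /q' ltr_pwDr// le_max lexx orbT.
rewrite -(@Rintegral_subset _ _ `[p', q']%classic); last 2 first.
- move=> r /=; rewrite !in_itv /= => /andP[h1 h2]; rewrite (le_trans h2 (ltW qq)) andbT.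
  by rewrite /p'; lra.
- by move=> r _ /= nr; apply: F0 => pr; apply: nr; rewrite in_itv.
have dF : has_deriv (fun r => phi r * z r) F by exact: has_derivM.
have cF : continuous F.
  by move=> r; apply: cvgD; apply: cvgM; [exact: cp|exact: (has_deriv_cts dz)|exact: (has_deriv_cts hp)|exact: cz].
rewrite /Rintegral (@continuous_FTC2 _ F (fun r => phi r * z r))//.
- rewrite (p0 q'); last by move=> /andP[_]; rewrite leNgt qq.
  rewrite (p0 p'); last by rewrite /p' => /andP[]; lra.
  by rewrite /= !mul0r subr0.
- exact: continuous_subspaceT.
- have c := has_deriv_cts dF; split.
  + by move=> r _; have [] := dF r.
  + by apply: cvg_at_right_filter; exact: c.
  + by apply: cvg_at_left_filter; exact: c.
- by move=> r _; rewrite (has_derivE dF).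
Qed.

End MaximalCriterion.

(** * Surjectivity of the trace *)

Section PoissonWeights.
Context {R : realType}.
Implicit Types s t : R.

(** The Poisson probabilities with mean [s]. For [s >= 0] they are nonnegative with partial sums at
    most 1, so sums of contractions weighted by them do not increase norms. *)
Definition poisson_weight (k : nat) (s : R) : R := expR (- s) * exp_coeff s k.

Lemma exp_coeff_ge0' s k : 0 <= s -> 0 <= exp_coeff s k.
Proof. by move=> s0; rewrite /exp_coeff /= divr_ge0// exprn_ge0. Qed.

Lemma poisw_ge0 k s : 0 <= s -> 0 <= poisson_weight k s.
Proof. by move=> s0; rewrite /poisson_weight mulr_ge0 ?expR_ge0// exp_coeff_ge0'. Qed.

Lemma poisw_sum N s : 0 <= s -> \sum_(k < N) poisson_weight k s <= 1.
Proof.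
move=> s0; rewrite -mulr_sumr expRN mulrC ler_pdivrMr ?expR_gt0// mul1r.
have -> : \sum_(k < N) exp_coeff s k = series (exp_coeff s) N by rewrite /series /= big_mkord.
rewrite /expR; apply: (@nondecreasing_cvgn_le _ (series (exp_coeff s))); last exact: is_cvg_series_exp_coeff.
by apply/nondecreasing_seqP => n; rewrite /series /= big_nat_recr//= lerDl exp_coeff_ge0'.
Qed.

Lemma poisw_0 k : poisson_weight k 0 = (k == 0%N)%:R.
Proof.
rewrite /poisson_weight oppr0 expR0 mul1r /exp_coeff /= expr0n; case: k => [|k] /=.
  by rewrite fact0 divr1.
by rewrite mul0r.
Qed.

(** The exponential coefficients increase with [s], and those at [S] tend to 0, so one index serves
    all [s] up to [S]. This weight controls the truncation term of [poisson_telescope]. *)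
Lemma poisw_small S e : 0 <= S -> 0 < e -> exists N, forall s, 0 <= s -> s <= S -> poisson_weight N s < e.
Proof.
move=> S0 e0; have /cvg_series_cvg_0/cvgrPdist_lt/(_ _ e0)[N _ hN] := @is_cvg_series_exp_coeff R S.
exists N => s s0 sS; have := hN N (leqnn N); rewrite /= sub0r normrN ger0_norm ?exp_coeff_ge0'//.
apply: le_lt_trans; rewrite /poisson_weight -[leRHS]mul1r; apply: ler_pM; rewrite ?expR_ge0 ?exp_coeff_ge0'//.
  by rewrite -[leRHS]expR0 ler_expR; lra.
by rewrite /exp_coeff /= ler_pM2r ?invr_gt0 ?ltr0n ?fact_gt0// lerXn2r ?nnegrE.
Qed.

Definition poisson_weight_deriv (k : nat) s : R := (if k is k'.+1 then poisson_weight k' s else 0) - poisson_weight k s.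

Lemma poisw_deriv k : has_deriv (poisson_weight k) (poisson_weight_deriv k).
Proof.
have hE : has_deriv (fun s : R => expR (- s)) (fun s => - expR (- s)).
  have he : has_deriv (@expR R) expR by move=> t; exact: is_derive_expR.
  have := has_deriv_affine (-1) 0 he.
  congr has_deriv; apply/funext => s; rewrite mulN1r addr0//.
  by rewrite mulN1r.
have hX : has_deriv (fun s : R => exp_coeff s k) (fun s => if k is k'.+1 then exp_coeff s k' else 0).
  elim: k => [|k IH].
    have := @has_deriv_cst R 1; congr has_deriv; apply/funext => s.
    by rewrite /exp_coeff /= expr0 fact0 divr1.
  have h := has_derivM (has_derivM (@has_deriv_id R) IH) (has_deriv_cst (k.+1%:R^-1)).
  have -> : (fun s : R => exp_coeff s k.+1) = (fun s => s * exp_coeff s k * k.+1%:R^-1).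
    apply/funext => s; rewrite /exp_coeff /= factS natrM exprS invfM; ring.
  apply: (has_deriv_eq h) => s; rewrite mulr0 addr0 mul1r.
  have kn : k.+1%:R != 0 :> R by rewrite pnatr_eq0.
  case: k {IH h} kn => [|k] kn; first by rewrite mulr0 addr0 invr1 mulr1.
  have -> : s * exp_coeff s k = k.+1%:R * exp_coeff s k.+1.
    have k1 : k.+1%:R != 0 :> R by rewrite pnatr_eq0.
    have k2 : k`!%:R != 0 :> R by rewrite pnatr_eq0 -lt0n fact_gt0.
    rewrite /exp_coeff /= factS natrM exprS invfM; move: (k.+1%:R : R) k1 => z z0.
    have -> : z * (s * s ^+ k * (z^-1 * k`!%:R^-1)) = (z * z^-1) * (s * (s ^+ k * k`!%:R^-1)) by ring.
    by rewrite mulfV ?mul1r.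
  have -> : exp_coeff s k.+1 + k.+1%:R * exp_coeff s k.+1 = k.+2%:R * exp_coeff s k.+1.
    by rewrite -[in RHS]nat1r; ring.
  by rewrite mulrAC mulfV// mul1r.
apply: (has_deriv_eq (has_derivM hE hX)) => s.
by rewrite /poisson_weight_deriv /poisson_weight; case: k {hX} => [|k]; ring.
Qed.

End PoissonWeights.

(** * Classical solutions and their sums *)

Section ClassicalSolutions.
Context {R : realType} {H : completeNormedModType R[i]}.
Variable ip : {dot H for Num.conj}.
Hypothesis norm_ip : forall x : H, `|x| ^+ 2 = ip x x.
Local Notation rip := (re_ip ip).
Variable A : set (H * H).
Hypothesis sA : selfadjoint ip A.

Lemma ctsD (u v : R -> H) : cts_fun u -> cts_fun v -> cts_fun (fun t => u t + v t).
Proof.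
move=> cu cv t e e0; have e2 : 0 < e / 2 by rewrite divr_gt0.
have [r r0 hr] := cu t _ e2; have [q q0 hq] := cv t _ e2.
exists (Num.min r q); first by rewrite lt_min r0 q0.
move=> s; rewrite lt_min => /andP[/hr h1 /hq h2].
have -> : u t + v t - (u s + v s) = (u t - u s) + (v t - v s) by rewrite opprD addrACA.
by apply: le_lt_trans (rnormD _ _) _; lra.
Qed.

Lemma cts_scale (w : R -> R) (x : H) : continuous w -> cts_fun (fun t => (w t)%:C *: x).
Proof.
move=> cw t e e0; have k0 : 0 < rnorm x + 1 by have := rnorm_ge0 x; lra.
have /cvgrPdist_lt/(_ (e / (rnorm x + 1))) := cw t.
rewrite divr_gt0// => /(_ isT)/nbhs_normP[r /= r0 hr].
exists r => // s ts; have := hr s ts.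
rewrite ltr_pdivlMr// -scalerBl -rmorphB rnormZR mulrDr mulr1; apply: le_lt_trans.
by rewrite lerDl.
Qed.

Lemma cts_sum n (u : 'I_n -> R -> H) : (forall j, cts_fun (u j)) -> cts_fun (fun t => \sum_(j < n) u j t).
Proof.
elim: n u => [|n IH] u hu t e e0.
  by exists 1 => // s _; rewrite !big_ord0 subrr rnorm0.
have [r r0 hr] := ctsD (hu ord0) (IH (fun j => u (lift ord0 j)) (fun j => hu _)) t e0.
by exists r => // s /hr; rewrite !big_ord_recl.
Qed.

Lemma cts_rip (u : R -> H) f : cts_fun u -> continuous (fun t => rip (u t) f).
Proof.
move=> cu t; apply/cvgrPdist_lt => e e0; have k0 : 0 < rnorm f + 1 by have := rnorm_ge0 f; lra.
have [|r r0 hr] := cu t (e / (rnorm f + 1)); first by rewrite divr_gt0.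
apply/nbhs_normP; exists r => //= s /hr; rewrite ltr_pdivlMr// -ripBl; apply: le_lt_trans.
apply: le_trans (rip_CS norm_ip _ _) _; apply: ler_wpM2l; first exact: rnorm_ge0.
lra.
Qed.

(** The equation [i u' + A u = g] with [A] moved to the test vector: stable under finite sums, and
    of the form that [c1_crit] takes. *)
Definition classical_sol (u g : R -> H) := [/\ cts_fun u, cts_fun g &
  forall f h, A (f, h) -> has_deriv (fun r => rip (u r) ('i%C *: f)) (fun r => rip (u r) h - rip (g r) f)].

Lemma classicalD u g v k : classical_sol u g -> classical_sol v k ->
  classical_sol (fun t => u t + v t) (fun t => g t + k t).
Proof.
move=> [cu cg du] [cv ck dv]; split; [exact: ctsD|exact: ctsD|] => f h Afh.
have := has_derivD (du _ _ Afh) (dv _ _ Afh).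
have -> : (fun t => rip (u t) ('i%C *: f) + rip (v t) ('i%C *: f)) = (fun r => rip (u r + v r) ('i%C *: f)).
  by apply/funext => t; rewrite ripDl.
by move=> h0; apply: has_deriv_eq h0 _ => t; rewrite !ripDl; ring.
Qed.

Lemma classical0 : classical_sol (fun=> 0) (fun=> 0).
Proof.
have c0 : cts_fun (fun=> 0 : H) by move=> t e e0; exists 1 => // s _; rewrite subrr rnorm0.
split=> // f h _; have := @has_deriv_cst R 0.
have -> : (fun=> 0 : R) = (fun _ : R => rip 0 ('i%C *: f)) by apply/funext => t; rewrite rip0l.
by move=> h0; apply: has_deriv_eq h0 _ => t; rewrite !rip0l subrr.
Qed.

Lemma classical_elem (w w' : R -> R) x z : A (x, z) -> has_deriv w w' -> continuous w' ->
  classical_sol (fun t => (w t)%:C *: x) (fun t => (w t)%:C *: z + (w' t)%:C *: ('i%C *: x)).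
Proof.
move=> Axz dw cw'; have cw := has_deriv_cts dw.
split; [exact: cts_scale|by apply: ctsD; exact: cts_scale|] => f h Afh.
have := has_derivM dw (has_deriv_cst (rip x ('i%C *: f))).
have -> : (fun t => w t * rip x ('i%C *: f)) = (fun r => rip ((w r)%:C *: x) ('i%C *: f)).
  by apply/funext => t; rewrite ripZl.
move=> h0; apply: has_deriv_eq h0 _ => t; rewrite ripDl !ripZl (sadj_rsym sA Axz Afh) ripiC; ring.
Qed.

Lemma classical_sum n (u g : 'I_n -> R -> H) : (forall j, classical_sol (u j) (g j)) ->
  classical_sol (fun t => \sum_(j < n) u j t) (fun t => \sum_(j < n) g j t).
Proof.
elim: n u g => [|n IH] u g hu.
  have := classical0; congr classical_sol; apply/funext => t; by rewrite big_ord0.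
have := classicalD (hu ord0) (IH (fun j => u (lift ord0 j)) (fun j => g (lift ord0 j)) (fun j => hu _)).
by congr classical_sol; apply/funext => t; rewrite big_ord_recl.
Qed.

End ClassicalSolutions.

(** * Approximate solutions with a prescribed value *)

Section ApproximateSolution.
Context {R : realType} {H : completeNormedModType R[i]}.
Variable ip : {dot H for Num.conj}.
Hypothesis norm_ip : forall x : H, `|x| ^+ 2 = ip x x.
Variable A : set (H * H).
Hypothesis sA : selfadjoint ip A.
Local Notation J d := (resolv A d).

Lemma rnorm_sum n (F : 'I_n -> H) : rnorm (\sum_(j < n) F j) <= \sum_(j < n) rnorm (F j).
Proof.
elim: n F => [|n IH] F; first by rewrite !big_ord0 rnorm0.
by rewrite !big_ord_recl; apply: le_trans (rnormD _ _) _; rewrite lerD2l.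
Qed.

(** All four facts propagate by applying the contraction [J], which commutes with [A]. The last one
    is [J - 1 = i d A J] in the form that the telescoping sum needs. *)
Lemma iter_J d k x z : d != 0 -> A (x, z) ->
  [/\ A (iter k (J d) x, iter k (J d) z), rnorm (iter k (J d) x) <= rnorm x,
    rnorm (iter k (J d) z - iter k.+1 (J d) z) <= rnorm (z - J d z) &
    'i%C *: iter k.+1 (J d) x = 'i%C *: iter k (J d) x - d%:C *: iter k.+1 (J d) z].
Proof.
move=> d0 Axz; elim: k => [|k [Ak xk zk ik]] /=.
  split=> //; rewrite -(Jr_comm norm_ip sA d0 Axz) /resolv_img scalerA.
  have -> : d%:C * (d%:C * 'i%C)^-1 = - 'i%C :> R[i].
    have di := di_neq0 d0; apply: (mulIf di); rewrite -mulrA mulVf// mulr1 mulNr mulrC -mulrA -expr2 sqr_i.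
    by rewrite mulrN1 opprK.
  by rewrite scaleNr opprK scalerBr addrC subrK.
split.
- have := JrP norm_ip sA (iter k (J d) x) d0.
  by rewrite (Jr_comm norm_ip sA d0 Ak).
- exact: le_trans (Jr_norm norm_ip sA _ d0) xk.
- rewrite -(JrB norm_ip sA _ _ d0); apply: le_trans zk; exact: (Jr_norm norm_ip sA _ d0).
- by have := congr1 (J d) ik; rewrite (JrB norm_ip sA _ _ d0) !(JrZ norm_ip sA _ _ d0).
Qed.

(* Abel summation of the telescoping weights: the Poisson weights solve p_k' = p_(k-1) - p_k,
   so all but the last term of d^-1 p_k' i J^k x cancel against p_k J^k z up to z - J z. *)
Lemma poisson_telescope d N x z (c c' : R) (s : R) : d != 0 -> A (x, z) ->
  let X k := iter k (J d) x in let Z k := iter k (J d) z in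
  \sum_(k < N.+1) ((c * poisson_weight k s)%:C *: Z k +
    (c' * poisson_weight k s + c * (d^-1 * poisson_weight_deriv k s))%:C *: ('i%C *: X k)) =
  \sum_(k < N.+1) ((c * poisson_weight k s)%:C *: (Z k - Z k.+1) + (c' * poisson_weight k s)%:C *: ('i%C *: X k))
  - (c * d^-1 * poisson_weight N s)%:C *: ('i%C *: X N.+1).
Proof.
move=> d0 Axz X Z.
have E k : 'i%C *: X k.+1 = 'i%C *: X k - d%:C *: Z k.+1 by have [] := iter_J k d0 Axz.
have key k : (c * poisson_weight k s)%:C *: Z k.+1 + (c * d^-1 * poisson_weight k s)%:C *: ('i%C *: X k.+1) =
    (c * d^-1 * poisson_weight k s)%:C *: ('i%C *: X k).
  rewrite E scalerBr [_%:C *: (d%:C *: _)]scalerA -rmorphM.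
  have -> : c * d^-1 * poisson_weight k s * d = c * poisson_weight k s by rewrite mulrAC mulfVK.
  by rewrite addrC subrK.
(* Pure rearrangement of sums: the hypothesis [b + w = y] stands for [key], which absorbs the index
   shift. *)
have ac (S w0 a e y b w : H) : b + w = y ->
    S - w0 + (a + (e + (w0 - y))) = S + (a - b + e) - w.
  move=> <-; rewrite -!addrA; congr (_ + _).
  by rewrite (addrCA (- w0)) (addrCA (- w0)) addKr opprD [in LHS](addrCA e).
have ac0 (a e y b w : H) : b + w = y -> a + (e - y) = (a - b + e) - w.
  by move=> h; have := ac 0 0 a e y b w h; rewrite subr0 !add0r.
elim: N => [|N IH].
  rewrite !big_ord_recl !big_ord0 !addr0 scalerBr rmorphD scalerDl -(ac0 _ _ _ _ _ (key 0%N)).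
  congr (_ + (_ + _)); rewrite -scaleNr -rmorphN; congr (_%:C *: _); rewrite /poisson_weight_deriv /= sub0r; ring.
rewrite big_ord_recr IH [in RHS]big_ord_recr /= scalerBr rmorphD scalerDl.
rewrite -(ac _ ((c * d^-1 * poisson_weight N s)%:C *: ('i%C *: X N.+1)) _ _ _ _ _ (key N.+1)); congr (_ + (_ + (_ + _))).
by rewrite -scalerBl -rmorphB; congr (_%:C *: _); rewrite /poisson_weight_deriv; ring.
Qed.

Variables (c : R) (chi chi' : R -> R) (M : R).
Hypothesis dchi : has_deriv chi chi'.
Hypothesis cchi' : continuous chi'.
Hypothesis chi01 : forall t, 0 <= chi t <= 1.
Hypothesis chic : chi c = 1.
Hypothesis chi0 : forall t, ~ (`|t - c| <= 1) -> chi t = 0 /\ chi' t = 0.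
Hypothesis chiM : forall t, `|chi' t| <= M.

Lemma poisw_cts k : continuous (@poisson_weight R k).
Proof. exact: has_deriv_cts (poisw_deriv k). Qed.

(** Untruncated, the series is the exponential of [((t - c) / d) (J_d - 1)] applied to [x], and
    [(J_d - 1) / d] is the Yosida approximation [i A J_d]. Cut off at [N] and multiplied by [chi],
    it leaves a source with three parts: the derivative of [chi], at most [M |x|], the resolvent
    error [z - J z], at most [eta / 2], and the truncation, at most [eta / 2]. *)
Lemma approx_solution (sg : R) x z eta : sg = 1 \/ sg = -1 -> A (x, z) -> 0 < eta ->
  exists v g, [/\ classical_sol ip A v g, v c = x,
    forall t, 0 <= sg * (t - c) -> rnorm (v t) <= rnorm x /\ rnorm (g t) <= M * rnorm x + eta &
    forall t, ~ (`|t - c| <= 1) -> v t = 0 /\ g t = 0].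
Proof.
move=> sgE Axz eta0.
have sg2 : sg * sg = 1 by case: sgE => ->; rewrite ?mulr1 ?mulrNN ?mulr1.
have sgn : `|sg| = 1 by case: sgE => ->; rewrite ?normrN normr1.
have e2 : 0 < eta / 2 by rewrite divr_gt0.
have [dl dl0 hdl] := Jr_cvg norm_ip sA z e2.
pose de := dl / 2; have de0 : 0 < de by rewrite divr_gt0.
have dedl : de < dl by rewrite /de; lra.
(* This sign makes the Poisson parameter [(t - c) / d] nonnegative on the side of [c] selected by
   [sg]. *)
pose d := sg * de.
have dE : `|d| = de by rewrite normrM sgn mul1r gtr0_norm.
have d0 : d != 0 by rewrite -normr_gt0 dE.
have Jz : rnorm (z - J d z) <= eta / 2 by rewrite rnormBC ltW// hdl// dE.
have dV : d^-1 = sg * de^-1.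
  by rewrite /d invfM; congr (_ * _); apply: (mulfI (_ : sg != 0)); rewrite ?mulfV ?sg2// -normr_gt0 sgn.
have k0 : 0 < rnorm x + 1 by have := rnorm_ge0 x; lra.
(* The tolerance brings the left-over term, whose factor is [1 / de] and whose vector has norm at
   most [|x|], below [eta / 2]. Only parameters up to [1 / de] occur, since [chi] vanishes for
   [|t - c| > 1]. *)
have [N hN] : exists N, forall s, 0 <= s -> s <= de^-1 -> poisson_weight N s < eta / 2 * de / (rnorm x + 1).
  by apply: poisw_small; [rewrite invr_ge0 ltW|rewrite divr_gt0// mulr_gt0].
pose s t := d^-1 * t + - (d^-1 * c).
have sE t : s t = sg * (t - c) * de^-1 by rewrite /s dV; ring.
pose w k t := chi t * poisson_weight k (s t).
pose w' k t := chi' t * poisson_weight k (s t) + chi t * (d^-1 * poisson_weight_deriv k (s t)).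
have dw k : has_deriv (w k) (w' k).
  have := has_deriv_affine d^-1 (- (d^-1 * c)) (poisw_deriv k).
  exact: has_derivM dchi.
have cs : continuous s.
  by move=> t; apply: cvgD; [apply: cvgM; [exact: cvg_cst|exact: cvg_id]|exact: cvg_cst].
have cp k : continuous (fun t => poisson_weight k (s t)).
  by move=> t; apply: (continuous_comp (cs t)); exact: poisw_cts.
have cd k : continuous (fun t => poisson_weight_deriv k (s t)).
  move=> t; rewrite /poisson_weight_deriv; apply: cvgB; last exact: cp.
  by case: k => [|k]; [exact: cvg_cst|exact: cp].
have cw' k : continuous (w' k).
  move=> t; apply: cvgD; apply: cvgM; [exact: cchi'|exact: cp|exact: (has_deriv_cts dchi)|].
  by apply: cvgM; [exact: cvg_cst|exact: cd].
pose X k := iter k (J d) x; pose Z k := iter k (J d) z.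
pose v t := \sum_(k < N.+1) (w k t)%:C *: X k.
pose g t := \sum_(k < N.+1) ((w k t)%:C *: Z k + (w' k t)%:C *: ('i%C *: X k)).
have AX k : A (X k, Z k) by have [] := iter_J k d0 Axz.
have nX k : rnorm (X k) <= rnorm x by have [] := iter_J k d0 Axz.
have nZ k : rnorm (Z k - Z k.+1) <= eta / 2.
  by have [_ _ h _] := iter_J k d0 Axz; exact: le_trans h Jz.
have off t : ~ (`|t - c| <= 1) -> v t = 0 /\ g t = 0.
  move=> /chi0[c0 c'0]; split; [rewrite /v|rewrite /g]; rewrite big1// => k _;
    rewrite /w /w' c0 ?c'0 !mul0r ?addr0 !scale0r//.
  by rewrite addr0.
have x0 := rnorm_ge0 x.
have M0 : 0 <= M by apply: le_trans (chiM c); exact: normr_ge0.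
exists v, g; split=> //.
- by apply: classical_sum => k; exact: (classical_elem sA).
- rewrite /v big_ord_recl big1 ?addr0 => [|k _].
    by rewrite /w chic sE subrr mulr0 mul0r poisw_0 mulr1 scale1r.
  by rewrite /w chic sE subrr mulr0 mul0r poisw_0 mulr0 scale0r.
move=> t tc; have [t1|/off[-> ->]] := pselect (`|t - c| <= 1); last first.
  by rewrite rnorm0; split=> //; rewrite addr_ge0 ?mulr_ge0// ltW.
have s0 : 0 <= s t by rewrite sE mulr_ge0// invr_ge0 ltW.
have s1 : s t <= de^-1.
  rewrite sE ler_piMl ?invr_ge0 ?(ltW de0)//; apply: (le_trans _ t1).
  by rewrite -[leRHS]mul1r -sgn -normrM; exact: ler_norm.
have p0 k := poisw_ge0 k s0; have ps := poisw_sum N.+1 s0.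
have /andP[c0 c1] := chi01 t.
have sumle B (F : nat -> H) : 0 <= B -> (forall k, rnorm (F k) <= poisson_weight k (s t) * B) ->
    rnorm (\sum_(k < N.+1) F k) <= B.
  move=> B0 hF; apply: le_trans (rnorm_sum _) _.
  apply: (@le_trans _ _ (\sum_(k < N.+1) poisson_weight k (s t) * B)); first by apply: ler_sum => k _.
  by rewrite -mulr_suml ler_piMl.
split.
  apply: (sumle _ (fun k => (w k t)%:C *: X k)) => // k; rewrite rnormZR /w (ger0_norm (mulr_ge0 c0 (p0 k))).
  by apply: ler_pM; [exact: mulr_ge0|exact: rnorm_ge0|exact: ler_piMl|].
have -> : g t = \sum_(k < N.+1) ((chi t * poisson_weight k (s t))%:C *: (Z k - Z k.+1) +
    (chi' t * poisson_weight k (s t))%:C *: ('i%C *: X k)) - (chi t * d^-1 * poisson_weight N (s t))%:C *: ('i%C *: X N.+1).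
  exact: poisson_telescope.
apply: le_trans (rnormD _ _) _; rewrite rnormN.
have -> : M * rnorm x + eta = (eta / 2 + M * rnorm x) + eta / 2 by field.
apply: lerD.
  apply: (sumle _ (fun k => (chi t * poisson_weight k (s t))%:C *: (Z k - Z k.+1) +
    (chi' t * poisson_weight k (s t))%:C *: ('i%C *: X k))) => [|k].
    by rewrite addr_ge0 ?mulr_ge0// ltW.
  apply: le_trans (rnormD _ _) _; rewrite !rnormZR rnormi (normrM (chi t)) (normrM (chi' t)) mulrDr; apply: lerD.
    rewrite (ger0_norm (p0 k)) (ger0_norm c0).
    by apply: ler_pM; [exact: mulr_ge0|exact: rnorm_ge0|exact: ler_piMl|].
  rewrite (ger0_norm (p0 k)) (mulrC `|_|) -mulrA; apply: ler_wpM2l => //.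
  by apply: ler_pM; rewrite ?rnorm_ge0.
rewrite rnormZR rnormi (normrM (chi t * d^-1)) (normrM (chi t)) normfV dE (ger0_norm c0) (ger0_norm (p0 N)).
apply: (@le_trans _ _ (1 * de^-1 * (eta / 2 * de / (rnorm x + 1)) * rnorm x)).
  have di0 : 0 <= de^-1 by rewrite invr_ge0 ltW.
  apply: ler_pM; [|exact: rnorm_ge0| |exact: nX].
    by apply: mulr_ge0; [exact: mulr_ge0|exact: p0].
  apply: ler_pM; [exact: mulr_ge0|exact: p0| |exact: ltW (hN _ s0 s1)].
  exact: ler_wpM2r.
have -> : 1 * de^-1 * (eta / 2 * de / (rnorm x + 1)) * rnorm x = eta / 2 * (rnorm x / (rnorm x + 1)).
  by field; rewrite !gt_eqF.
rewrite ler_piMr ?ltW// ltr_pdivrMr//; lra.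
Qed.

End ApproximateSolution.

(** * Every vector is a trace *)

Section TraceLift.
Context {R : realType} {H : completeNormedModType R[i]}.
Variable ip : {dot H for Num.conj}.
Hypothesis norm_ip : forall x : H, `|x| ^+ 2 = ip x x.
Hypothesis sep : exists D : set H, countable D /\ dense D.
Local Notation rip := (re_ip ip).
Local Notation mu := (@lebesgue_measure R).
Variable A : set (H * H).
Hypothesis sA : selfadjoint ip A.
Local Notation half n := ((2^-1 : R) ^+ n).

Lemma rnorm_ip_norm x : ip_norm ip x = rnorm x.
Proof. by rewrite /ip_norm -/(rip x x) (rip_norm norm_ip) sqrtr_sqr ger0_norm ?rnorm_ge0. Qed.

Lemma half_lt (e : R) : 0 < e -> exists n, half n < e.
Proof.
move=> e0; have /cvgrPdist_lt/(_ _ e0)[N _ /(_ N (leqnn N))] := @cvg_expr R 2^-1 ltac:(rewrite ger0_norm; lra).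
by rewrite /= sub0r normrN ger0_norm ?exprn_ge0// => h; exists N.
Qed.

Lemma le_half (x y K : R) : 0 <= K -> (forall n, x <= y + K * half n) -> x <= y.
Proof.
move=> K0 h; rewrite leNgt; apply/negP => yx.
have [n hn] : exists n, half n < (x - y) / (K + 1) by apply: half_lt; rewrite divr_gt0; lra.
have := h n; rewrite leNgt => /negP; apply; rewrite -ltrBrDl.
have h0 : 0 <= half n by rewrite exprn_ge0.
by move: hn; rewrite ltr_pdivlMr; last lra; nra.
Qed.

Lemma geo_sum (F : nat -> H) C : (forall j, rnorm (F j) <= C * half j) ->
  exists v, forall n, rnorm (v - \sum_(j < n) F j) <= 2 * C * half n.
Proof.
move=> hF; have C0 : 0 <= C by have := le_trans (rnorm_ge0 _) (hF 0%N); rewrite expr0 mulr1.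
pose S n := \sum_(j < n) F j.
have hS n k : rnorm (S (n + k)%N - S n) <= 2 * C * half n - 2 * C * half (n + k).
  elim: k => [|k IH]; first by rewrite addn0 !subrr rnorm0.
  rewrite addnS /S big_ord_recr /= addrAC; apply: le_trans (rnormD _ _) _.
  have := hF (n + k)%N; move: IH; rewrite /S exprS; move: (rnorm _) (rnorm _) (half (n + k)) (half n) => *.
  lra.
have hS' n m : (n <= m)%N -> rnorm (S m - S n) <= 2 * C * half n.
  move=> nm; rewrite -(subnKC nm); apply: le_trans (hS _ _) _.
  by rewrite gerBl mulr_ge0 ?mulr_ge0 ?exprn_ge0.
have [v hv] : exists l : H, S n @[n --> \oo] --> l.
  apply: rnorm_cauchy => e e0.
  have [N hN] : exists N, half N < e / (4 * C + 1) by apply: half_lt; rewrite divr_gt0; lra.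
  have h2 : 4 * C * half N < e.
    move: hN; rewrite ltr_pdivlMr; last lra.
    have : 0 <= half N by rewrite exprn_ge0.
    by move: (half N) => z; nra.
  exists N => m n Nm Nn.
  have -> : S m - S n = (S m - S N) - (S n - S N) by rewrite opprB addrA subrK.
  apply: le_lt_trans (rnormD _ _) _; rewrite rnormN.
  have := hS' _ _ Nm; have := hS' _ _ Nn; lra.
exists v => n; apply: (@le_half _ _ 1) => // k.
have [N hN] := (rnorm_cvgP _ _).1 hv (half k) ltac:(by rewrite exprn_gt0).
have nN : (n <= maxn n N)%N by rewrite leq_maxl.
have := hN _ (leq_maxr n N); have := hS' _ _ nN.
have -> : v - \sum_(j < n) F j = (S (maxn n N) - S n) + (v - S (maxn n N)) by rewrite [RHS]addrC addrA subrK.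
move=> h1 h2; apply: le_trans (rnormD _ _) _; rewrite mul1r; apply: lerD => //; exact: ltW.
Qed.

(** Differences of successive approximations of [x] from the domain of [A], with errors [2^-n]. The
    constant covers [|F 0| <= |x| + 1] and [|F j| <= 3 * 2^-j] for the later terms. *)
Lemma dense_series x : exists K (F F' : nat -> H), [/\ 0 <= K, forall j, A (F j, F' j),
  forall j, rnorm (F j) <= K * half j & forall n, exists m, (n <= m)%N /\ rnorm (x - \sum_(j < m) F j) <= half n].
Proof.
have [_ dA _] := sA.
have h n : exists p : H * H, A p /\ rnorm (x - p.1) < half n.
  have [p []] := dA x (half n) ltac:(by rewrite exprn_gt0).
  by rewrite rnorm_ip_norm => ? ?; exists p.
have [d hd] := choice h.
have hd1 n : A ((d n).1, (d n).2) by rewrite -surjective_pairing; have [] := hd n.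
exists (rnorm x + 4).
exists (fun j => if j is j'.+1 then (d j).1 - (d j').1 else (d 0%N).1).
exists (fun j => if j is j'.+1 then (d j).2 - (d j').2 else (d 0%N).2).
have x0 := rnorm_ge0 x; split=> [|j|j|n]; first lra.
- case: j => [|j]; first exact: hd1.
  by apply: (sadjD sA); [exact: hd1|apply: (sadjN sA); exact: hd1].
- case: j => [|j].
    rewrite expr0 mulr1; have [_ h0] := hd 0%N; move: h0; rewrite expr0 rnormBC => h0.
    rewrite -[(d 0%N).1](subrK x); apply: le_trans (rnormD _ _) _; lra.
  have [_ h1] := hd j; have [_ h2] := hd j.+1.
  have -> : (d j.+1).1 - (d j).1 = (x - (d j).1) - (x - (d j.+1).1) by rewrite opprB [RHS]addrC addrA subrK.
  apply: le_trans (rnormD _ _) _; rewrite rnormN; move: h1 h2; rewrite exprS.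
  have : 0 <= half j by rewrite exprn_ge0.
  move: (half j) (rnorm _) (rnorm _) => *; nra.
- exists n.+1; split=> //.
  have -> : \sum_(j < n.+1) (if j : nat is j'.+1 then (d j).1 - (d j').1 else (d 0%N).1) = (d n).1.
    elim: n => [|n IH]; first by rewrite big_ord1.
    by rewrite big_ord_recr /= IH addrC subrK.
  by have [_ /ltW] := hd n.
Qed.

(** [pi] will be the retraction onto the half-line where the partial sums converge uniformly; beyond
    it [V] is continued by a constant. *)
Lemma cts_uniform (S : nat -> R -> H) V C (pi : R -> R) : (forall n, cts_fun (S n)) ->
  (forall s t, `|pi s - pi t| <= `|s - t|) ->
  (forall n t, rnorm (V t - S n (pi t)) <= C * half n) -> cts_fun V.
Proof.
move=> cS hpi hV t e e0.
have C0 : 0 <= C by have := le_trans (rnorm_ge0 _) (hV 0%N t); rewrite expr0 mulr1.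
have [n hn] : exists n, half n < e / (3 * C + 1) by apply: half_lt; rewrite divr_gt0; lra.
have h2 : 3 * (C * half n) < e.
  move: hn; rewrite ltr_pdivlMr; last lra.
  have : 0 <= half n by rewrite exprn_ge0.
  by move: (half n) => z; nra.
have [r r0 hr] := cS n (pi t) (e / 3) ltac:(lra).
exists r => // s ts; have h3 := hr _ (le_lt_trans (hpi t s) ts).
have -> : V t - V s = (V t - S n (pi t)) + (S n (pi t) - S n (pi s)) - (V s - S n (pi s)).
  by rewrite opprB ![in RHS]addrA !subrK.
apply: le_lt_trans (rnormD _ _) _; rewrite rnormN.
have := rnormD (V t - S n (pi t)) (S n (pi t) - S n (pi s)).
have := hV n t; have := hV n s; lra.
Qed.

(** Since [x] need not lie in the domain of [A], it is expanded by [dense_series], and the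
    approximate solution for [F j] is taken with tolerance [2^-j]. Values and sources are then both
    dominated by [C * 2^-j] on the proper side of [c], and both series converge uniformly there. The
    source of the sum need not vanish; it only has to be square integrable. *)
Lemma trace_lift (sg c : R) (I : interval R) x : sg = 1 \/ sg = -1 ->
  (forall t, t \in I -> 0 <= sg * (t - c)) ->
  exists (p : L2 H I * L2 H I) V, [/\ maximal_on ip I A p, cts_fun V, represents p.1 V & V c = x].
Proof.
move=> sgE Isg.
have [chi [dchi chi01 chi1 chi0]] := @plateau R c 1 ltr01.
have [chi' [dchi1 [chi'' [dchi2 _]]]] := dchi 2%N.
have cchi' := has_deriv_cts dchi2.
have off t : ~ (`|t - c| <= 1) -> chi t = 0 /\ chi' t = 0.
  move=> tc; split; first exact: chi0.
  apply: (deriv_off (p := c - 1) (q := c + 1) dchi1) => [r hr|].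
    by apply: chi0; rewrite ler_norml => /andP[h1 h2]; apply: hr; apply/andP; split; lra.
  by move=> /andP[h1 h2]; apply: tc; rewrite ler_norml; apply/andP; split; lra.
have [M [M0 chiM]] : exists M, 0 <= M /\ forall t, `|chi' t| <= M.
  have cc : {within `[c - 1, c + 1]%classic, continuous chi'} by exact: continuous_subspaceT.
  have [M [_ hM]] := compact_bounded (continuous_compact cc (@segment_compact R (c - 1) (c + 1))).
  have M0 : 0 <= `|M| + 1 by have := normr_ge0 M; lra.
  exists (`|M| + 1); split=> // t.
  have [tc|/off[_ ->]] := pselect (`|t - c| <= 1); last by rewrite normr0.
  apply: hM; first by have := ler_norm M; lra.
  exists t => //=; move: tc; rewrite in_itv /= ler_norml => /andP[h1 h2]; apply/andP; split; lra.
have chic : chi c = 1 by apply: chi1; rewrite subrr normr0 divr_ge0.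
have [K [F [F' [K0 FA Fle Fsum]]]] := dense_series x.
have half_gt0 n : 0 < half n by rewrite exprn_gt0.
have Vex j := approx_solution norm_ip sA dchi1 cchi' chi01 chic off chiM sgE (FA j) (half_gt0 j).
have [v hv] := choice Vex; have [g hg] := choice hv; clear Vex hv.
pose C := K + M * K + 1; have C0 : 0 <= C by rewrite /C !addr_ge0// mulr_ge0.
pose pi t := c + sg * Num.max 0 (sg * (t - c)).
have sg2 : sg * sg = 1 by case: (sgE) => ->; rewrite ?mulr1 ?mulrNN ?mulr1.
have sgn : `|sg| = 1 by case: (sgE) => ->; rewrite ?normrN normr1.
have piI t : 0 <= sg * (t - c) -> pi t = t.
  by move=> h; rewrite /pi max_r// mulrA sg2 mul1r addrC subrK.
have pic : pi c = c by apply: piI; rewrite subrr mulr0.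
have pi0 t : 0 <= sg * (pi t - c).
  by rewrite /pi [c + _]addrC addrK mulrA sg2 mul1r le_max lexx.
have piL s t : `|pi s - pi t| <= `|s - t|.
  rewrite /pi opprD addrACA subrr add0r -mulrBr normrM sgn mul1r.
  have : `|sg * (s - c) - sg * (t - c)| = `|s - t|.
    by rewrite -mulrBr normrM sgn mul1r; congr `|_|; ring.
  move: (sg * (s - c)) (sg * (t - c)) => y z <-.
  rewrite /Num.max; do 2 case: ltrP => ?; rewrite ?subrr ?normr0// ler_norml; apply/andP; split;
    have := ler_norm (y - z); have := ler_norm (z - y); rewrite distrC; lra.
have vle j t : 0 <= sg * (t - c) -> rnorm (v j t) <= C * half j /\ rnorm (g j t) <= C * half j.
  have [_ _ h _] := hg j => /h[h1 h2]; have h3 := Fle j; have hj := ltW (half_gt0 j).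
  have MF : M * rnorm (F j) <= M * (K * half j) by apply: ler_wpM2l.
  have MK : 0 <= M * K by rewrite mulr_ge0.
  split; rewrite /C !mulrDl mul1r.
    apply: le_trans h1 _; apply: le_trans h3 _; rewrite -addrA lerDl addr_ge0 ?mulr_ge0//.
  apply: le_trans h2 _; apply: lerD => //; apply: le_trans MF _.
  by rewrite mulrA lerDr mulr_ge0.
have sumex (w : nat -> R -> H) : (forall j t, 0 <= sg * (t - c) -> rnorm (w j t) <= C * half j) ->
    exists V, forall t n, rnorm (V t - \sum_(j < n) w j (pi t)) <= 2 * C * half n.
  move=> hw; have h t : exists V, forall n, rnorm (V - \sum_(j < n) w j (pi t)) <= 2 * C * half n.
    by apply: (@geo_sum (fun j => w j (pi t)) C) => j; exact: hw.
  by have [V hV] := choice h; exists V.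
have [V hV] := sumex v (fun j t h => (vle j t h).1).
have [G hG] := sumex g (fun j t h => (vle j t h).2).
have [psi [dpsi psi01 psi1 psi0]] := @plateau R c 2 ltac:(lra).
have [psi' [dpsi1 _]] := dpsi 1%N; have cpsi := has_deriv_cts dpsi1.
(* [psi] equals 1 for [|t - c| <= 1], and beyond that distance the partial sums vanish. The factor 4
   adds [2 C] for the limit and [2 C] for the remainder. *)
pose B t := 4 * C * psi t.
have B0 t : 0 <= B t by have /andP[h _] := psi01 t; rewrite /B !mulr_ge0.
have iB2 : mu.-integrable [set` I] (EFin \o (fun t => B t ^+ 2)).
  apply: (@int_compact _ _ _ (c - 2) (c + 2)).
    move=> t; apply: (@continuous_comp _ _ _ B (fun x => x ^+ 2)); last exact: exprn_continuous.
    by apply: cvgM; [exact: cvg_cst|exact: cpsi].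
  move=> t ht; rewrite /B psi0 ?mulr0 ?expr0n// => tc; apply: ht.
  by move: tc; rewrite ler_norml => /andP[h1 h2]; apply/andP; split; lra.
have fin (w : nat -> R -> H) W : (forall j, cts_fun (w j)) ->
    (forall j t, ~ (`|t - c| <= 1) -> w j t = 0) ->
    (forall t n, rnorm (W t - \sum_(j < n) w j (pi t)) <= 2 * C * half n) ->
    [/\ cts_fun W, square_integrable I W, forall n, square_integrable I (fun t => \sum_(j < n) w j t),
      forall n t, t \in I -> rnorm (\sum_(j < n) w j t) <= B t &
      forall t, t \in I -> \sum_(j < n) w j t @[n --> \oo] --> W t].
  move=> cw w0 hW.
  have cS n : cts_fun (fun t => \sum_(j < n) w j t) by apply: cts_sum.
  have cW : cts_fun W by apply: (cts_uniform cS piL) => n t; exact: hW.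
  have Sle n t : t \in I -> rnorm (\sum_(j < n) w j t) <= B t.
    move=> /Isg tI; have [tc|tc] := pselect (`|t - c| <= 1); last first.
      by rewrite big1 ?rnorm0// => j _; rewrite w0.
    rewrite /B psi1 ?mulr1 ?divff//; have := hW t n; have := hW t 0%N.
    rewrite big_ord0 subr0 expr0 mulr1 piI// => h1 h2.
    have h3 : half n <= 1 by apply: exprn_ile1; lra.
    have -> : \sum_(j < n) w j t = W t - (W t - \sum_(j < n) w j t) by rewrite opprB addrC subrK.
    apply: le_trans (rnormD _ _) _; rewrite rnormN.
    have : 2 * C * half n <= 2 * C * 1 by apply: ler_wpM2l; rewrite ?mulr_ge0.
    by move: h1 h2; move: (rnorm _) (rnorm _) (half n) => *; lra.
  have Wle t : t \in I -> rnorm (W t) <= B t.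
    move=> tI; apply: (@le_half _ _ (2 * C)) => [|n]; first by rewrite mulr_ge0.
    have := hW t n; rewrite (piI _ (Isg _ tI)) => h1.
    rewrite -[W t](subrK (\sum_(j < n) w j t)) addrC; apply: le_trans (rnormD _ _) _.
    by apply: lerD => //; exact: Sle.
  have sq_of (f : R -> H) : cts_fun f -> (forall t, t \in I -> rnorm (f t) <= B t) -> square_integrable I f.
    move=> cf fle; have sf : strongly_measurable I f by exact: (sm_continuous sep).
     apply: int_sq => //.
    apply: int_le iB2; first by apply: measurable_funX; exact: sm_rnorm.
    by move=> t tI; rewrite ger0_norm ?sqr_ge0// lerXn2r ?nnegrE ?rnorm_ge0// fle.
  split=> //; [exact: sq_of|by move=> n; apply: sq_of => // t; exact: Sle|].
  move=> t tI; apply/rnorm_cvgP => e e0.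
  have [N hN] : exists n, half n < e / (2 * C + 1) by apply: half_lt; rewrite divr_gt0; lra.
  exists N => n Nn; have := hW t n; rewrite (piI _ (Isg _ tI)) => h; apply: le_lt_trans h _.
  have h2 : half n <= half N by apply: ler_wiXn2l => //; lra.
  move: hN; rewrite ltr_pdivlMr; last lra.
  have : 0 <= half n by rewrite exprn_ge0.
  by move: (half n) (half N) h2 => y z; nra.
have cl j : classical_sol ip A (v j) (g j) by have [] := hg j.
have [cV sV sS SB SV] := fin v V (fun j => let: And3 h _ _ := cl j in h)
  (fun j t h => let: And4 _ _ _ k := hg j in (k t h).1) hV.
have [cG sG sGn GB GV] := fin g G (fun j => let: And3 _ h _ := cl j in h)
  (fun j t h => let: And4 _ _ _ k := hg j in (k t h).2) hG.
exists (toL2 sV, toL2 sG), V; split=> //; last 2 first.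
- exact: toL2_repr.
- apply/eqP; rewrite -subr_eq0; apply/eqP/rnorm_eq0/eqP; rewrite eq_le rnorm_ge0 andbT.
  apply: (@le_half _ _ (2 * C + 1)) => [|n]; first by rewrite addr_ge0 ?mulr_ge0.
  have [m [nm xm]] := Fsum n; have := hV c m; rewrite pic.
  have -> : \sum_(j < m) v j c = \sum_(j < m) F j by apply: eq_bigr => j _; have [] := hg j.
  have hm : half m <= half n by apply: ler_wiXn2l => //; lra.
  have : 2 * C * half m <= 2 * C * half n by apply: ler_wpM2l; rewrite ?mulr_ge0.
  have -> : V c - x = (V c - \sum_(j < m) F j) - (x - \sum_(j < m) F j).
    by rewrite opprB addrA subrK.
  have := rnormD (V c - \sum_(j < m) F j) (- (x - \sum_(j < m) F j)); rewrite rnormN add0r mulrDl mul1r.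
  move: xm; move: (rnorm _) (rnorm _) (rnorm _) (half n) (half m) => *; lra.
(* The partial sums satisfy the criterion by [c1_crit], and both of its sides pass to the limit by
   dominated convergence. *)
apply: (max_crit norm_ip sep sA sV sG (toL2_repr sV) (toL2_repr sG)) => phi phi' f h rt Afh.
have s1 := sq_T1 norm_ip sep f rt; have s2 := sq_T2 norm_ip sep f h rt.
have lim (w : nat -> R -> H) (W T : R -> H) : square_integrable I T -> (forall n, square_integrable I (fun t => \sum_(j < n) w j t)) ->
    (forall n t, t \in I -> rnorm (\sum_(j < n) w j t) <= B t) ->
    (forall t, t \in I -> \sum_(j < n) w j t @[n --> \oo] --> W t) ->
    re_rint ip I (fun t => \sum_(j < n) w j t) T @[n --> \oo] --> re_rint ip I W T.
  move=> hT sw wB wW; rewrite /re_rint.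
  apply: (@Rintegral_dominated_cvg _ [set` I] (fun n t => rip (\sum_(j < n) w j t) (T t)) (fun t => rip (W t) (T t))
    (fun t => B t ^+ 2 + rnorm (T t) ^+ 2) (measurable_Itv I) _ _ _ _).2.
  - by move=> n; apply: (measurable_rip norm_ip); exact: sq_sm.
  - move=> t tI; have h0 := wW t tI; apply: (rip_cvg norm_ip) => //; exact: cvg_cst.
  - exact: int_D iB2 (sq_int hT).
  - move=> n t tI; apply: le_trans (rip_CS norm_ip _ _) _.
    apply: (@le_trans _ _ (B t * rnorm (T t))).
      by apply: ler_wpM2r; [exact: rnorm_ge0|exact: wB].
    have := sqr_ge0 (B t - rnorm (T t)); have := sqr_ge0 (B t + rnorm (T t)).
    by move: (rnorm (T t)) (B t) => p z; nra.
have c1 := lim _ _ _ s2 sS SB SV; have c2 := lim _ _ _ s1 sGn GB GV.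
have E : (fun n => re_rint ip I (fun t => \sum_(j < n) v j t) (test_img phi phi' f h)) =
    (fun n => re_rint ip I (fun t => \sum_(j < n) g j t) (test_vec phi f)).
  apply/funext => n.
  have [cSn cGn dS] := classical_sum (fun j : 'I_n => cl j).
  apply: (c1_crit norm_ip sep (sS n) (sGn n) rt (dS _ _ Afh)) => t.
  by apply: cvgB; exact: (cts_rip norm_ip).
by rewrite E in c1; exact: (cvg_unique _ c1 c2).
Qed.

End TraceLift.

(** * Density of the test functions *)

Section SmoothIndicators.
Context {R : realType}.
Local Notation mu := (@lebesgue_measure R).
Variable I : interval R.

Definition smooth_test (phi : R -> R) := (forall n, diffn n phi) /\
  exists p q, [/\ p <= q, forall t, ~ (p <= t <= q) -> phi t = 0 & forall t, p <= t <= q -> t \in I].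

Let cutoff (U S : set R) := exists phi, [/\ smooth_test phi, forall t, 0 <= phi t <= 1,
  forall t, S t -> phi t = 1 & forall t, ~ U t -> phi t = 0].

(** Even the zero function has to exhibit a nonempty support segment inside [I], hence the point of
    [I]. *)
Let cutoff0 U : (exists t, t \in I) -> cutoff U set0.
Proof.
move=> [r rI]; exists (fun=> 0); split=> //; last by move=> t; rewrite lexx ler01.
split; first by move=> n; exact: diffn_cst.
by exists r, r; split=> // t; rewrite -eq_le => /eqP <-.
Qed.

Let cutoffU U S S' : cutoff U S -> cutoff U S' -> cutoff U (S `|` S').
Proof.
move=> [f [[df [p [q [pq f0 fI]]]] f01 f1 fU]] [g [[dg [p' [q' [pq' g0 gI]]]] g01 g1 gU]].
(* This is [1 - (1 - f) (1 - g)]: it is 1 where [f] or [g] is, and stays between 0 and 1. *)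
exists (fun t => (f t + g t) + (-1) * (f t * g t)); split=> [|t|t [St|St]|t tU].
- split=> [n|].
    by apply: diffnD; [exact: diffnD|apply: diffnM; [exact: diffn_cst|exact: diffnM]].
  exists (Num.min p p'), (Num.max q q'); split=> [|t ht|t].
  + by rewrite ge_min le_max pq.
  + rewrite f0 ?g0 ?mulr0 ?mul0r ?addr0//.
      by move=> /andP[h1 h2]; apply: ht; rewrite ge_min le_max h1 h2 !orbT.
    by move=> /andP[h1 h2]; apply: ht; rewrite ge_min le_max h1 h2.
  + apply: itv_convex.
      by rewrite /Num.min; case: ifP => _; [apply: fI|apply: gI]; rewrite lexx ?pq.
    by rewrite /Num.max; case: ifP => _; [apply: gI|apply: fI]; rewrite lexx ?pq ?pq'.
- by have /andP[? ?] := f01 t; have /andP[? ?] := g01 t; apply/andP; split; nra.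
- by rewrite f1//; ring.
- by rewrite g1//; ring.
- by rewrite fU// gU// !mulr0 !addr0.
Qed.

Let cutoffS U S S' : S `<=` S' -> cutoff U S' -> cutoff U S.
Proof. by move=> sS [f [h1 h2 h3 h4]]; exists f; split=> // t /sS; exact: h3. Qed.

(** Finitely many balls of half radius cover [K]; the plateau functions of the full radii vanish
    outside [U] and are combined by [cutoffU]. *)
Lemma compact_cutoff (K U : set R) : (exists t, t \in I) -> compact K -> open U ->
  K `<=` U -> U `<=` [set` I] -> cutoff U K.
Proof.
move=> Ine cK oU KU UI.
have h x : exists r, 0 < r /\ (K x -> forall t, `|t - x| <= r -> U t).
  have [Kx|] := pselect (K x); last by move=> ?; exists 1; split.
  have /nbhs_ballP[r /= r0 hr] := open_nbhs_nbhs (conj oU (KU _ Kx)).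
  exists (r / 2); split=> [|_ t tx]; first by rewrite divr_gt0.
  by apply: hr; rewrite /ball /= distrC; lra.
have [r hr] := choice h.
move: cK; rewrite compact_cover => /(_ R K (fun x => ball x (r x / 2))).
case=> [x Kx|x Kx|D' D'K KD'].
- by apply: ball_open; rewrite divr_gt0//; have [] := hr x.
- by exists x => //; apply: ballxx; rewrite divr_gt0//; have [] := hr x.
have one x : K x -> cutoff U (ball x (r x / 2)).
  move=> Kx; have [rx hx] := hr x; have [phi [dphi p01 p1 p0]] := plateau x rx.
  exists phi; split=> // [|t|t tU].
  - split=> //; exists (x - r x), (x + r x); split=> [|t ht|t ht]; first by lra.
      by apply: p0; rewrite ler_norml => /andP[h1 h2]; apply: ht; apply/andP; split; lra.
    by apply/UI/hx => //; rewrite ler_norml; move/andP: ht => [h1 h2]; apply/andP; split; lra.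
  - by rewrite /ball /= distrC => /ltW; exact: p1.
  - by apply: p0 => tx; apply: tU; exact: hx.
have all_s (s : seq R) : {subset s <= K} -> cutoff U [set t | exists2 x, x \in s & ball x (r x / 2) t].
  elim: s => [|x s IH] sK; first by apply: cutoffS (cutoff0 U Ine) => t [].
  have h1 : cutoff U (ball x (r x / 2)) by apply: one; apply/set_mem/sK; rewrite mem_head.
  have h2 := IH (fun y ys => sK y (@mem_behead _ (x :: s) y ys)).
  apply: cutoffS (cutoffU h1 h2) => t [y]; rewrite in_cons => /orP[/eqP ->|ys] yt; first by left.
  by right; exists y.
apply: cutoffS (all_s (finmap.enum_fset D') _) => [t /KD'[x xD xt]|x xD]; first by exists x.
exact: D'K.
Qed.

(** With [K] compact inside [E] and [U] open around it, both up to [e / 2] in measure, a cutoff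
    between them differs from the indicator only on the two difference sets, and there by at most
    1. *)
Lemma smooth_indicator (E : set R) e : (exists t, t \in I) -> open [set` I] ->
  measurable (E : set (measurableTypeR R)) ->
  E `<=` [set` I] -> (mu E < +oo)%E -> 0 < e -> exists phi, [/\ smooth_test phi,
    forall t, 0 <= phi t <= 1 & (\int[mu]_(t in [set` I]) ((\1_E t - phi t) ^+ 2)%:E <= e%:E)%E].
Proof.
move=> Ine oI mE EI Eoo e0; have e2 : 0 < e / 2 by rewrite divr_gt0.
have [U [oU EU mU]] := lebesgue_regularity_outer mE Eoo e2.
have [K [cK KE mK]] := lebesgue_regularity_inner mE Eoo e2.
have oV : open (U `&` [set` I]) by exact: openI.
have [phi [sphi p01 pK pV]] : cutoff (U `&` [set` I]) K.
  by apply: compact_cutoff => // t Kt; split; [apply/EU/KE|apply/EI/KE].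
exists phi; split=> //.
have mK' : measurable (K : set (measurableTypeR R)) by apply: closed_measurable; exact: compact_closed.
have mU' : measurable (U : set (measurableTypeR R)) by exact: open_measurable.
have cphi : continuous phi by have [d [hd _]] := sphi.1 1%N; exact: has_deriv_cts hd.
have mphi : measurable_fun ([set` I] : set (measurableTypeR R)) phi.
  by apply: measurable_funTS; exact: continuous_measurable_fun.
pose F t : R := \1_(E `\` K) t + \1_(U `\` E) t.
apply: (@le_trans _ _ (\int[mu]_(t in [set` I]) (F t)%:E)%E).
  apply: ge0_le_integral => //=.
  - by move=> t _; rewrite lee_fin sqr_ge0.
  - apply/measurable_EFinP; apply: measurable_funX; apply: measurable_funB => //.
  - apply/measurable_EFinP; apply: measurable_funD; apply: measurable_funTS; apply: measurable_indic;
      exact: measurableD.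
  - move=> t _; rewrite lee_fin /F !indicE.
    have /andP[p0 p1] := p01 t.
    have [Et|Et] := pselect (E t).
      rewrite (mem_set Et) (memNset (A := U `\` E)); last by move=> [].
      have [Kt|Kt] := pselect (K t); first by rewrite pK// subrr expr0n addr_ge0.
      rewrite mem_set; last by split.
      rewrite !mulr1n mulr0n addr0; nra.
    rewrite (memNset Et) (memNset (A := E `\` K)); last by move=> [].
    rewrite !mulr0n !add0r sqrrN.
    have [Ut|Ut] := pselect (U t); last by rewrite pV ?expr0n// => -[].
    rewrite mem_set; last by split.
    by rewrite mulr1n; nra.
apply: (@le_trans _ _ (mu (E `\` K) + mu (U `\` E))%E); last first.
  by rewrite (splitr e) EFinD; apply: leeD; exact: ltW.
rewrite /F; under eq_integral do rewrite EFinD.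
have mEK : measurable (E `\` K : set (measurableTypeR R)) by exact: measurableD.
have mUE : measurable (U `\` E : set (measurableTypeR R)) by exact: measurableD.
have mi (D : set R) : measurable (D : set (measurableTypeR R)) ->
    measurable_fun ([set` I] : set (measurableTypeR R)) (fun t => (\1_D t : R)%:E).
  by move=> mD; apply/measurable_EFinP; apply: measurable_funTS; exact: measurable_indic.
rewrite ge0_integralD//=; [|exact: mi|exact: mi].
rewrite !integral_indic//.
by apply: leeD; apply: le_measure; rewrite ?inE//; try (apply: measurableI => //; exact: measurable_Itv); move=> t [].
Qed.

End SmoothIndicators.

(** * Density of the preminimal domain *)

Section Density.
Context {R : realType} {H : completeNormedModType R[i]}.
Variable ip : {dot H for Num.conj}.
Hypothesis norm_ip : forall x : H, `|x| ^+ 2 = ip x x.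
Hypothesis sep : exists D : set H, countable D /\ dense D.
Local Notation rip := (re_ip ip).
Local Notation mu := (@lebesgue_measure R).
Variable A : set (H * H).
Hypothesis sA : selfadjoint ip A.
Variable I : interval R.
Local Notation sq := (@square_integrable R H I).
Local Notation rint := (re_rint ip I).
Local Notation int f := (mu.-integrable [set` I] (EFin \o f)).
Local Notation pre := (preminimal I A).

Lemma represents0 : represents (0 : L2 H I) (fun=> 0).
Proof. by rewrite -toL2_0; exact: toL2_repr. Qed.

Lemma representsD (u v : L2 H I) f g : represents u f -> represents v g ->
  represents (u + v) (fun t => f t + g t).
Proof.
move=> hu hv; have := representsZD 1 hu hv; rewrite scale1r; congr represents.
by apply/funext => t; rewrite scale1r.
Qed.

Lemma pre0 : pre 0.
Proof.
exists 0%N, (fun _ _ => 0), (fun=> 0), (fun=> 0); split=> [[]//||].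
  by apply: ae_sub represents0 => t h tI; rewrite h// big_ord0.
by apply: ae_sub represents0 => t h tI; rewrite h// big_ord0.
Qed.

Lemma preD p q : pre p -> pre q -> pre (p + q).
Proof.
move=> [n [phi [f [g [hj r1 r2]]]]] [m [psi [k [l [hj' s1 s2]]]]].
pose glue T (a : 'I_n -> T) (b : 'I_m -> T) (j : 'I_(n + m)) :=
  match fintype.split j with inl i => a i | inr i => b i end.
have gl T (a : 'I_n -> T) b i : glue T a b (lshift m i) = a i by rewrite /glue (unsplitK (inl i)).
have gr T (a : 'I_n -> T) b i : glue T a b (rshift n i) = b i by rewrite /glue (unsplitK (inr i)).
exists (n + m)%N, (glue _ phi psi), (glue _ f k), (glue _ g l); split=> [j||].
- rewrite /glue; case: (fintype.split j) => i; [exact: hj|exact: hj'].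
- have := representsD r1 s1; apply: ae_sub => t h tI; rewrite h// big_split_ord /=.
  by congr (_ + _); apply: eq_bigr => i _; rewrite ?gl ?gr.
- have := representsD r2 s2; apply: ae_sub => t h tI; rewrite h// big_split_ord /=.
  by congr (_ + _); apply: eq_bigr => i _; rewrite ?gl ?gr.
Qed.

Local Notation d2 u v := (rint (fun t => u t - v t) (fun t => u t - v t)).

Lemma rint_sqrD a b : sq a -> sq b ->
  rint (fun t => a t + b t) (fun t => a t + b t) <= 2 * rint a a + 2 * rint b b.
Proof.
move=> ha hb; have hD := sqD ha hb; have hB := sqB ha hb.
have := rint_ge0 norm_ip I (fun t => a t - b t).
have cB f : sq f -> rint f (fun t => a t - b t) = rint f a - rint f b.
  by move=> hf; rewrite rintC (rintBl norm_ip ha hb hf) ![re_rint ip I _ f]rintC.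
rewrite (rintDl norm_ip ha hb hD) (rintBl norm_ip ha hb hB) !cB//.
rewrite (rintDr norm_ip ha ha hb) (rintDr norm_ip hb ha hb) [re_rint ip I b a]rintC; lra.
Qed.

Definition approximable (u : R -> H) := sq u /\ forall e, 0 < e ->
  exists p v, [/\ pre p, sq v, represents p.1 v & d2 u v < e].

Lemma sq_ext u v : (forall t, t \in I -> u t = v t) -> sq u -> sq v.
Proof.
move=> uv [[s [ss su]] iu]; split; first by exists s; split=> // t tI; rewrite -uv//; exact: su.
by under eq_integral => t /set_mem tI do rewrite -uv//.
Qed.

Lemma approximable_ext u v : (forall t, t \in I -> u t = v t) -> approximable u -> approximable v.
Proof.
move=> uv [su h]; split; first exact: sq_ext uv su.
move=> e /h[p [w [pp sw rw hw]]]; exists p, w; split=> //; apply: le_lt_trans hw.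
by rewrite le_eqVlt; apply/orP; left; apply/eqP; apply: eq_Rintegral => t /set_mem tI; rewrite uv.
Qed.

Lemma approximable0 : approximable (fun=> 0).
Proof.
have s0 := @sq0 R H I; split=> // e e0; exists 0, (fun=> 0); split=> //; [exact: pre0|exact: represents0|].
by rewrite /re_rint; under eq_Rintegral do rewrite subr0 rip0l; rewrite /Rintegral integral0.
Qed.

Lemma approximableD u v : approximable u -> approximable v -> approximable (fun t => u t + v t).
Proof.
move=> [su hu] [sv hv]; split; first exact: sqD.
move=> e e0; have e4 : 0 < e / 4 by rewrite divr_gt0.
have [p [w [pp sw rw hw]]] := hu _ e4; have [q [z [qq sz rz hz]]] := hv _ e4.
exists (p + q), (fun t => w t + z t); split; [exact: preD|exact: sqD|exact: representsD|].
have := rint_sqrD (sqB su sw) (sqB sv sz).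
have -> : (fun t => u t - w t + (v t - z t)) = (fun t => u t + v t - (w t + z t)).
  by apply/funext => t; rewrite opprD addrACA.
lra.
Qed.

Lemma approximable_cl u : sq u ->
  (forall e, 0 < e -> exists2 v, approximable v & d2 u v < e) -> approximable u.
Proof.
move=> su h; split=> // e e0; have e4 : 0 < e / 4 by rewrite divr_gt0.
have [v [sv hv] uv] := h _ e4; have [p [w [pp sw rw vw]]] := hv _ e4.
exists p, w; split=> //; have := rint_sqrD (sqB su sv) (sqB sv sw).
have -> : (fun t => u t - v t + (v t - w t)) = (fun t => u t - w t).
  by apply/funext => t; rewrite addrA subrK.
lra.
Qed.

Lemma rint_scale (psi : R -> R) h : rint (fun t => (psi t)%:C *: h) (fun t => (psi t)%:C *: h) =
  \int[mu]_(t in [set` I]) (rnorm h ^+ 2 * psi t ^+ 2).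
Proof.
by apply: eq_Rintegral => t _; rewrite ripZl ripZr (rip_norm norm_ip); ring.
Qed.

(** The vector [h] is arbitrary; replacing it by a nearby vector of the domain of [A] brings the
    product into the preminimal domain. *)
Lemma approximable_T1 phi h : smooth_test I phi -> approximable (test_vec phi h).
Proof.
move=> [dphi [p [q [pq p0 pI]]]]; have [phi' [hphi _]] := dphi 1%N.
have rt := rtest_diffn dphi hphi p0 pI.
have sT f : sq (test_vec phi f) by exact: (sq_T1 norm_ip sep f rt).
apply: approximable_cl => // e e0.
pose K := \int[mu]_(t in [set` I]) (phi t ^+ 2).
have K0 : 0 <= K by apply: Rintegral_ge0 => t _; exact: sqr_ge0.
have iphi : int (fun t => phi t ^+ 2).
  apply: (@int_compact _ _ _ p q) => [t|t /p0 ->]; last by rewrite expr0n.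
  apply: (@continuous_comp _ _ _ phi (fun x => x ^+ 2)); last exact: exprn_continuous.
  exact: (has_deriv_cts hphi).
have k0 : 0 < Num.sqrt (e / (K + 1)) by rewrite sqrtr_gt0 divr_gt0//; lra.
have [_ dA _] := sA; have [[f g] [/= Afg]] := dA h _ k0; rewrite (rnorm_ip_norm norm_ip) => hf.
exists (test_vec phi f).
  split=> // e' e'0; have r1 := toL2_repr (sT f).
  have s2 := sq_T2 norm_ip sep f g rt.
  exists (toL2 (sT f), toL2 s2), (test_vec phi f); split=> //.
    apply: (pre_real dphi hphi _ Afg) => //; last exact: toL2_repr.
    by exists p, q.
  by rewrite /re_rint; under eq_Rintegral do rewrite subrr rip0l; rewrite /Rintegral integral0.
have -> : (fun t => test_vec phi h t - test_vec phi f t) = (fun t => (phi t)%:C *: (h - f)).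
  by apply/funext => t; rewrite scalerBr.
rewrite rint_scale RintegralZl// -/K; have h2 : rnorm (h - f) ^+ 2 < e / (K + 1).
  have h3 : 0 <= e / (K + 1) by apply: divr_ge0; lra.
  by rewrite -(sqr_sqrtr h3) ltr_pXn2r ?nnegrE ?rnorm_ge0 ?sqrtr_ge0.
move: h2; rewrite ltr_pdivlMr; last lra.
have := sqr_ge0 (rnorm (h - f)); move: (rnorm _ ^+ 2) => z; nra.
Qed.

Hypothesis Ine : exists t, t \in I.
Hypothesis oI : open [set` I].

Lemma approximable_indic (E : set R) h : measurable (E : set (measurableTypeR R)) ->
  E `<=` [set` I] -> (mu E < +oo)%E -> approximable (fun t => (\1_E t)%:C *: h).
Proof.
move=> mE EI Eoo.
have mE1 : measurable_fun ([set` I] : set (measurableTypeR R)) (\1_E : R -> R).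
  by apply: measurable_funTS; exact: measurable_indic.
have sE : sq (fun t => (\1_E t)%:C *: h).
  apply: int_sq; first by apply: (sm_scale norm_ip sep) => //; exact: sm_cst.
  have iE : int (\1_E : R -> R).
    apply/integrableP; split; first exact/measurable_EFinP.
    under eq_integral do rewrite /= ger0_norm//.
    rewrite integral_indic//.
    by apply: le_lt_trans Eoo; apply: le_measure; rewrite ?inE//; apply: measurableI => //; exact: measurable_Itv.
  apply: int_le (int_Z (rnorm h ^+ 2) iE).
    apply: measurable_funX; apply: sm_rnorm; apply: (sm_scale norm_ip sep) => //; exact: sm_cst.
  move=> t _; rewrite ger0_norm ?sqr_ge0// rnormZR exprMn mulrC; apply: ler_wpM2l; first exact: sqr_ge0.
  by rewrite indicE; case: (_ \in _); rewrite ?normr1 ?normr0 ?expr1n ?expr0n.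
apply: approximable_cl => // e e0.
have k0 : 0 < rnorm h ^+ 2 + 1 by have := sqr_ge0 (rnorm h); lra.
have [phi [sphi p01 hphi]] := smooth_indicator Ine oI mE EI Eoo (divr_gt0 e0 k0).
exists (test_vec phi h); first exact: approximable_T1.
have -> : (fun t => (\1_E t)%:C *: h - test_vec phi h t) = (fun t => (\1_E t - phi t)%:C *: h).
  by apply/funext => t; rewrite /test_vec -scalerBl -rmorphB.
have mf : measurable_fun ([set` I] : set (measurableTypeR R)) (fun t => (\1_E t - phi t) ^+ 2).
  apply: measurable_funX; apply: measurable_funB => //.
  have [d [hd _]] := sphi.1 1%N.
  by apply: measurable_funTS; apply: continuous_measurable_fun; exact: has_deriv_cts hd.
have i2 : int (fun t => (\1_E t - phi t) ^+ 2).
  apply/integrableP; split; first exact/measurable_EFinP.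
  apply: le_lt_trans (ltry (e / (rnorm h ^+ 2 + 1))); apply: le_trans hphi.
  rewrite le_eqVlt; apply/orP; left; apply/eqP; apply: eq_integral => t _.
  by rewrite /= ger0_norm ?sqr_ge0.
rewrite rint_scale RintegralZl//.
set z := \int[mu]_(x in _) _; have hz : z <= e / (rnorm h ^+ 2 + 1).
  rewrite -lee_fin; apply: le_trans hphi; rewrite /z /Rintegral fineK//.
  exact: integrable_fin_num.
apply: (@le_lt_trans _ _ (rnorm h ^+ 2 * (e / (rnorm h ^+ 2 + 1)))).
  by apply: ler_wpM2l => //; exact: sqr_ge0.
rewrite mulrA ltr_pdivrMr// mulrC ltr_pM2l//; lra.
Qed.

Lemma approximable_sum (L : seq H) (F : H -> R -> H) : (forall h, approximable (F h)) ->
  approximable (fun t => \sum_(h <- L) F h t).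
Proof.
move=> hF; elim: L => [|h L IH].
  by apply: approximable_ext approximable0 => t _; rewrite big_nil.
by apply: approximable_ext (approximableD (hF h) IH) => t _; rewrite big_cons.
Qed.

(* Truncating where |s_n| > 2|u| makes dominated convergence available, and gives the level sets
   of nonzero values finite measure. *)
Lemma sq_approximable u : sq u -> approximable u.
Proof.
move=> su; have mu_ := sq_sm su; have [s [ss su_]] := mu_; have iu := sq_int su.
pose w n t := if rnorm (s n t) <= 2 * rnorm (u t) then s n t else 0.
have mru : measurable_fun ([set` I] : set (measurableTypeR R)) (fun t => 2 * rnorm (u t)).
  by apply: measurable_funM => //; exact: sm_rnorm.
have aw n : approximable (w n).
  have [/finite_seqP[L hL] ms] := ss n.
  pose E h := ([set` I] `&` s n @^-1` [set h]) `&` ([set` I] `&` [set t | rnorm h <= 2 * rnorm (u t)]).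
  have mE h : measurable (E h : set (measurableTypeR R)).
    apply: measurableI; first exact: ms.
    have := mru (measurable_Itv I) `[rnorm h, +oo[%classic (measurable_itv _).
    by congr measurable; congr (_ `&` _); apply/seteqP; split=> t /=; rewrite in_itv /= andbT.
  have aE h : approximable (fun t => (\1_(E h) t)%:C *: h).
    have [->|h0] := eqVneq h 0.
      by apply: approximable_ext approximable0 => t _; rewrite scaler0.
    apply: approximable_indic => //; first by move=> t [[]].
    have hp : 0 < rnorm h ^+ 2.
      rewrite exprn_gt0// lt_neqAle rnorm_ge0 andbT eq_sym; apply: contra h0 => /eqP h0.
      by apply/eqP; exact: rnorm_eq0.
    have : int (\1_(E h) : R -> R).
      apply: int_le (int_Z (4 / rnorm h ^+ 2) iu).
        by apply: measurable_funTS; apply: measurable_indic; exact: mE.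
      move=> t _; rewrite indicE; have [Et|nE] := pselect (E h t); last first.
        by rewrite memNset// normr0 mulr_ge0 ?sqr_ge0// divr_ge0// ltW.
      have h2 : rnorm h <= 2 * rnorm (u t) by case: Et => _ [].
      have h3 : rnorm h ^+ 2 <= 4 * rnorm (u t) ^+ 2.
        have -> : 4 * rnorm (u t) ^+ 2 = (2 * rnorm (u t)) ^+ 2 by ring.
        by rewrite lerXn2r ?nnegrE ?mulr_ge0 ?rnorm_ge0.
      by rewrite mem_set// normr1 mulrAC ler_pdivlMr// mul1r.
    move=> /integrableP[_]; under eq_integral do rewrite /= ger0_norm//.
    rewrite integral_indic//.
    by rewrite setIidl// => t [[]].
  (* [w n] is a finite sum over the values of [s n]; [undup] makes each value count once. *)
  apply: approximable_ext (approximable_sum (undup L) aE) => t tI.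
  have sL : s n t \in undup L.
    have : (s n @` [set` I]) (s n t) by exists t.
    by rewrite hL mem_undup.
  rewrite (bigD1_seq (s n t)) ?undup_uniq//= big1 ?addr0 => [|h hs]; last first.
    by rewrite indicE memNset ?scale0r// => -[[_ /= E1]]; rewrite E1 eqxx in hs.
  rewrite indicE /w; case: ifPn => h1.
    by rewrite mem_set ?scale1r//; split; split.
  by rewrite memNset ?scale0r// => -[_ [_ /=]]; apply/negP.
have wle n t : rnorm (w n t) <= 2 * rnorm (u t).
  by rewrite /w; case: ifP => // _; rewrite rnorm0 mulr_ge0 ?rnorm_ge0.
have wcvg t : t \in I -> w n t @[n --> \oo] --> u t.
  move=> tI; have h := (rnorm_cvgP _ _).1 (su_ t tI); apply/rnorm_cvgP => e e0.
  have [u0|u0] := eqVneq (rnorm (u t)) 0.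
    exists 0%N => n _; have := wle n t; rewrite u0 mulr0 => w0.
    have -> : w n t = 0 by apply: rnorm_eq0; apply/eqP; rewrite eq_le w0 rnorm_ge0.
    by rewrite subr0 u0.
  have up : 0 < rnorm (u t) by rewrite lt_neqAle eq_sym u0 rnorm_ge0.
  (* Once [s n t] is within [|u t|] of [u t], its norm is at most [2 |u t|] and the truncation no
     longer acts. *)
  have [N hN] := h (Num.min e (rnorm (u t))) ltac:(by rewrite lt_min e0).
  exists N => n /hN; rewrite lt_min => /andP[h1 h2]; rewrite /w ifT//.
  have -> : s n t = u t - (u t - s n t) by rewrite opprB addrC subrK.
  by apply: le_trans (rnormD _ _) _; rewrite rnormN; lra.
apply: approximable_cl => // e e0.
pose f n t := rip (u t - w n t) (u t - w n t).
have [_ hc] : int (fun=> 0) /\ \int[mu]_(t in [set` I]) f n t @[n --> \oo] --> \int[mu]_(t in [set` I]) (0 : R).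
  apply: (@Rintegral_dominated_cvg _ [set` I] f (fun=> 0) (fun t => 9 * rnorm (u t) ^+ 2) (measurable_Itv I)).
  - move=> n; have [sw _] := aw n.
    by apply: (measurable_rip norm_ip); apply: sq_sm; exact: sqB.
  - move=> t tI; have -> : 0 = rip (u t - u t) (u t - u t) by rewrite subrr rip0l.
    have c : u t - w n t @[n --> \oo] --> u t - u t by apply: cvgB; [exact: cvg_cst|exact: wcvg].
    exact: (rip_cvg norm_ip).
  - exact: int_Z.
  - move=> n t tI; rewrite /f (rip_norm norm_ip) ger0_norm ?sqr_ge0//.
    have -> : 9 * rnorm (u t) ^+ 2 = (3 * rnorm (u t)) ^+ 2 by ring.
    rewrite lerXn2r ?nnegrE ?mulr_ge0 ?rnorm_ge0//.
    apply: le_trans (rnormD _ _) _; rewrite rnormN; have := wle n t; lra.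
have [N /(_ N (leqnn N))] := cvgn_eps hc e0.
rewrite {2}/Rintegral integral0 subr0 => h; exists (w N); first exact: aw.
by apply: le_lt_trans h; exact: ler_norm.
Qed.

Lemma preminimal_dense : densely_defined (L2_ip ip) pre.
Proof.
move=> x e e0; have [_ /(_ (e ^+ 2))] := sq_approximable (L2_sq x).
case; first by rewrite exprn_gt0.
move=> p [v [pp sv rv h]]; exists p; split=> //.
have rx : represents (x - p.1) (fun t => L2_repr x t - v t).
  have := representsZD (-1) rv (represents_self x); rewrite scaleN1r addrC; congr represents.
  by apply/funext => t; rewrite scaleN1r addrC.
have sm1 := sq_sm (sqB (L2_sq x) sv).
rewrite /ip_norm (L2_ipE norm_ip sm1 sm1 rx rx) /=.
rewrite -[ltRHS]ger0_norm ?ltW// -sqrtr_sqr ltr_sqrt//.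
by rewrite exprn_gt0.
Qed.

End Density.

(** * Green's formula *)

Section MinimalMaximal.
Context {R : realType} {H : completeNormedModType R[i]}.
Variable ip : {dot H for Num.conj}.
Hypothesis norm_ip : forall x : H, `|x| ^+ 2 = ip x x.
Hypothesis sep : exists D : set H, countable D /\ dense D.
Local Notation rip := (re_ip ip).
Local Notation mu := (@lebesgue_measure R).
Variable A : set (H * H).
Hypothesis sA : selfadjoint ip A.
Variable I : interval R.
Local Notation sq := (@square_integrable R H I).
Local Notation lip := (L2_ip ip).
Local Notation pre := (preminimal I A).

(** Test functions are classical solutions with their images as sources, and [c1_crit] performs the
    integration by parts. *)
Lemma preminimal_maximal : pre `<=` maximal_on ip I A.
Proof.
move=> [U G] [n [phi [f [h [hj r1 r2]]]]] /=.
pose al j t := complex.Re (phi j t); pose be j t := complex.Im (phi j t).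
pose al' j t := complex.Re (cderive (phi j) t); pose be' j t := complex.Im (cderive (phi j) t).
have ta j : real_test I (al j) (al' j) by have [/test_function_parts[]] := hj j.
have tb j : real_test I (be j) (be' j) by have [/test_function_parts[]] := hj j.
have Aj j : A (f j, h j) by have [] := hj j.
have Aij j := sadjZ sA 'i%C (Aj j).
pose u j t := test_vec (al j) (f j) t + test_vec (be j) ('i%C *: f j) t.
pose g j t := test_img (al j) (al' j) (f j) (h j) t + test_img (be j) (be' j) ('i%C *: f j) ('i%C *: h j) t.
have T2E (a b : R -> R) x y : (fun t => (a t)%:C *: y + (b t)%:C *: ('i%C *: x)) = test_img a b x y.
  by apply/funext => t; rewrite /test_img addrC.
have cl j : classical_sol ip A (u j) (g j).
  have [d1 c1 _] := ta j; have [d2 c2 _] := tb j.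
  have := classicalD (classical_elem sA (Aj j) d1 c1) (classical_elem sA (Aij j) d2 c2).
  by congr classical_sol; apply/funext => t; rewrite /g /test_img; congr (_ + _); rewrite addrC.
have su : sq (fun t => \sum_(j < n) u j t).
  by apply: sq_sum => j; apply: sqD; [exact: (sq_T1 norm_ip sep _ (ta j))|exact: (sq_T1 norm_ip sep _ (tb j))].
have sg : sq (fun t => \sum_(j < n) g j t).
  by apply: sq_sum => j; apply: sqD; [exact: (sq_T2 norm_ip sep _ _ (ta j))|exact: (sq_T2 norm_ip sep _ _ (tb j))].
have [cu cg du] := classical_sum cl.
apply: (max_crit norm_ip sep sA su sg).
- apply: ae_sub r1 => t ht tI; rewrite ht//; apply: eq_bigr => j _.
  rewrite /u /test_vec {1}(complexE (phi j t)) scalerDl scalerA; congr (_ + _ *: _); rewrite /be; ring.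
- apply: ae_sub r2 => t ht tI; rewrite ht//; apply: eq_bigr => j _.
  rewrite /g /test_img addrACA; congr (_ + _).
    rewrite {1}(complexE (cderive (phi j) t)) !scalerA -scalerDl; congr (_ *: _); rewrite /al' /be'; ring.
  rewrite {1}(complexE (phi j t)) !scalerA -scalerDl; congr (_ *: _); rewrite /al /be; ring.
- move=> psi psi' k l rt Akl.
  apply: (c1_crit norm_ip sep su sg rt (du _ _ Akl)) => t.
  by apply: cvgB; exact: (cts_rip norm_ip).
Qed.

Let lipP : inner_product (@L2_ip R H I ip) := L2_inner norm_ip I.

(** The relation of [preminimal_maximal], read with its two arguments exchanged by conjugate
    symmetry. *)
Lemma minimal_maximal : minimal_on ip I A `<=` maximal_on ip I A.
Proof.
move=> p mp; rewrite (maximalE norm_ip) => q /preminimal_maximal mq.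
by have := mq p mp; rewrite (innerC lipP p.1) (innerC lipP p.2) => ->.
Qed.

Lemma preminimal_minimal : pre `<=` minimal_on ip I A.
Proof.
move=> p pp e e0; exists p; rewrite !subrr; split=> //;
  by rewrite /ip_norm (inner0l lipP) /= sqrtr0.
Qed.

Lemma maximal_lin c p q : maximal_on ip I A p -> maximal_on ip I A q ->
  maximal_on ip I A (c *: p.1 + q.1, c *: p.2 + q.2).
Proof.
by move=> hp hq r mr; rewrite /= !(inner_linl lipP) (hp r mr) (hq r mr).
Qed.

End MinimalMaximal.

(** * Uniqueness of boundary values *)

Section BoundaryValues.
Context {R : realType} {H : completeNormedModType R[i]}.
Local Notation mu := (@lebesgue_measure R).

Lemma cts_continuous (f : R -> H) : cts_fun f -> continuous f.
Proof.
move=> cf t; apply/cvgrPdist_lt => e e0.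
have eE : e = (complex.Re e)%:C by rewrite RRe_real// gtr0_real.
have [r r0 hr] := cf t (complex.Re e) ltac:(by move: e0; rewrite {1}eE ltcR).
by apply/nbhs_normP; exists r => //= s /hr; rewrite eE -ltcR rnormE.
Qed.

Variables (I J : interval R) (c : R).

Lemma cts_boundary_value u f : cts_fun f -> represents (u : L2 H I) f -> boundary_value J c u (f c).
Proof.
by move=> cf rf; exists f; split=> //; apply: continuous_subspaceT; exact: cts_continuous.
Qed.

Hypothesis cJ : c \in J.
Hypothesis nearc : forall e, 0 < e -> exists p q, p < q /\
  forall t, p <= t <= q -> [/\ t \in I, t \in J & `|c - t| < e].

(** Two representatives agree almost everywhere on [I], and by [nearc] there are segments of
    positive length in [I] arbitrarily close to [c]. *)
Lemma boundary_value_uniq (u : L2 H I) x y : boundary_value J c u x -> boundary_value J c u y -> x = y.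
Proof.
move=> [f [cf rf <-]] [g [cg rg <-]].
have eps (h : R -> H) e : {within [set` J], continuous h} -> 0 < e ->
    exists2 r, 0 < r & forall t, t \in J -> `|c - t| < r -> rnorm (h c - h t) < e.
  move=> /subspace_continuousP/(_ c cJ)/cvgrPdist_lt hc e0.
  have eC : 0 < e%:C by rewrite ltcR.
  have /nbhs_normP[r /= r0 hr] := hc _ eC.
  by exists r => // t tJ ct; rewrite -ltcR rnormE; exact: hr.
apply/eqP; rewrite -subr_eq0; apply/eqP/rnorm_eq0/eqP; rewrite eq_le rnorm_ge0 andbT.
apply/ler_addgt0Pr => e e0; have e2 : 0 < e / 2 by rewrite divr_gt0.
have [r r0 hr] := eps _ _ cf e2; have [q q0 hq] := eps _ _ cg e2.
have [s [t [st hst]]] := nearc (e := Num.min r q) ltac:(by rewrite lt_min r0).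
have [z /hst[zI zJ]] := ae_pt st (ae_and rf rg).
rewrite lt_min => /andP[/(hr _ zJ) h1 /(hq _ zJ) h2] [/(_ zI) f1 /(_ zI) g1].
have -> : f c - g c = (f c - f z) - (g c - g z).
  by rewrite -f1 -g1 opprB addrA subrK.
by apply: le_trans (rnormD _ _) _; rewrite rnormN; lra.
Qed.

End BoundaryValues.

Section Green.
Context {R : realType} {H : completeNormedModType R[i]}.
Variable ip : {dot H for Num.conj}.
Hypothesis norm_ip : forall x : H, `|x| ^+ 2 = ip x x.
Hypothesis sep : exists D : set H, countable D /\ dense D.
Local Notation rip := (re_ip ip).
Local Notation mu := (@lebesgue_measure R).
Variable A : set (H * H).
Hypothesis sA : selfadjoint ip A.
(** One end point at a time: [s] will be [1] for the half-line to the left of [c] and [-1] for the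
    one to the right, the signs found in [left_trace] and [right_trace]. *)
Variables (I J : interval R) (c s : R).
Local Notation lip := (L2_ip ip).
Local Notation max := (maximal_on ip I A).
Hypothesis cJ : c \in J.
Hypothesis nearc : forall e, 0 < e -> exists p q, p < q /\
  forall t, p <= t <= q -> [/\ t \in I, t \in J & `|c - t| < e].
Hypothesis trace : forall u g, weak_sol ip A I u g ->
  exists U : R -> H, [/\ cts_fun U, {ae mu, forall t, t \in I -> u t = U t}
    & rnorm (U c) ^+ 2 = 2 * s * \int[mu]_(r in [set` I]) rip ('i%C *: u r) (g r)].
Hypothesis lift : forall x, exists (p : L2 H I * L2 H I) V,
  [/\ max p, cts_fun V, represents p.1 V & V c = x].
Local Notation bv := (boundary_value J c).
Let uniq := @boundary_value_uniq R H I J c cJ nearc.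
Let lipP : inner_product (@L2_ip R H I ip) := L2_inner norm_ip I.
Hypothesis s2 : s * s = 1.

Lemma trace_onto x : exists2 p, max p & bv p.1 x.
Proof.
by have [p [V [mp cV rV <-]]] := lift x; exists p => //; exact: cts_boundary_value.
Qed.

Lemma trace_norm p : max p -> exists2 x, bv p.1 x & rnorm x ^+ 2 = - 2 * s * complex.Im (lip p.1 p.2).
Proof.
case: p => u g mp; have [U [cU uU nU]] := trace (maximal_weak norm_ip sep mp).
exists (U c); first by apply: cts_boundary_value.
rewrite nU (L2_ip_repr norm_ip) /=; have := rintiC norm_ip (L2_sq u) (L2_sq g).
by rewrite /re_rint => ->; ring.
Qed.

Lemma trace_sqr p x : max p -> bv p.1 x -> rnorm x ^+ 2 = - 2 * s * complex.Im (lip p.1 p.2).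
Proof. by move=> mp px; have [y py <-] := trace_norm mp; rewrite (uniq px py). Qed.

(** A [boundary_value] comes with continuity on [J] only; [trace] supplies a representative
    continuous on the line, and uniqueness identifies its value. *)
Lemma trace_lin a p q x y : max p -> max q -> bv p.1 x -> bv q.1 y -> bv (a *: p.1 + q.1) (a *: x + y).
Proof.
move=> mp mq px qy.
have rep r z : max r -> bv r.1 z -> exists f, [/\ cts_fun f, represents r.1 f & f c = z].
  case: r => u g mr bz; have [U [cU uU _]] := trace (maximal_weak norm_ip sep mr).
  by exists U; split=> //; apply: (uniq _ bz); apply: cts_boundary_value.
have [f [cf rf <-]] := rep _ _ mp px; have [g [cg rg <-]] := rep _ _ mq qy.
apply: (@cts_boundary_value _ _ _ _ _ _ (fun t => a *: f t + g t)); last exact: representsZD.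
apply: ctsD => // t e e0.
pose k := complex.Re `|a|; have k0 : 0 <= k by rewrite -lecR RRe_real ?normr_real// normr_ge0.
have [r r0 hr] := cf t (e / (k + 1)) ltac:(by rewrite divr_gt0//; lra).
exists r => // z /hr; rewrite -scalerBr rnormZ -/k ltr_pdivlMr; last lra.
by have := rnorm_ge0 (f t - f z); nra.
Qed.

Lemma green_re p q x y : max p -> max q -> bv p.1 x -> bv q.1 y ->
  rip x y = - s * complex.Im (lip p.1 q.2 - lip p.2 q.1).
Proof.
move=> mp mq px qy.
have := trace_sqr (maximal_lin norm_ip 1 mp mq) (trace_lin 1 mp mq px qy).
rewrite !scale1r (rnorm_sqrD norm_ip) (trace_sqr mp px) (trace_sqr mq qy).
cbn [fst snd]; rewrite !(innerDl lipP) !(innerDr lipP) (innerC lipP q.1 p.2).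
case: (lip p.1 q.2) (lip p.2 q.1) (lip p.1 p.2) (lip q.1 q.2) => [a b] [d e] [f g] [h k] /=.
lra.
Qed.

(** [green_re] for [q] gives the imaginary part and for ['i q] the real part; as [s * s = 1], the
    factor [s] is its own inverse. *)
Lemma green p q x y : max p -> max q -> bv p.1 x -> bv q.1 y ->
  lip p.1 q.2 - lip p.2 q.1 = - (s%:C * 'i%C) * ip x y.
Proof.
move=> mp mq px qy.
have max0 : max 0 by move=> r _; rewrite /= !(inner0l lipP).
have bv0 : bv (0 : L2 H I) 0.
  apply: (@cts_boundary_value _ _ _ _ _ _ (fun=> 0)); last exact: represents0.
  by move=> t e e0; exists 1 => // z _; rewrite subrr rnorm0.
have h1 := green_re mp mq px qy.
have := green_re mp (maximal_lin norm_ip 'i%C mq max0) px (trace_lin 'i%C mq max0 qy bv0).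
rewrite !addr0; cbn [fst snd]; rewrite -Im_ip !(innerZr lipP).
move: h1; rewrite {1}/re_ip; case: (lip p.1 q.2) (lip p.2 q.1) (ip x y) => [a b] [d e] [f g] /= h1 h2.
apply/eqP; rewrite eq_complex /=; apply/andP; split; apply/eqP.
  transitivity ((s * s) * (a - d)); first by rewrite s2 mul1r.
  by transitivity (s * g); [rewrite h2|]; ring.
transitivity ((s * s) * (b - e)); first by rewrite s2 mul1r.
by transitivity (- s * f); [rewrite h1|]; ring.
Qed.

(** An element of the minimal operator pairs symmetrically with all of the maximal one, so by
    Green's formula its trace is orthogonal to every trace; all vectors are traces, so it is
    orthogonal to itself. *)
Lemma minimal_trace p : minimal_on ip I A p -> bv p.1 0.
Proof.
move=> mp; have Mp := minimal_maximal norm_ip sep sA mp.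
have [x px _] := trace_norm Mp; suff -> : 0 = x by [].
have [q mq qx] := trace_onto x.
have := green Mp mq px qx; have := mq p mp.
rewrite (innerC lipP p.1) (innerC lipP p.2) => ->; rewrite subrr => /esym/eqP.
rewrite mulf_eq0 oppr_eq0 mulf_eq0 => /orP[/orP[]|] /eqP.
- by move=> [s0]; move: s2; rewrite s0 mulr0 => /eqP; rewrite eq_sym oner_eq0.
- by move=> [/eqP]; rewrite oner_eq0.
- by rewrite -norm_ip => /eqP; rewrite sqrf_eq0 normr_eq0 => /eqP.
Qed.

End Green.

(** * The two half-lines together *)

Section HalfLines.
Context {R : realType} {H : completeNormedModType R[i]}.
Variable ip : {dot H for Num.conj}.
Hypothesis norm_ip : forall x : H, `|x| ^+ 2 = ip x x.
Hypothesis sep : exists D : set H, countable D /\ dense D.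
Variables (a b : R) (A : set (H * H)).
Hypothesis sA : selfadjoint ip A.
Local Notation I1 := (`]-oo, a[ : interval R).
Local Notation I2 := (`]b, +oo[ : interval R).
Local Notation J1 := (`]-oo, a] : interval R).
Local Notation J2 := (`[b, +oo[ : interval R).

Let a1 : a \in J1. Proof. by rewrite in_itv /=. Qed.
Let b2 : b \in J2. Proof. by rewrite in_itv /= lexx. Qed.

Let near1 e : 0 < e -> exists p q, p < q /\
  forall t, p <= t <= q -> [/\ t \in I1, t \in J1 & `|a - t| < e].
Proof.
move=> e0; exists (a - e / 2), (a - e / 4); split=> [|t /andP[h1 h2]]; first by lra.
by rewrite !in_itv /= ltr_norml; split; [lra|lra|apply/andP; split; lra].
Qed.

Let near2 e : 0 < e -> exists p q, p < q /\
  forall t, p <= t <= q -> [/\ t \in I2, t \in J2 & `|b - t| < e].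
Proof.
move=> e0; exists (b + e / 4), (b + e / 2); split=> [|t /andP[h1 h2]]; first by lra.
by rewrite !in_itv /= !andbT ltr_norml; split; [lra|lra|apply/andP; split; lra].
Qed.

Let trace1 u g : weak_sol ip A I1 u g ->
  exists U : R -> H, [/\ cts_fun U, {ae (@lebesgue_measure R), forall t, t \in I1 -> u t = U t}
    & rnorm (U a) ^+ 2 = 2 * 1 * \int[@lebesgue_measure R]_(r in [set` I1]) re_ip ip ('i%C *: u r) (g r)].
Proof. by move=> /(left_trace norm_ip sep sA)[U [? ? h]]; exists U; rewrite mulr1. Qed.

Let trace2 u g : weak_sol ip A I2 u g ->
  exists U : R -> H, [/\ cts_fun U, {ae (@lebesgue_measure R), forall t, t \in I2 -> u t = U t}
    & rnorm (U b) ^+ 2 = 2 * (-1) * \int[@lebesgue_measure R]_(r in [set` I2]) re_ip ip ('i%C *: u r) (g r)].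
Proof. by move=> /(right_trace norm_ip sep sA)[U [? ? h]]; exists U; rewrite mulrN1. Qed.

Let lift1 x : exists (p : L2 H I1 * L2 H I1) V,
  [/\ maximal_on ip I1 A p, cts_fun V, represents p.1 V & V a = x].
Proof.
apply: (trace_lift norm_ip sep sA (sg := -1)); first by right.
by move=> t; rewrite in_itv /=; lra.
Qed.

Let lift2 x : exists (p : L2 H I2 * L2 H I2) V,
  [/\ maximal_on ip I2 A p, cts_fun V, represents p.1 V & V b = x].
Proof.
apply: (trace_lift norm_ip sep sA (sg := 1)); first by left.
by move=> t; rewrite in_itv /= andbT; lra.
Qed.

Let sq1 : 1 * 1 = 1 :> R. Proof. exact: mulr1. Qed.
Let sqN1 : (-1) * (-1) = 1 :> R. Proof. by rewrite mulrNN mulr1. Qed.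

Local Notation X := (L2pair H a b).
Local Notation pip := (L2pair_ip ip a b).
Local Notation L0 := (minimal_operator ip a b A).
Local Notation L := (maximal_operator ip a b A).

Definition traces (u : X) (z : H * H) :=
  boundary_value J1 a u.1 z.1 /\ boundary_value J2 b u.2 z.2.

Lemma traces_ex p : L p -> exists z, traces p.1 z.
Proof.
move=> [m1 m2].
have [x hx _] := trace_norm norm_ip sep J1 trace1 m1.
by have [y hy _] := trace_norm norm_ip sep J2 trace2 m2; exists (x, y).
Qed.

Lemma traces_uniq u z z' : traces u z -> traces u z' -> z = z'.
Proof.
move=> [h1 h2] [h3 h4]; rewrite [z]surjective_pairing [z']surjective_pairing.
by rewrite (boundary_value_uniq a1 near1 h1 h3) (boundary_value_uniq b2 near2 h2 h4).
Qed.

Lemma traces_onto z : exists2 p, L p & traces p.1 z.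
Proof.
have [[u1 g1] m1 h1] := trace_onto J1 lift1 z.1; have [[u2 g2] m2 h2] := trace_onto J2 lift2 z.2.
by exists ((u1, u2), (g1, g2)); split; [exact: m1|exact: m2|exact: h1|exact: h2].
Qed.

Lemma traces_green p q z z' : L p -> L q -> traces p.1 z -> traces q.1 z' ->
  pip p.1 q.2 - pip p.2 q.1 = - 'i%C * (ip z.1 z'.1 - ip z.2 z'.2).
Proof.
move=> [m1 m2] [n1 n2] [h1 h2] [k1 k2].
have g1 := green norm_ip sep a1 near1 trace1 sq1 m1 n1 h1 k1.
have g2 := green norm_ip sep b2 near2 trace2 sqN1 m2 n2 h2 k2.
transitivity ((L2_ip ip p.1.1 q.2.1 - L2_ip ip p.2.1 q.1.1) +
              (L2_ip ip p.1.2 q.2.2 - L2_ip ip p.2.2 q.1.2)).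
  by rewrite /L2pair_ip /sum_ip opprD addrACA.
rewrite [X in X + _]g1 [X in _ + X]g2 rmorphN rmorph1; ring.
Qed.

Lemma minimal_traces p : L0 p -> L p /\ traces p.1 0.
Proof.
move=> [m1 m2]; split; split.
- exact: (minimal_maximal norm_ip sep sA m1).
- exact: (minimal_maximal norm_ip sep sA m2).
- exact: (minimal_trace norm_ip sep sA a1 near1 trace1 lift1 sq1 m1).
- exact: (minimal_trace norm_ip sep sA b2 near2 trace2 lift2 sqN1 m2).
Qed.

Lemma pair_inner : inner_product pip.
Proof. by apply: sum_inner; exact: L2_inner. Qed.

Lemma pair_re0 u : complex.Re (pip u u) = 0 -> u = 0.
Proof.
have [_ _ p1] := L2_inner norm_ip I1; have [_ _ p2] := L2_inner norm_ip I2.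
have E : complex.Re (pip u u) = complex.Re (L2_ip ip u.1 u.1) + complex.Re (L2_ip ip u.2 u.2).
  by rewrite /L2pair_ip /sum_ip raddfD.
rewrite E => /eqP; rewrite paddr_eq0 ?p1 ?p2// => /andP[/eqP /(L2_re0 norm_ip) h1 /eqP /(L2_re0 norm_ip) h2].
by rewrite [u]surjective_pairing h1 h2.
Qed.

Lemma minimal0 (I : interval R) : minimal_on ip I A 0.
Proof. by apply: (preminimal_minimal norm_ip); exact: pre0. Qed.

(** Testing with elements that vanish on one half-line separates the two components. *)
Lemma adjoint_minimal : adjoint pip L0 `<=` L.
Proof.
move=> p hp; split=> q mq.
  have Lq : L0 ((q.1, 0), (q.2, 0)).
    by split; [rewrite /= -surjective_pairing|exact: minimal0].
  by have := hp _ Lq; rewrite /L2pair_ip /sum_ip !(inner0r (L2_inner norm_ip I2)) !addr0.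
have Lq : L0 ((0, q.1), (0, q.2)).
  by split; [exact: minimal0|rewrite /= -surjective_pairing].
by have := hp _ Lq; rewrite /L2pair_ip /sum_ip !(inner0r (L2_inner norm_ip I1)) !add0r.
Qed.

Lemma minimal_dense : densely_defined pip L0.
Proof.
have d1 : densely_defined (@L2_ip R H I1 ip) (minimal_on ip I1 A).
  have oI : open [set` I1] by exact: interval_open.
  have Ine : exists t, t \in I1 by exists (a - 1); rewrite in_itv /=; lra.
  move=> x e e0; have [p [/(preminimal_minimal norm_ip) ? ?]] :=
    preminimal_dense norm_ip sep sA Ine oI x e0.
  by exists p.
have d2 : densely_defined (@L2_ip R H I2 ip) (minimal_on ip I2 A).
  have oI : open [set` I2] by exact: interval_open.
  have Ine : exists t, t \in I2 by exists (b + 1); rewrite in_itv /= andbT; lra.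
  move=> x e e0; have [p [/(preminimal_minimal norm_ip) ? ?]] :=
    preminimal_dense norm_ip sep sA Ine oI x e0.
  by exists p.
move=> x e e0; have e2 : 0 < e / 2 by rewrite divr_gt0.
have [p [mp hp]] := d1 x.1 _ e2; have [q [mq hq]] := d2 x.2 _ e2.
exists ((p.1, q.1), (p.2, q.2)); split; first by split; rewrite /= -surjective_pairing.
apply: le_lt_trans (sum_norm_le _ _ _) _; [exact: L2_inner|exact: L2_inner|].
rewrite /=; lra.
Qed.

End HalfLines.

(** * Selfadjoint extensions *)

Section IsometricRelations.
Context {R : realType} {H : completeNormedModType R[i]}.
Variable ip : {dot H for Num.conj}.
Hypothesis norm_ip : forall x : H, `|x| ^+ 2 = ip x x.
Let dotP : inner_product ip := dot_inner ip.

Lemma ip_ext x y : (forall h, ip x h = ip y h) -> x = y.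
Proof.
move=> h; apply/eqP; rewrite -subr_eq0 -normr_eq0 -sqrf_eq0 norm_ip.
by rewrite {1}(innerBl dotP) h subrr.
Qed.

Section Relation.
Variable B : set (H * H).
(** Equality with the annihilator contains everything: linearity, isometry and closedness of [B] are
    read off from it. *)
Hypothesis B_adjoint : forall z, B z <-> forall z', B z' -> ip z.1 z'.1 = ip z.2 z'.2.

Let B_sym z z' : B z -> B z' -> ip z.1 z'.1 = ip z.2 z'.2.
Proof. by move=> /B_adjoint; apply. Qed.

Let B_adj z : (forall z', B z' -> ip z.1 z'.1 = ip z.2 z'.2) -> B z.
Proof. by move=> ?; apply/B_adjoint. Qed.

Let B0 : B 0. Proof. by apply: B_adj => v _; rewrite /= !(inner0l dotP). Qed.

Let B_lin c z z' : B z -> B z' -> B (c *: z + z').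
Proof.
move=> Bz Bz'; apply: B_adj => w Bw /=.
by rewrite !(inner_linl dotP) (B_sym Bz Bw) (B_sym Bz' Bw).
Qed.

Let B_norm z : B z -> rnorm z.1 = rnorm z.2.
Proof.
move=> Bz; have := B_sym Bz Bz; rewrite -!norm_ip => /eqP.
rewrite eqrXn2 ?normr_ge0// => /eqP.
by rewrite /rnorm => ->.
Qed.

Let B_cl z : (forall e, 0 < e -> exists z', [/\ B z', rnorm (z.1 - z'.1) < e & rnorm (z.2 - z'.2) < e]) -> B z.
Proof.
move=> h; apply: B_adj => w Bw; apply/(inner_eqP dotP).
have key k : B k -> complex.Re (ip z.1 k.1) = complex.Re (ip z.2 k.2).
  move=> Bk; apply: eps_eq => e e0; pose K := rnorm k.1 + rnorm k.2 + 1.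
  have K0 : 0 < K by have := rnorm_ge0 k.1; have := rnorm_ge0 k.2; rewrite /K; lra.
  have [z' [Bz' h1 h2]] := h (e / K) ltac:(by rewrite divr_gt0).
  have E : complex.Re (ip z.1 k.1) - complex.Re (ip z.2 k.2) = re_ip ip (z.1 - z'.1) k.1 - re_ip ip (z.2 - z'.2) k.2.
    by rewrite !ripBl /re_ip (B_sym Bz' Bk); ring.
  rewrite E; apply: le_trans (ler_normB _ _) _.
  have c1 := rip_CS norm_ip (z.1 - z'.1) k.1; have c2 := rip_CS norm_ip (z.2 - z'.2) k.2.
  have d1 : rnorm (z.1 - z'.1) * rnorm k.1 <= e / K * rnorm k.1 by apply: ler_wpM2r; [exact: rnorm_ge0|exact: ltW].
  have d2 : rnorm (z.2 - z'.2) * rnorm k.2 <= e / K * rnorm k.2 by apply: ler_wpM2r; [exact: rnorm_ge0|exact: ltW].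
  have d3 : e / K * rnorm k.1 + e / K * rnorm k.2 <= e.
    rewrite -mulrDr mulrAC ler_pdivrMr//; apply: ler_wpM2l; first exact: ltW.
    by rewrite /K; lra.
  by apply: le_trans d3; apply: lerD; [exact: le_trans d1|exact: le_trans d2].
split; first exact: key.
have Biw : B ('i%C *: w).
  by have := B_lin 'i%C Bw B0; rewrite addr0.
exact: key Biw.
Qed.

Let B_diff z z' : B z -> B z' -> B (z - z').
Proof. by move=> Bz Bz'; have := B_lin (-1) Bz' Bz; rewrite scaleN1r addrC. Qed.

(* Cauchy sequences of first components lift isometrically to the second ones, and a vector
   orthogonal to all first components is one itself, paired with 0. *)
Lemma isometric_relation_full x : exists y, B (x, y).
Proof.
apply: (@closed_subspace_full _ _ ip norm_ip (fun x => exists y, B (x, y))) => [|c u v [y By] [k Bk]|u hu|z hz].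
- by exists 0; exact: B0.
- by exists (c%:C *: y + k); exact: (B_lin c%:C By Bk).
- have half_gt0 n : 0 < (2^-1 : R) ^+ n by rewrite exprn_gt0.
  have h n : exists z, B z /\ rnorm (u - z.1) < 2^-1 ^+ n.
    by have [x' [[y' By'] h']] := hu _ (half_gt0 n); exists (x', y').
  have [f hf] := choice h.
  have [y hy] : exists l : H, (f n).2 @[n --> \oo] --> l.
    apply: rnorm_cauchy => e e0; have [N hN] := half_lt (divr_gt0 e0 (ltr0n _ 2)).
    have small n : (N <= n)%N -> rnorm (u - (f n).1) < e / 2.
      move=> Nn; have [_ h1] := hf n; apply: lt_trans h1 _; apply: le_lt_trans hN.
      by apply: ler_wiXn2l => //; lra.
    exists N => m n Nm Nn.
    have [Bm _] := hf m; have [Bn _] := hf n.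
    rewrite -[(f m).2 - _]/((f m - f n).2) -B_norm; last exact: B_diff.
    have -> : (f m - f n).1 = (u - (f n).1) - (u - (f m).1) by rewrite /= opprB [RHS]addrC addrA subrK.
    apply: le_lt_trans (rnormD _ _) _; rewrite rnormN.
    have := small _ Nm; have := small _ Nn; lra.
  exists y; apply: B_cl => e e0 /=.
  have [N hN] := (rnorm_cvgP _ _).1 hy _ e0; have [M hM] := half_lt e0.
  have [Bn h1] := hf (maxn N M); exists (f (maxn N M)); split=> //; last by apply: hN; rewrite leq_maxl.
  apply: lt_trans h1 _; apply: le_lt_trans hM; apply: ler_wiXn2l; [lra|lra|exact: leq_maxr].
- have Bz : B (z, 0).
    apply: B_adj => w Bw /=; rewrite (inner0l dotP).
    have hw c : re_ip ip z (c *: w.1) = 0.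
      by apply: hz; exists (c *: w.2); have := B_lin c Bw B0; rewrite addr0.
    by rewrite (ipE ip) -[in X in X +i* _](scale1r w.1) !hw.
  by have := B_norm Bz; rewrite /= rnorm0; exact: rnorm_eq0.
Qed.

End Relation.

(** The hypothesis is symmetric in the two components, so [isometric_relation_full] applies to the
    transposed relation as well. This gives surjectivity and, since second components exhaust [H],
    single-valuedness. *)
Lemma isometric_relation_unitary (B : set (H * H)) :
  (forall z, B z <-> forall z', B z' -> ip z.1 z'.1 = ip z.2 z'.2) ->
  exists W, unitary ip W /\ forall x y, B (x, y) <-> y = W x.
Proof.
move=> BP; have [W hW] := choice (isometric_relation_full BP).
have BP' z : B (z.2, z.1) <-> forall z', B (z'.2, z'.1) -> ip z.1 z'.1 = ip z.2 z'.2.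
  split=> [/BP h z' /h/esym//|h]; apply/BP => z' Bz'.
  by have := h (z'.2, z'.1); rewrite /= -surjective_pairing => /(_ Bz')/esym.
have uniq x y : B (x, y) -> y = W x.
  move=> Bxy; apply: ip_ext => k.
  have [x' /= Bk] := isometric_relation_full BP' k.
  by have /BP/(_ _ Bk) /= <- := Bxy; have /BP/(_ _ Bk) /= := hW x.
have BW x y : B (x, y) <-> y = W x by split=> [|->]; [exact: uniq|exact: hW].
exists W; split=> //; split.
- move=> c x y; symmetry; apply: uniq; apply/BP => z Bz.
  have /BP/(_ _ Bz) /= h1 := hW x; have /BP/(_ _ Bz) /= h2 := hW y.
  by rewrite /= !(inner_linl dotP) h1 h2.
- by move=> x y; have /BP/(_ _ (hW y)) /= -> := hW x.
- by move=> y; have [x /= /BW ->] := isometric_relation_full BP' y; exists x.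
Qed.

End IsometricRelations.

Section Extensions.
Context {R : realType} {H : completeNormedModType R[i]}.
Variable ip : {dot H for Num.conj}.
Hypothesis norm_ip : forall x : H, `|x| ^+ 2 = ip x x.
Hypothesis sep : exists D : set H, countable D /\ dense D.
Variables (a b : R) (A : set (H * H)).
Hypothesis sA : selfadjoint ip A.
Local Notation X := (L2pair H a b).
Local Notation pip := (L2pair_ip ip a b).
Local Notation L0 := (minimal_operator ip a b A).
Local Notation L := (maximal_operator ip a b A).
Local Notation LW := (boundary_operator ip a b A).
Let dotP : inner_product ip := dot_inner ip.
Let pipP : inner_product pip := pair_inner norm_ip a b.

Lemma boundary_operatorP W p : LW W p <-> L p /\ exists2 z, traces p.1 z & z.2 = W z.1.
Proof.
split=> [[Lp [x [y [h1 h2 h3]]]]|[Lp [[x y] [h1 h2] h3]]]; split=> //.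
  by exists (x, y).
by exists x, y.
Qed.

(** Green's formula turns the defect of symmetry into the boundary form; [adjoint_green] reads the
    same identity in the other direction. *)
Lemma symmetric_green (G : set (X * X)) p z : G `<=` L -> L p -> traces p.1 z ->
  (forall q z', G q -> traces q.1 z' -> ip z.1 z'.1 = ip z.2 z'.2) -> adjoint pip G p.
Proof.
move=> GL Lp pz h q Gq; have [z' qz] := traces_ex norm_ip sep sA (GL _ Gq).
have := traces_green norm_ip sep sA Lp (GL _ Gq) pz qz; rewrite (h _ _ Gq qz) subrr mulr0.
by move/eqP; rewrite subr_eq0 => /eqP.
Qed.

Lemma adjoint_green (G : set (X * X)) p q z z' : G `<=` L -> L p -> traces p.1 z -> adjoint pip G p ->
  G q -> traces q.1 z' -> ip z.1 z'.1 = ip z.2 z'.2.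
Proof.
move=> GL Lp pz hp Gq qz; have := traces_green norm_ip sep sA Lp (GL _ Gq) pz qz.
rewrite (hp _ Gq) subrr => /esym/eqP; rewrite mulf_eq0 oppr_eq0 => /orP[|].
  by rewrite eq_complex /= oner_eq0 andbF.
by rewrite subr_eq0 => /eqP.
Qed.

Lemma unitary0 (W : H -> H) : unitary ip W -> W 0 = 0.
Proof.
move=> [lW _ _]; have := lW (-1) 0 0; rewrite scaler0 addr0 scaleN1r addNr.
by [].
Qed.

Lemma boundary_operator_minimal W : unitary ip W -> L0 `<=` LW W.
Proof.
move=> uW p /(minimal_traces norm_ip sep sA)[Lp p0]; apply/boundary_operatorP; split=> //.
by exists 0 => //=; rewrite unitary0.
Qed.

Lemma densely_definedS (G G' : set (X * X)) : G `<=` G' -> densely_defined pip G -> densely_defined pip G'.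
Proof. by move=> GG dG x e /dG -/(_ x)[p [/GG ? ?]]; exists p. Qed.

Lemma boundary_operator_selfadjoint W : unitary ip W -> selfadjoint pip (LW W).
Proof.
move=> uW; have [lW iW sW] := uW.
have LWL : LW W `<=` L by move=> p /boundary_operatorP[].
have mL := boundary_operator_minimal uW.
have dL := densely_definedS mL (minimal_dense norm_ip sep sA).
have E : adjoint pip (LW W) = LW W.
  apply/seteqP; split=> p hp.
    have Lp : L p by apply: (adjoint_minimal norm_ip) => q /mL; exact: hp.
    have [z pz] := traces_ex norm_ip sep sA Lp.
    apply/boundary_operatorP; split=> //; exists z => //.
    (* By surjectivity every [k] is some [W x], and [(x, W x)] is the pair of traces of an element
       of [L_W]; pairing with it forces [z.2 = W z.1]. *)
    apply: (ip_ext norm_ip) => k; have [x <-] := sW k; rewrite iW; symmetry.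
    have [q Lq qz] := traces_onto norm_ip sep a b sA (x, W x).
    have Gq : LW W q by apply/boundary_operatorP; split=> //; exists (x, W x).
    exact: (adjoint_green LWL Lp pz hp Gq qz).
  have /boundary_operatorP[Lp [z pz zW]] := hp.
  apply: (symmetric_green LWL Lp pz) => q z' /boundary_operatorP[Lq [z'' qz zW']] qz'.
  by rewrite (traces_uniq qz' qz) zW zW' iW.
split; [rewrite -E|exact: dL|exact: E].
apply: (adjoint_linear pipP _ dL); exact: (pair_re0 norm_ip).
Qed.

Section SelfadjointExtension.
Variable Lt : set (X * X).
Hypothesis sL : selfadjoint pip Lt.
Hypothesis minL : L0 `<=` Lt.

Let B (z : H * H) := exists2 p, Lt p & traces p.1 z.

(** Adjoints reverse inclusions: [Lt] equals its adjoint, which lies in the adjoint of [L0]. *)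
Let LtL : Lt `<=` L.
Proof.
have [_ _ E] := sL; rewrite -E => p hp; apply: (adjoint_minimal norm_ip) => q /minL.
exact: hp.
Qed.

(** Selfadjointness transported to traces. From right to left, [z] is first lifted to an element of
    the maximal operator, which then belongs to the adjoint of [Lt]. *)
Let B_adjoint z : B z <-> forall z', B z' -> ip z.1 z'.1 = ip z.2 z'.2.
Proof.
have [_ _ E] := sL; split=> [[p Lp pz] z' [q Lq qz]|h].
  by apply: (adjoint_green LtL (LtL Lp) pz _ Lq qz); rewrite E.
have [p Lp pz] := traces_onto norm_ip sep a b sA z; exists p => //; rewrite -E.
by apply: (symmetric_green LtL Lp pz) => q z' Lq qz; apply: h; exists q.
Qed.

Lemma selfadjoint_extension : exists W, unitary ip W /\ Lt = LW W.
Proof.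
have [W [uW BW]] := isometric_relation_unitary norm_ip B_adjoint.
exists W; split=> //; apply/seteqP; split=> p Lp.
  have [[x y] pz] := traces_ex norm_ip sep sA (LtL Lp).
  apply/boundary_operatorP; split; first exact: LtL.
  by exists (x, y) => //=; apply/BW; exists p.
have /boundary_operatorP[Mp [[x y] pz /= /BW Bxy]] := Lp.
have [_ _ <-] := sL; apply: (symmetric_green LtL Mp pz) => q z' Lq qz.
by have /B_adjoint := Bxy; apply; exists q.
Qed.

End SelfadjointExtension.

(** Lift the pair [(x, W x)] to an element of [L_W]; its traces are unique and must also satisfy the
    condition of [W']. *)
Lemma boundary_operator_inj W W' : unitary ip W -> unitary ip W' -> LW W = LW W' -> W = W'.
Proof.
move=> uW uW' E; apply/funext => x.
have [p Lp pz] := traces_onto norm_ip sep a b sA (x, W x).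
have : LW W p by apply/boundary_operatorP; split=> //; exists (x, W x).
by rewrite E => /boundary_operatorP[_ [z /(traces_uniq pz) <-]].
Qed.

End Extensions.

Theorem theorem2p2 (R : realType) (H : completeNormedModType R[i])
    (ip : {dot H for Num.conj})
    (norm_ip : forall x : H, `|x| ^+ 2 = ip x x)
    (separableH : exists D : set H, countable D /\ dense D)
    (nontrivialH : exists x : H, x != 0)
    (a b : R) (ltab : a < b)
    (A : set (H * H)) (selfadjointA : selfadjoint ip A) :
  (forall Lt : set (L2pair H a b * L2pair H a b),
     selfadjoint (L2pair_ip ip a b) Lt ->
     minimal_operator ip a b A `<=` Lt ->
     exists! W : H -> H, unitary ip W /\ Lt = boundary_operator ip a b A W) /\
  (forall W : H -> H, unitary ip W ->
     selfadjoint (L2pair_ip ip a b) (boundary_operator ip a b A W) /\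
     minimal_operator ip a b A `<=` boundary_operator ip a b A W).
Proof.
split=> [Lt sL mL|W uW].
  have [W [uW E]] := selfadjoint_extension norm_ip separableH selfadjointA sL mL.
  exists W; split=> // W' [uW' E'].
  exact: (boundary_operator_inj norm_ip separableH selfadjointA uW uW' (etrans (esym E) E')).
split; first exact: boundary_operator_selfadjoint.
exact: boundary_operator_minimal.
Qed.
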